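(* Let $(M,g)$ be either the unit sphere $S^n\subset\mathbb{R}^{n+1}$ with its standard induced metric for some $n\ge 2$, or the square torus $T^2=S^1\times S^1=\mathbb{R}^2/(2\pi\mathbb{Z})^2$ with its flat metric. Then there exist a smooth function $f:M\to\mathbb{R}$ with $f>0$ everywhere and $f\perp\mathscr{U}_1$, and a smooth function $\phi:M\to\mathbb{R}$ with $\int_M f\phi\, d\mu=0$, such that $$\int_M|\nabla\phi|^2\,d\mu<\lambda_1\int_M\phi^2\,d\mu .$$
   Context: For a closed Riemannian manifold $(M,g)$, $d\mu$ is the Riemannian measure and $\Delta$ is the Laplace operator (divergence of the gradient); its eigenvalues are the $\lambda\ge 0$ for which $\Delta u=-\lambda u$ has a nonzero smooth solution $u$. $\lambda_1$ denotes the first (i.e. smallest positive) eigenvalue and $\mathscr{U}_1$ the corresponding eigenspace (the space of all smooth $u$ with $\Delta u=-\lambda_1u$). The symbol $\perp$ means orthogonality in $L^2(M,d\mu)$. *)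

(* Defs.v *)
From HB Require Import structures.
From mathcomp Require Import all_boot all_order all_algebra.
From mathcomp Require Import generic_quotient.
From mathcomp Require Import all_classical all_reals all_analysis.
From mathcomp Require Import ring.

Set Implicit Arguments.
Unset Strict Implicit.
Unset Printing Implicit Defensive.

Import Order.TTheory GRing.Theory Num.Theory.
Import numFieldNormedType.Exports.

Local Open Scope classical_set_scope.
Local Open Scope ring_scope.

(* Lebesgue measure on R^n is built on n.-tuple R, which the library equips   *)
(* with the product sigma-algebra, and then transported to 'rV[R]_n.          *)

Section cons_measure.
Context (R : realType) (n : nat).
Local Notation mR := (measurableTypeR R).
Variable mu : {sigma_finite_measure set (n.-tuple mR) -> \bar R}.

Let cons_pair (p : mR * n.-tuple mR) : n.+1.-tuple mR := [tuple of p.1 :: p.2].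

Let measurable_cons_pair : measurable_fun setT cons_pair.
Proof. exact: measurable_cons. Qed.

Definition cons_measure : set (n.+1.-tuple mR) -> \bar R :=
  pushforward (@lebesgue_measure R \x mu)%E cons_pair.

Let cons_measure0 : cons_measure set0 = 0%E.
Proof. by rewrite /cons_measure /pushforward preimage_set0 measure0. Qed.

Let cons_measure_ge0 A : (0 <= cons_measure A)%E.
Proof. exact: measure_ge0. Qed.

Let cons_measure_sigma_additive : semi_sigma_additive cons_measure.
Proof.
move=> F mF tF mUF; rewrite /cons_measure /pushforward preimage_bigcup.
apply: measure_semi_sigma_additive.
- by move=> k; rewrite -[X in measurable X]setTI; exact: measurable_cons_pair.
- apply/trivIsetP => /= i j _ _ ij; rewrite -preimage_setI.
  by move/trivIsetP : tF => /(_ _ _ _ _ ij) ->//; rewrite preimage_set0.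
- rewrite -preimage_bigcup -[X in measurable X]setTI.
  exact: measurable_cons_pair.
Qed.

HB.instance Definition _ := isMeasure.Build _ _ _ cons_measure
  cons_measure0 cons_measure_ge0 cons_measure_sigma_additive.

Let cons_measure_sigma_finite : sigma_finite setT cons_measure.
Proof.
have /sigma_finiteP[F [TF ndF Foo]] := sigma_finiteT (@lebesgue_measure R).
have /sigma_finiteP[G [TG ndG Goo]] := sigma_finiteT mu.
pose uncons (t : n.+1.-tuple mR) : mR * n.-tuple mR :=
  (tnth t ord0, [tuple of behead t]).
have muncons : measurable_fun setT uncons.
  apply: measurable_fun_pair; first exact: measurable_tnth.
  exact: measurable_behead.
exists (fun k => uncons @^-1` (F k `*` G k)).
  rewrite predeqE => t; split=> // _.
  have [i _ Fi] : (\bigcup_i F i) (uncons t).1 by rewrite -TF.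
  have [j _ Gj] : (\bigcup_i G i) (uncons t).2 by rewrite -TG.
  exists (maxn i j) => //; split.
  - by move: Fi; exact/subsetPset/ndF/leq_maxl.
  - by move: Gj; exact/subsetPset/ndG/leq_maxr.
move=> k; have [? ?] := Foo k; have [? ?] := Goo k; split.
  by rewrite -[X in measurable X]setTI; apply: muncons => //; exact: measurableX.
rewrite /cons_measure /pushforward -comp_preimage.
suff -> : uncons \o cons_pair = id.
  by rewrite preimage_id product_measure1E// lte_mul_pinfty// ge0_fin_numE.
by apply/funext => -[x t]; rewrite /uncons /=; congr pair; exact: val_inj.
Qed.

HB.instance Definition _ := Measure_isSigmaFinite.Build _ _ _ cons_measure
  cons_measure_sigma_finite.

End cons_measure.

Section lebesgue_tuple.
Context (R : realType).
Local Notation mR := (measurableTypeR R).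

Fixpoint lebesgue_tuple n : {sigma_finite_measure set (n.-tuple mR) -> \bar R} :=
  match n with
  | 0 => dirac ([tuple] : 0.-tuple mR)
  | m.+1 => cons_measure (lebesgue_tuple m)
  end.

End lebesgue_tuple.

Section calculus.
Context (R : realType).

Definition row_of_tuple n (t : n.-tuple R) : 'rV[R]_n := \row_i tnth t i.

Definition integral_rV n (D : set 'rV[R]_n) (h : 'rV[R]_n -> R) : R :=
  Rintegral (lebesgue_tuple R n) (@row_of_tuple n @^-1` D)
    (fun t => h (row_of_tuple t)).

Definition partial n (i : 'I_n) (F : 'rV[R]_n -> R) : 'rV[R]_n -> R :=
  fun y => 'D_(delta_mx 0 i) F y.

Fixpoint Ck n (k : nat) (F : 'rV[R]_n -> R) : Prop :=
  match k with
  | 0 => continuous F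
  | k.+1 => continuous F /\
      forall i, (forall y, derivable F y (delta_mx 0 i)) /\ Ck k (partial i F)
  end.

Definition smooth_rV n (F : 'rV[R]_n -> R) : Prop := forall k, Ck k F.

End calculus.

(* A Riemannian manifold of dimension dim, given by local parametrizations    *)
(* (inverses of charts, or local diffeomorphisms) param a : R^dim -> carrier  *)
(* whose images cover the carrier, together with the matrix (g_ij) of the     *)
(* metric in each of them. The parametrization param base maps the Borel set  *)
(* domain injectively onto the complement of a null set of the carrier, so    *)
(* that integrals over the manifold can be computed there.                    *)
Record riemannian (R : realType) := Riemannian {
  dim : nat;
  carrier : Type;
  chart : Type;
  param : chart -> 'rV[R]_dim -> carrier;
  metric : chart -> 'rV[R]_dim -> 'M[R]_dim;
  base : chart;
  domain : set 'rV[R]_dim }.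

Arguments domain {R} r _.

Section geometry.
Context (R : realType) (M : riemannian R).
Implicit Types (a : chart M) (y : 'rV[R]_(dim M)) (u : carrier M -> R).

Definition smooth u : Prop := forall a, smooth_rV (u \o param a).

(* sqrt (det g), the density of the Riemannian measure in coordinates *)
Definition volume_density a y : R := Num.sqrt (\det (metric a y)).

(* (grad u)^i = \sum_j g^ij d_j u; the metric is symmetric *)
Definition grad u a y : 'rV[R]_(dim M) :=
  (\row_j partial j (u \o param a) y) *m invmx (metric a y).

Definition grad_norm2 u a y : R :=
  (grad u a y *m metric a y *m (grad u a y)^T) 0 0.

(* div X = (det g)^(-1/2) \sum_i d_i ((det g)^(1/2) X^i) *)
Definition divergence a (X : 'rV[R]_(dim M) -> 'rV[R]_(dim M)) y : R :=
  (volume_density a y)^-1 *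
  \sum_i partial i (fun z => volume_density a z * X z 0 i) y.

(* The value at the point param a y of the Laplacian of u. *)
Definition laplacian u a y : R := divergence a (grad u a) y.

(* Integral, for the Riemannian measure, of a scalar field h given in the     *)
(* coordinates of param base.                                                 *)
Definition integral_coord (h : 'rV[R]_(dim M) -> R) : R :=
  integral_rV (domain M) (fun y => h y * volume_density (base M) y).

Definition integralM u : R := integral_coord (u \o param (base M)).

Definition dirichlet u : R := integral_coord (grad_norm2 u (base M)).

Definition laplace_eigenspace (lambda : R) : set (carrier M -> R) :=
  [set u | smooth u /\ forall a y, laplacian u a y = - lambda * u (param a y)].

Definition laplace_eigenvalue (lambda : R) : Prop :=
  0 <= lambda /\ exists2 u, laplace_eigenspace lambda u & u <> cst 0.

Definition first_eigenvalue : set R :=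
  [set lambda | [/\ laplace_eigenvalue lambda, 0 < lambda
    & forall mu, laplace_eigenvalue mu -> 0 < mu -> lambda <= mu]].

(* The default value 0, in the absence of a smallest positive eigenvalue,     *)
(* makes a strict upper bound by lambda1 * \int phi^2 false, not vacuous.     *)
Definition lambda1 : R := xget 0 first_eigenvalue.

Definition orthoL2 (u v : carrier M -> R) : Prop :=
  integralM (fun p => u p * v p) = 0.

End geometry.

Section sphere.
Context (R : realType) (n : nat).

Definition norm2 m (x : 'rV[R]_m) : R := \sum_i x 0 i ^+ 2.

Definition sphere_point := {x : 'rV[R]_(1 + n) | norm2 x == 1}.

(* Inverse stereographic projections, from the pole (1, 0) for s = false and  *)
(* from the pole (-1, 0) for s = true.                                        *)
Definition stereo (s : bool) (y : 'rV[R]_n) : 'rV[R]_(1 + n) :=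
  row_mx ((-1) ^+ s * ((norm2 y - 1) / (norm2 y + 1)))%:M
         ((2 / (norm2 y + 1)) *: y).

Lemma norm2_stereo s y : norm2 (stereo s y) == 1.
Proof.
have n0 : norm2 y + 1 != 0.
  by rewrite gt_eqF// ltr_wpDl//; apply: sumr_ge0 => i _; exact: sqr_ge0.
rewrite /norm2 big_split_ord/= big_ord1 row_mxEl mxE eqxx mulr1n.
under eq_bigr do rewrite row_mxEr mxE exprMn.
rewrite -mulr_sumr -/(norm2 y) exprMn sqrr_sign mul1r.
by apply/eqP; field.
Qed.

Definition sphere_param (s : bool) (y : 'rV[R]_n) : sphere_point :=
  exist _ (stereo s y) (norm2_stereo s y).

(* The metric induced by R^(n+1): g_ij is the inner product of the i-th and   *)
(* j-th partial derivatives of the parametrization, which are the rows of the *)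
(* Jacobian matrix. The parametrization stereo false misses one point.        *)
Definition sphere : riemannian R := {|
  dim := n;
  carrier := sphere_point;
  chart := bool;
  param := sphere_param;
  metric := fun s y => 'J (stereo s) y *m ('J (stereo s) y)^T;
  base := false;
  domain := setT |}.

End sphere.

Section torus.
Context (R : realType).

Definition torus_rel (x y : 'rV[R]_2) : bool :=
  `[< forall i, exists k : int, x 0 i - y 0 i = k%:~R * (2 * pi) >].

Lemma torus_rel_refl : reflexive torus_rel.
Proof. by move=> x; apply/asboolP => i; exists 0; rewrite subrr mul0r. Qed.

Lemma torus_rel_sym : symmetric torus_rel.
Proof.
suff H x y : torus_rel x y -> torus_rel y x by move=> x y; apply/idP/idP => /H.
move=> /asboolP xy; apply/asboolP => i; have [k xyk] := xy i.
by exists (- k); rewrite -opprB xyk intrN mulNr.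
Qed.

Lemma torus_rel_trans : transitive torus_rel.
Proof.
move=> y x z /asboolP xy /asboolP yz; apply/asboolP => i.
have [k xyk] := xy i; have [l yzl] := yz i.
by exists (k + l); rewrite intrD mulrDl -xyk -yzl addrA subrK.
Qed.

Canonical torus_equiv :=
  EquivRel torus_rel torus_rel_refl torus_rel_sym torus_rel_trans.

Definition torus_point := {eq_quot torus_rel}%qT.

Definition torus : riemannian R := {|
  dim := 2;
  carrier := torus_point;
  chart := unit;
  param := fun _ y => (\pi_torus_point y)%qT;
  metric := fun _ _ => 1%:M;
  base := tt;
  domain := [set y | forall i, 0 <= y 0 i < 2 * pi] |}.

End torus.

(* Main.v *)
Require Import Defs.
From mathcomp Require Import all_boot all_order all_algebra.
From mathcomp Require Import generic_quotient.
From mathcomp Require Import all_classical all_reals all_analysis.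
From mathcomp Require Import measurable_realfun.
From mathcomp Require Import ring lra.

(* The function phi = 1 satisfies the strict inequality but not the orthogonality
   constraint, so one looks for a nonconstant phi of small energy, invariant under
   the antipodal map (sphere) resp. the translation by (pi, pi) (torus), and for
   an f concentrated where phi has the opposite sign.  With s a linear coordinate
   on S^n, phi = s^2 - 7/(n+7) and f = s^8 + delta work, where delta > 0 is chosen
   to make f and phi orthogonal.  On the torus, with X = cos x and Y = cos y,
   f = (X + Y)^2 + 1/25 and phi = 33 - 48XY - 8X^2 - 8Y^2.

   All integrals reduce to Green's formula.  It gives a linear recursion for the
   moments int s^k u of an eigenfunction u: for u = 1 these are the integrals
   needed above, for the eigenvalue lambda_1 the even moments vanish, whence f is
   orthogonal to U_1.  For 0 < lambda < lambda_1 all moments int (1 + <x,p>)^k u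
   vanish; as (1 + <x,p>)^k concentrates at p, this forces u(p) = 0, so that
   lambda_1 is n on the sphere and 1 on the torus. *)

Set Implicit Arguments.
Unset Strict Implicit.
Unset Printing Implicit Defensive.

Import Order.TTheory GRing.Theory Num.Theory.
Import numFieldNormedType.Exports.

Local Open Scope classical_set_scope.
Local Open Scope ring_scope.

(** * Integration over boxes *)

Section euclidean.
Context (R : realType).
Local Notation mR := (measurableTypeR R).

(** Write phi = c + psi, with c constant and psi a sum of eigenfunctions for eigenvalues above
    lambda_1. Then psi alone violates the inequality, and c has to pay: lambda_1 c^2 vol(M) must
    exceed int |grad psi|^2 - lambda_1 int psi^2. But int f phi = 0 with f > 0 makes c minus the
    f-weighted mean of psi, so f must favour the places where psi is large and opposite to c. There
    is little room: on the torus with psi = -48XY, the inequality asks for c > 24, while f = (X +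
    Y)^2 + delta gives c < 24; the squares in phi open a gap.

    The bases 1 + <x,p>, and (1 + cos)(1 + cos) on the torus, are chosen because 1 - cos^2 = (1 +
    cos)(1 - cos): the Laplacian of a power then involves only that power and the preceding ones, so
    all moments follow by induction from the constant one.

    The analytic obstacle is that integrals over the sphere are taken in one stereographic chart,
    hence over all of R^n. Green's formula there needs bounds at infinity, and these come from
    compactness in the other chart. *)

Lemma continuous_rVP n (F : 'rV[R]_n -> R) (v : 'rV[R]_n) :
  F @ v --> F v <->
  forall e, 0 < e -> exists2 d, 0 < d &
    forall v' : 'rV[R]_n, (forall i, `|v 0 i - v' 0 i| < d) -> `|F v - F v'| < e.
Proof.
split=> [/cvgrPdist_lt H e e0|H].
  have /nbhs_ballP[d /= d0 {}H] := H e e0.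
  by exists d => // v' Hv'; apply: H; split=> // i j; rewrite (ord1 i); exact: Hv'.
apply/(cvgrPdist_lt (FF := nbhs_filter v)) => e e0; have [d d0 {}H] := H e e0; apply/nbhs_ballP; exists d => //= v' vv'.
by apply: H => i; case: vv' => _; exact.
Qed.

Lemma measurable_coord n (i : 'I_n) :
  measurable_fun setT (fun t : n.-tuple mR => tnth t i : mR).
Proof. exact: measurable_tnth. Qed.

(** Tuples carry the product sigma-algebra, so measurability is derived from that of the
    coordinates. [F] is the pointwise limit of its values at the corners of the grid cubes of mesh
    1/(k+1), and each of these approximations is constant on countably many cubes. *)
Lemma measurable_row_of_tuple n (F : 'rV[R]_n -> R) : continuous F ->
  measurable_fun setT (fun t : n.-tuple mR => F (row_of_tuple t) : mR).
Proof.
move=> cF.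
pose z k (t : n.-tuple mR) : {ffun 'I_n -> int} :=
  [ffun i => Num.floor (k.+1%:R * tnth t i)].
pose a k (v : {ffun 'I_n -> int}) : 'rV[R]_n := \row_i ((v i)%:~R / k.+1%:R).
apply: (@measurable_fun_cvg _ _ _ _
  (fun k t => F (a k (z k t)))) => [k _ Y mY|t _].
  rewrite setTI.
  have -> : (fun t => F (a k (z k t))) @^-1` Y =
      \bigcup_(v in [set: {ffun 'I_n -> int}])
        (if `[< Y (F (a k v)) >] then
         \bigcap_(i in [set: 'I_n]) ((fun t : n.-tuple mR => tnth t i : mR) @^-1`
           [set` `[(v i)%:~R / k.+1%:R, (v i + 1)%:~R / k.+1%:R[ ])
         else set0).
    apply/seteqP; split=> [t /= Yt|t [v _]].
      exists (z k t) => //; case: asboolP => //= _ i _ /=.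
      rewrite /z ffunE in_itv/= ler_pdivrMr// ltr_pdivlMr// [_ * _.+1%:R]mulrC.
      exact: floor_itv.
    case: asboolP => //= Yv tv.
    suff -> : z k t = v by [].
    apply/ffunP => i; rewrite /z ffunE; apply/floor_def.
    have := tv i I; rewrite /= in_itv/=.
    by rewrite ler_pdivrMr// ltr_pdivlMr// [_ * _.+1%:R]mulrC.
  apply: countable_bigcupT_measurable => [|v]; first exact: countableP.
  case: ifP => // _; apply: fin_bigcap_measurable => [|i _]; first exact: finite_finset.
  by rewrite -[X in measurable X]setTI; apply: measurable_coord => //; exact: measurable_itv.
apply: (@cvg_comp _ _ _ (fun k => a k (z k t)) F _ (nbhs (row_of_tuple t))); last first.
  exact: cF.
apply/cvgrPdist_lt => e e0.
have /= := near_infty_natSinv_lt (PosNum e0).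
apply: filterS => k ke; rewrite /Num.norm/= mx_normrE.
apply: bigmax_lt => // -[i j] _ /=.
rewrite !mxE ffunE; apply: le_lt_trans ke.
have k0 : 0 < k.+1%:R :> R by rewrite ltr0n.
have /andP[] := Num.Theory.floor_itv (k.+1%:R * tnth t j).
rewrite intrD => h1 h2; have nk : k.+1%:R != 0 :> R by rewrite lt0r_neq0.
have E w : tnth t j - w / k.+1%:R = (k.+1%:R * tnth t j - w) / k.+1%:R.
  by rewrite mulrBl mulrAC divff// mul1r.
rewrite E normrM [X in _ * X]gtr0_norm ?invr_gt0//.
rewrite ler_piMl ?invr_ge0 ?ler0n// ger0_norm ?subr_ge0//.
by rewrite lerBlDl ltW.
Qed.

(** Half-open, so that the fundamental domain of the torus is literally a box. *)
Definition box n (a b : 'I_n -> R) : set 'rV[R]_n :=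
  [set y | forall i, a i <= y 0 i < b i].

Definition cons_row n (x : R) (y : 'rV[R]_n) : 'rV[R]_n.+1 :=
  \row_i oapp (y 0) x (unlift ord0 i).

Lemma cons_row0 n x (y : 'rV[R]_n) : cons_row x y 0 ord0 = x.
Proof. by rewrite mxE unlift_none. Qed.

Lemma cons_row_lift n x (y : 'rV[R]_n) j : cons_row x y 0 (lift ord0 j) = y 0 j.
Proof. by rewrite mxE liftK. Qed.

Lemma row_of_tuple_cons n x (t : n.-tuple R) :
  row_of_tuple [tuple of x :: t] = cons_row x (row_of_tuple t).
Proof.
apply/rowP => i; rewrite !mxE; case: unliftP => [j ->|->]/=; last exact: tnth0.
by rewrite tnthS mxE.
Qed.

Lemma box_cons n (a b : 'I_n.+1 -> R) x (y : 'rV[R]_n) :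
  box a b (cons_row x y) <->
  a ord0 <= x < b ord0 /\ box (a \o lift ord0) (b \o lift ord0) y.
Proof.
split=> [H|[Hx Hy] i].
  by split=> [|j]; [have := H ord0; rewrite cons_row0 |
    have := H (lift ord0 j); rewrite cons_row_lift].
by rewrite mxE; case: unliftP => [j ->|->] //=; exact: Hy.
Qed.

Lemma measurable_box n (a b : 'I_n -> R) :
  measurable (@row_of_tuple R n @^-1` box a b : set (n.-tuple mR)).
Proof.
have -> : (@row_of_tuple R n @^-1` box a b : set (n.-tuple mR)) =
    \bigcap_(i in [set: 'I_n]) ((fun t : n.-tuple mR => tnth t i : mR) @^-1`
           [set` `[a i, b i[ ]).
  apply/seteqP; split=> [t /= Bt i _|t Bt i].
    by have := Bt i; rewrite mxE /= in_itv.
  by have := Bt i I; rewrite mxE /= in_itv.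
apply: fin_bigcap_measurable => [|i _]; first exact: finite_finset.
by rewrite -[X in measurable X]setTI; apply: measurable_coord.
Qed.

Lemma measurable_cons_tuple n :
  measurable_fun setT (fun p : mR * n.-tuple mR => [tuple of p.1 :: p.2] : n.+1.-tuple mR).
Proof. exact: measurable_cons. Qed.

Lemma lebesgue_tuple_box n (a b : 'I_n -> R) : (forall i, a i <= b i) ->
  lebesgue_tuple R n (@row_of_tuple R n @^-1` box a b) =
  (\prod_i (b i - a i))%:E.
Proof.
elim: n a b => [|n IH] a b ab.
  by rewrite big_ord0 /= diracE mem_set// => -[].
rewrite big_ord_recl /=.
have -> : cons_measure (lebesgue_tuple R n) (@row_of_tuple R n.+1 @^-1` box a b) =
  (@lebesgue_measure R \x lebesgue_tuple R n)%E
    ([set` `[a ord0, b ord0[ ] `*`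
     (@row_of_tuple R n @^-1` box (a \o lift ord0) (b \o lift ord0))).
  rewrite /cons_measure /pushforward; congr (_ _).
  apply/seteqP; split=> -[x t] /=; rewrite row_of_tuple_cons in_itv/=.
    by move=> /box_cons.
  by move=> /box_cons.
rewrite product_measure1E//; last exact: measurable_box.
have /= -> := IH (a \o lift ord0) (b \o lift ord0) (fun i => ab _).
rewrite lebesgue_measure_itv/= lte_fin EFinM.
have := ab ord0; rewrite le_eqVlt => /predU1P[->|->]; last by rewrite EFinB.
by rewrite ltxx subrr.
Qed.

Lemma box_bounded n (a b : 'I_n -> R) (G : 'rV[R]_n -> R) : continuous G ->
  exists2 C, 0 <= C & forall y : 'rV[R]_n, (forall i, a i <= y 0 i <= b i) -> `|G y| <= C.
Proof.
move=> cG.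
pose A : set 'rV[R]_n := [set v | forall i, [set` `[a i, b i]] (v 0 i)].
have cA : compact A.
  by apply: (@rV_compact R n (fun i => [set` `[a i, b i]])) => i; exact: segment_compact.
have [A0|/set0P A0] := eqVneq A set0.
  exists 0 => // y ay; suff : A y by rewrite A0.
  by move=> i /=; rewrite in_itv/=.
have cnG : {within A, continuous (fun y => `|G y|)}.
  by apply: continuous_subspaceT => y; apply: continuous_comp;
    [exact: cG | exact: norm_continuous].
have [c Ac H] := EVT_max_rV A0 cA cnG.
exists `|G c| => // y ay; apply: H; rewrite inE => i /=.
by rewrite in_itv/=.
Qed.

Lemma integrable_box n (a b : 'I_n -> R) (G : 'rV[R]_n -> R) : continuous G ->
  (forall i, a i <= b i) ->
  (lebesgue_tuple R n).-integrable (@row_of_tuple R n @^-1` box a b)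
    (fun t => (G (row_of_tuple t))%:E).
Proof.
move=> cG ab.
apply: measurable_bounded_integrable.
- exact: measurable_box.
- by rewrite [X in (X < _)%E](lebesgue_tuple_box ab) ltry.
- apply: measurable_funTS; exact: measurable_row_of_tuple.
- have [C _ H] := box_bounded a b cG.
  exists C; split; first exact: num_real.
  move=> M CM /= t Bt; apply/(le_trans _ (ltW CM))/H => i.
  by have /andP[-> /ltW ->] := Bt i.
Qed.

Lemma continuous_integrable_co (f : R -> R) (a b : R) : continuous f ->
  (@lebesgue_measure R).-integrable [set` `[a, b[ ] (EFin \o f).
Proof.
move=> cf; apply: (@integrableS _ mR R lebesgue_measure [set` `[a, b]]).
- exact: measurable_itv.
- exact: measurable_itv.
- by move=> x/=; rewrite !in_itv/= => /andP[-> /ltW].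
- apply: continuous_compact_integrable; first exact: segment_compact.
  exact: continuous_subspaceT.
Qed.

Lemma continuous_cons_row_tail n (G : 'rV[R]_n.+1 -> R) x : continuous G ->
  continuous (fun y => G (cons_row x y)).
Proof.
move=> cG y; apply/continuous_rVP => e e0.
have /continuous_rVP/(_ e e0)[d d0 H] := cG (cons_row x y).
exists d => // v' Hv'; apply: H => i; rewrite !mxE.
by case: unliftP => [j _|_] //=; rewrite subrr normr0.
Qed.

Lemma continuous_cons_row_head n (G : 'rV[R]_n.+1 -> R) y : continuous G ->
  continuous (fun x => G (cons_row x y)).
Proof.
move=> cG x; apply/cvgrPdist_lt => e e0.
have /continuous_rVP/(_ e e0)[d d0 H] := cG (cons_row x y).
apply/nbhs_ballP; exists d => //= x' xx'; apply: H => i; rewrite !mxE.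
by case: unliftP => [j _|_] //=; rewrite subrr normr0.
Qed.

(** * Fubini's theorem on boxes *)

Section fubini_box.
Variables (n : nat) (a b : 'I_n.+1 -> R) (G : 'rV[R]_n.+1 -> R).
Hypothesis ab : forall i, a i <= b i.
Hypothesis cG : continuous G.

Let m1 : {sigma_finite_measure set mR -> \bar R} := @lebesgue_measure R.
Let m2 := lebesgue_tuple R n.
Let I0 : set mR := [set` `[a ord0, b ord0[ ].
Let a' := a \o lift ord0.
Let b' := b \o lift ord0.
Let B' : set (n.-tuple mR) := @row_of_tuple R n @^-1` box a' b'.
Let g (p : mR * n.-tuple mR) := (G (cons_row p.1 (row_of_tuple p.2)))%:E.

Let mB' : measurable B'. Proof. exact: measurable_box. Qed.

Let mI0 : measurable I0. Proof. exact: measurable_itv. Qed.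

Let mg : measurable_fun [set: (mR * n.-tuple mR)%type] g.
Proof.
apply/measurable_EFinP.
have -> : (fun p : mR * n.-tuple mR => G (cons_row p.1 (row_of_tuple p.2)) : mR) =
    (fun t : n.+1.-tuple mR => G (row_of_tuple t) : mR) \o
    (fun p : mR * n.-tuple mR => [tuple of p.1 :: p.2] : n.+1.-tuple mR).
  by apply/funext => p /=; rewrite row_of_tuple_cons.
apply: measurableT_comp; first exact: measurable_row_of_tuple.
exact: measurable_cons_tuple.
Qed.

Let ig : (m1 \x m2)%E.-integrable (I0 `*` B') g.
Proof.
apply: measurable_bounded_integrable.
- exact: measurableX.
- rewrite [X in (X < _)%E]product_measure1E//.
  rewrite [X in (_ * X < _)%E](lebesgue_tuple_box (fun i => ab _)).
  rewrite [X in (X * _ < _)%E]lebesgue_measure_itv/= lte_fin.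
  by case: ifPn => _; rewrite -?EFinB -?EFinM ?mul0e ltry.
- by have /measurable_EFinP mg' := mg; exact: measurable_funS mg'.
- have [C _ H] := box_bounded a b cG.
  exists C; split; first exact: num_real.
  move=> M CM /= [x t] /= [Ix Bt]; apply/(le_trans _ (ltW CM))/H => i.
  suff /(_ i)/andP[-> /ltW ->] : box a b (cons_row x (row_of_tuple t)) by [].
  by apply/box_cons; move: Ix; rewrite /I0 /= in_itv.
Qed.

(** The integrand is extended by zero, so that Fubini's theorem can be applied on the whole product
    space. *)
Let igT : (m1 \x m2)%E.-integrable setT (g \_ (I0 `*` B')).
Proof.
exact: (integrable_mkcond _ (measurableX mI0 mB')).1.
Qed.

Let itg : (\int[lebesgue_tuple R n.+1]_(t in @row_of_tuple R n.+1 @^-1` box a b)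
   (G (row_of_tuple t))%:E = \int[m1 \x m2]_p (g \_ (I0 `*` B')) p)%E.
Proof.
rewrite -integral_mkcond.
have mc := @measurable_cons_tuple n.
transitivity (\int[pushforward (m1 \x m2) (fun p : mR * n.-tuple mR => [tuple of p.1 :: p.2] : n.+1.-tuple mR)]_(t in @row_of_tuple R n.+1 @^-1` box a b)
   (G (row_of_tuple t))%:E)%E.
  exact: eq_measure_integral.
have E : (fun p : mR * n.-tuple mR => [tuple of p.1 :: p.2] : n.+1.-tuple mR) @^-1`
    (@row_of_tuple R n.+1 @^-1` box a b) = I0 `*` B'.
  apply/seteqP; split=> -[x t] /=; rewrite row_of_tuple_cons /I0/= in_itv/=.
    by move=> /box_cons.
  by move=> ?; apply/box_cons.
have Eg : (fun t : n.+1.-tuple mR => (G (row_of_tuple t))%:E) \o (fun p : mR * n.-tuple mR => [tuple of p.1 :: p.2] : n.+1.-tuple mR) = g.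
  by apply/funext => p /=; rewrite row_of_tuple_cons.
rewrite integral_pushforward//.
- by rewrite E Eg.
- by apply/measurable_EFinP; exact: measurable_row_of_tuple.
- by rewrite E Eg.
- exact: measurable_box.
Qed.

Let fubini_slice x : fubini_F m2 (g \_ (I0 `*` B')) x =
  ((EFin \o (fun x => integral_rV (box (a \o lift ord0) (b \o lift ord0))
      (fun y => G (cons_row x y)))) \_ I0) x.
Proof.
rewrite /fubini_F /patch/=.
case: ifPn => Ix.
  rewrite /integral_rV /Rintegral fineK; last first.
    apply: integrable_fin_num; first exact: measurable_box.
    apply: (@integrable_box _ _ _ (fun y => G (cons_row x y))) => [|i].
      exact: continuous_cons_row_tail.
    exact: ab.
  rewrite [in RHS]integral_mkcond; apply: eq_integral => t _; rewrite /patch/=.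
  by rewrite in_setX/= Ix.
by apply: integral0_eq => t _; rewrite in_setX/= (negbTE Ix).
Qed.

Lemma integral_box_cons :
  integral_rV (box a b) G = Rintegral (@lebesgue_measure R) [set` `[a ord0, b ord0[ ]
    (fun x => integral_rV (box (a \o lift ord0) (b \o lift ord0))
      (fun y => G (cons_row x y))).
Proof.
rewrite [LHS]/integral_rV [LHS]/Rintegral itg -integral12_prod_meas1//.
rewrite [RHS]/Rintegral [in RHS]integral_mkcond; congr (fine _).
by apply: eq_integral => x _; rewrite fubini_slice.
Qed.

Lemma integrable_box_slice :
  (@lebesgue_measure R).-integrable [set` `[a ord0, b ord0[ ]
    (EFin \o (fun x => integral_rV (box (a \o lift ord0) (b \o lift ord0))
      (fun y => G (cons_row x y)))).
Proof.
apply/(integrable_mkcond _ mI0).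
apply: eq_integrable (integrable_fubini_F igT) => // x _; rewrite fubini_slice.
Qed.

(** Here the first coordinate is integrated innermost, which is where the fundamental theorem of
    calculus removes a derivative in that direction. *)
Lemma integral_box_cons_swap :
  integral_rV (box a b) G = integral_rV (box (a \o lift ord0) (b \o lift ord0))
    (fun y => Rintegral (@lebesgue_measure R) [set` `[a ord0, b ord0[ ]
       (fun x => G (cons_row x y))).
Proof.
rewrite /integral_rV [LHS]/Rintegral itg -integral21_prod_meas1//.
rewrite [RHS]/Rintegral [in RHS]integral_mkcond; congr (fine _).
apply: eq_integral => t _; rewrite /fubini_G /patch/=.
case: ifPn => Bt.
  rewrite /Rintegral fineK; last first.
    apply: integrable_fin_num; first exact: measurable_itv.
    by apply: continuous_integrable_co; exact: continuous_cons_row_head.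
  rewrite [in RHS]integral_mkcond; apply: eq_integral => x _; rewrite /patch/=.
  by rewrite in_setX/= Bt andbT.
by apply: integral0_eq => x _; rewrite in_setX/= (negbTE Bt) andbF.
Qed.

End fubini_box.

Lemma is_derive_line n (F : 'rV[R]_n -> R) (v y : 'rV[R]_n) (t : R) :
  derivable F (y + t *: v) v ->
  is_derive t 1 (fun t => F (y + t *: v)) ('D_v F (y + t *: v)).
Proof.
move=> dF.
have E : (fun h : R => h^-1 *: (F (y + (h *: 1 + t) *: v) - F (y + t *: v))) =
         (fun h : R => h^-1 *: (F (h *: v + (y + t *: v)) - F (y + t *: v))).
  apply/funext => h; do 3 f_equal.
  by rewrite scalerDl [h *: 1]mulr1 addrCA.
by split; rewrite ?/derivable ?/derive /= E.
Qed.

Lemma continuous_line n (F : 'rV[R]_n -> R) (v y : 'rV[R]_n) :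
  continuous F -> continuous (fun t : R => F (y + t *: v)).
Proof.
move=> cF t; apply: (@continuous_comp _ _ _ (fun t : R => y + t *: v) F); last exact: cF.
by apply: cvgD; [exact: cvg_cst | apply: cvgZr_tmp; exact: cvg_id].
Qed.

Lemma FTC_line n (F : 'rV[R]_n -> R) (v y : 'rV[R]_n) (a b : R) : a <= b ->
  (forall y, derivable F y v) -> continuous ('D_v F) ->
  Rintegral (@lebesgue_measure R) [set` `[a, b[ ] (fun t => 'D_v F (y + t *: v)) =
  F (y + b *: v) - F (y + a *: v).
Proof.
rewrite le_eqVlt => /predU1P[<- _ _|ab dF cF].
  by rewrite set_itvco0 ?Rintegral_set0 ?subrr.
rewrite Rintegral_itv_bndo_bndc; last first.
  apply: continuous_integrable_co; exact: (@continuous_line _ ('D_v F)).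
have dl (t : R) : is_derive t 1 (fun t => F (y + t *: v)) ('D_v F (y + t *: v)).
  exact: is_derive_line.
have cl : continuous (fun t : R => F (y + t *: v)).
  by move=> t; apply: differentiable_continuous; apply/derivable1_diffP; case: (dl t).
rewrite /Rintegral (continuous_FTC2 ab (F := fun t => F (y + t *: v)))//=.
- exact/continuous_subspaceT/(@continuous_line _ ('D_v F)).
- split.
  + by move=> x _; case: (dl x).
  + exact/cvg_at_right_filter/cl.
  + exact/cvg_at_left_filter/cl.
- by move=> x _; rewrite derive1E; case: (dl x).
Qed.

End euclidean.

(** * The divergence theorem on cubes, as an estimate by boundary values *)

Section divergence.
Context (R : realType).

(** For [c] an endpoint of the [i]-th side of a box, this is the projection onto a face. *)
Definition set_coord n (i : 'I_n) (c : R) (y : 'rV[R]_n) : 'rV[R]_n :=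
  \row_j (if j == i then c else y 0 j).

Lemma cons_row_scale n (x : R) (y : 'rV[R]_n) :
  cons_row x y = cons_row 0 y + x *: delta_mx 0 ord0.
Proof.
apply/rowP => i; rewrite !mxE; case: unliftP => [j ->|->]/=.
  by rewrite mulr0 addr0.
by rewrite mulr1 add0r.
Qed.

Lemma cons_row_delta n (x h : R) (y : 'rV[R]_n) j :
  h *: delta_mx 0 (lift ord0 j) + cons_row x y = cons_row x (h *: delta_mx 0 j + y).
Proof.
apply/rowP => i; rewrite !mxE; case: unliftP => [k ->|->]/=.
  by rewrite !mxE (inj_eq (@lift_inj _ _)).
by rewrite mulr0 add0r.
Qed.

Lemma set_coord_cons0 n (c x : R) (y : 'rV[R]_n) :
  set_coord ord0 c (cons_row x y) = cons_row c y.
Proof. by apply/rowP => i; rewrite !mxE; case: unliftP => [k ->|->]. Qed.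

Lemma set_coord_cons_lift n j (c x : R) (y : 'rV[R]_n) :
  set_coord (lift ord0 j) c (cons_row x y) = cons_row x (set_coord j c y).
Proof.
apply/rowP => i; rewrite !mxE; case: unliftP => [k ->|->] //=.
by rewrite (inj_eq (@lift_inj _ _)) mxE.
Qed.

Let growth_cons_lift n (F : 'rV[R]_n.+1 -> R) x j (y : 'rV[R]_n) :
  (fun h : R => h^-1 *: (F (cons_row x (h *: delta_mx 0 j + y)) - F (cons_row x y))) =
  (fun h => h^-1 *: (F (h *: delta_mx 0 (lift ord0 j) + cons_row x y) - F (cons_row x y))).
Proof. by apply/funext => h; rewrite cons_row_delta. Qed.

Lemma partial_cons_lift n (F : 'rV[R]_n.+1 -> R) x j y :
  partial j (fun y => F (cons_row x y)) y = partial (lift ord0 j) F (cons_row x y).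
Proof. by rewrite /partial /derive /= growth_cons_lift. Qed.

Lemma derivable_cons_lift n (F : 'rV[R]_n.+1 -> R) x j y :
  derivable F (cons_row x y) (delta_mx 0 (lift ord0 j)) ->
  derivable (fun y => F (cons_row x y)) y (delta_mx 0 j).
Proof. by rewrite /derivable /= growth_cons_lift. Qed.

Lemma normr_Rintegral_le d (T : measurableType d) (mu : {measure set T -> \bar R})
    (D : set T) (f : T -> R) (M : R) : measurable D -> (mu D < +oo)%E ->
  mu.-integrable D (EFin \o f) -> (forall x, D x -> `|f x| <= M) ->
  `|Rintegral mu D f| <= M * fine (mu D).
Proof.
move=> mD D1 If fM; apply: (le_trans (le_normr_Rintegral _ _)) => //.
rewrite -Rintegral_cst//; apply: le_Rintegral => //.
- exact: (integrable_norm If).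
- apply/integrableP; split; first exact: measurable_cst.
  by rewrite integral_cst//= lte_mul_pinfty.
Qed.

(* For [i = ord0] the inner integral is evaluated by the fundamental theorem
   of calculus; the other directions follow by slicing off the first
   coordinate. *)
Lemma integral_box_partial n (F : 'rV[R]_n -> R) (i : 'I_n) (a b e : R) :
  a < b -> continuous F -> (forall y, derivable F y (delta_mx 0 i)) ->
  continuous (partial i F) ->
  (forall y, box (fun=> a) (fun=> b) y ->
    `|F (set_coord i b y) - F (set_coord i a y)| <= e) ->
  `|integral_rV (box (fun=> a) (fun=> b)) (partial i F)| <= e * (b - a) ^+ n.-1.
Proof.
move=> ab; have leab := ltW ab.
elim: n F i => [F []//|n IH] F i cF dF cdF H.
have ltn_box : lebesgue_tuple R n (@row_of_tuple R n @^-1` box (fun=> a) (fun=> b)) = ((b - a) ^+ n)%:E.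
  by rewrite (@lebesgue_tuple_box _ n (fun=> a) (fun=> b))// prodr_const card_ord.
have mI : @lebesgue_measure R [set` `[a, b[ ] = (b - a)%:E.
  by rewrite lebesgue_measure_itv/= lte_fin ab EFinB.
case: (unliftP ord0 i) => [j|] ->{i} in dF cdF H *.
  rewrite integral_box_cons//=.
  have n0 : (0 < n)%N by case: n j {IH cF cdF dF H ltn_box F} => [[]|].
  have -> : e * (b - a) ^+ n = e * (b - a) ^+ n.-1 * fine (@lebesgue_measure R [set` `[a, b[ ]).
    by rewrite [X in fine X]mI/= -mulrA -exprSr prednK.
  apply: normr_Rintegral_le.
  - exact: measurable_itv.
  - by rewrite [X in (X < _)%E]mI ltry.
  - by apply: (@integrable_box_slice _ n (fun=> a) (fun=> b)).
  - move=> x; rewrite /= in_itv/= => abx.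
    have -> : (fun y => partial (lift ord0 j) F (cons_row x y)) =
        partial j (fun y => F (cons_row x y)).
      by apply/funext => y; rewrite partial_cons_lift.
    apply: IH => //.
    + exact: continuous_cons_row_tail.
    + by move=> y; apply: derivable_cons_lift.
    + have -> : partial j (fun y => F (cons_row x y)) = (fun y => partial (lift ord0 j) F (cons_row x y)).
        by apply/funext => y; rewrite partial_cons_lift.
      exact: continuous_cons_row_tail.
    + move=> y By; rewrite -!set_coord_cons_lift; apply: H.
      exact/box_cons.
rewrite integral_box_cons_swap//=.
have -> : (fun y => Rintegral (@lebesgue_measure R) [set` `[a, b[ ]
      (fun x => partial ord0 F (cons_row x y))) =
    (fun y : 'rV[R]_n => F (cons_row b y) - F (cons_row a y)).
  apply/funext => y.
  rewrite (cons_row_scale b y) (cons_row_scale a y).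
  rewrite -(@FTC_line R _ F (delta_mx 0 ord0) (cons_row 0 y) a b leab dF cdF).
  by apply: eq_Rintegral => x _; rewrite cons_row_scale.
have cD : continuous (fun y : 'rV[R]_n => F (cons_row b y) - F (cons_row a y)).
  have cb := continuous_cons_row_tail (x := b) cF.
  have ca := continuous_cons_row_tail (x := a) cF.
  by move=> y; apply: cvgB; [exact: nbhs_filter|exact: cb|exact: ca].
have -> : e * (b - a) ^+ n = e * fine (lebesgue_tuple R n (@row_of_tuple R n @^-1` box (fun=> a) (fun=> b))).
  by rewrite [X in fine X]ltn_box.
apply: normr_Rintegral_le.
- exact: measurable_box.
- by rewrite [X in (X < _)%E]ltn_box ltry.
- exact: (@integrable_box _ n (fun=> a) (fun=> b) _ cD).
- move=> t Bt; have := H (cons_row a (row_of_tuple t)).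
  by rewrite !set_coord_cons0; apply; apply/box_cons; split => //=; rewrite lexx.
Qed.

End divergence.

(** * Weighted integrals *)

Section weighted.
Context (R : realType).
Local Notation mR := (measurableTypeR R).
Variables (n : nat) (D : set 'rV[R]_n) (w : 'rV[R]_n -> R).
Hypothesis mD : measurable (@row_of_tuple R n @^-1` D : set (n.-tuple mR)).
Hypothesis cw : continuous w.
Hypothesis w0 : forall y, 0 < w y.
Hypothesis iw : (lebesgue_tuple R n).-integrable (@row_of_tuple R n @^-1` D)
  (fun t => (w (row_of_tuple t))%:E).

Definition wint (h : 'rV[R]_n -> R) : R := integral_rV D (fun y => h y * w y).

(** An algebra of functions, all integrable against the finite measure with density [w]: membership
    settles every integrability condition in the manipulations of [wint]. *)
Definition tame (h : 'rV[R]_n -> R) : Prop :=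
  continuous h /\ exists2 C, 0 <= C & forall y, D y -> `|h y| <= C.

Lemma tame_cst c : tame (cst c).
Proof. by split; [exact: cst_continuous|exists `|c|]. Qed.

Lemma tameD h1 h2 : tame h1 -> tame h2 -> tame (fun y => h1 y + h2 y).
Proof.
move=> [c1 [C1 C10 H1]] [c2 [C2 C20 H2]]; split.
  by move=> y; apply: cvgD; [exact: nbhs_filter|exact: c1|exact: c2].
exists (C1 + C2) => [|y Dy]; first exact: addr_ge0.
by rewrite (le_trans (ler_normD _ _))// lerD ?H1 ?H2.
Qed.

Lemma tameM h1 h2 : tame h1 -> tame h2 -> tame (fun y => h1 y * h2 y).
Proof.
move=> [c1 [C1 C10 H1]] [c2 [C2 C20 H2]]; split.
  by move=> y; apply: cvgM; [exact: nbhs_filter|exact: c1|exact: c2].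
exists (C1 * C2) => [|y Dy]; first exact: mulr_ge0.
by rewrite normrM ler_pM ?H1 ?H2.
Qed.

Lemma tameZ c h : tame h -> tame (fun y => c * h y).
Proof. by move=> th; apply: (@tameM (cst c)) => //; exact: tame_cst. Qed.

Lemma tameX h k : tame h -> tame (fun y => h y ^+ k).
Proof.
move=> th; elim: k => [|k IH].
  by rewrite (_ : (fun y => _) = cst 1); [exact: tame_cst|apply/funext => y; rewrite expr0].
rewrite (_ : (fun y => _) = fun y => h y * h y ^+ k); first exact: tameM.
by apply/funext => y; rewrite exprS.
Qed.

Lemma tame_integrable h : tame h ->
  (lebesgue_tuple R n).-integrable (@row_of_tuple R n @^-1` D)
    (EFin \o (fun t => h (row_of_tuple t) * w (row_of_tuple t))).
Proof.
move=> [ch [C C0 hC]].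
apply: (le_integrable mD (g := fun t => (C * w (row_of_tuple t))%:E)).
- apply/measurable_EFinP; apply: measurable_funTS; apply: measurable_funM.
    exact: measurable_row_of_tuple.
  exact: measurable_row_of_tuple.
- move=> t Dt /=; rewrite lee_fin !normrM ler_wpM2r//.
  by rewrite (ger0_norm C0) hC.
- by under eq_fun do rewrite EFinM; exact: integrableZl.
Qed.

Lemma wintD h1 h2 : tame h1 -> tame h2 ->
  wint (fun y => h1 y + h2 y) = wint h1 + wint h2.
Proof.
move=> t1 t2; rewrite /wint /integral_rV -RintegralD//; last 2 first.
- exact: tame_integrable.
- exact: tame_integrable.
by apply: eq_Rintegral => t _ /=; rewrite mulrDl.
Qed.

Lemma wintZ c h : tame h -> wint (fun y => c * h y) = c * wint h.
Proof.
move=> th; rewrite /wint /integral_rV -RintegralZl//; last exact: tame_integrable.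
by apply: eq_Rintegral => t _ /=; rewrite mulrA.
Qed.

Lemma le_wint h1 h2 : tame h1 -> tame h2 -> (forall y, D y -> h1 y <= h2 y) ->
  wint h1 <= wint h2.
Proof.
move=> t1 t2 h12; apply: le_Rintegral => //.
- exact: tame_integrable.
- exact: tame_integrable.
- by move=> t Dt /=; rewrite ler_wpM2r ?h12// ltW.
Qed.

Lemma eq_wint h1 h2 : (forall y, D y -> h1 y = h2 y) -> wint h1 = wint h2.
Proof.
move=> h12; apply: eq_Rintegral => t; rewrite inE => Dt.
by rewrite h12.
Qed.

Lemma wint_gt0 h y0 : tame h -> (forall y, D y -> 0 <= h y) -> 0 < h y0 ->
  (exists2 d, 0 < d & forall y : 'rV[R]_n, (forall i, `|y0 0 i - y 0 i| < d) -> D y) ->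
  0 < wint h.
Proof.
move=> th h0 hy0 [d d0 dD].
have cg : continuous (fun y => h y * w y).
  by move=> y; apply: cvgM; [exact: nbhs_filter|exact: th.1|exact: cw].
have g0 : 0 < h y0 * w y0 / 2 by rewrite divr_gt0// mulr_gt0.
have [d' d'0 Hd'] := (continuous_rVP _ _).1 (cg y0) _ g0.
pose r := Num.min d d' / 2.
have r0 : 0 < r by rewrite divr_gt0// lt_min d0.
have min1 : Num.min d d' <= d by rewrite ge_min lexx.
have min2 : Num.min d d' <= d' by rewrite ge_min lexx orbT.
have rd : r < d by rewrite /r; lra.
have rd' : r < d' by rewrite /r; lra.
(* On this cube the integrand stays above half of its value at [y0], and the cube lies inside [D]
   with positive volume. *)
pose B : set 'rV[R]_n := box (fun i => y0 0 i - r) (fun i => y0 0 i + r).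
have mB : measurable (@row_of_tuple R n @^-1` B : set (n.-tuple mR)).
  exact: measurable_box.
have Br y : B y -> forall i, `|y0 0 i - y 0 i| <= r.
  by move=> By i; have := By i; rewrite ler_norml; lra.
have muB : lebesgue_tuple R n (@row_of_tuple R n @^-1` B) = ((r + r) ^+ n)%:E.
  rewrite lebesgue_tuple_box; last by move=> i; lra.
  congr (_%:E); rewrite -[in RHS](card_ord n) -prodr_const.
  by apply: eq_bigr => i _; ring.
have BD : (@row_of_tuple R n @^-1` B) `<=` (@row_of_tuple R n @^-1` D).
  by move=> t Bt; apply: dD => i; exact: le_lt_trans (Br _ Bt i) rd.
have IB : (lebesgue_tuple R n).-integrable (@row_of_tuple R n @^-1` B)
    (EFin \o (fun t => h (row_of_tuple t) * w (row_of_tuple t))).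
  by apply: integrableS (tame_integrable th).
rewrite /wint /integral_rV.
rewrite (_ : @row_of_tuple R n @^-1` D =
  (@row_of_tuple R n @^-1` B) `|` (@row_of_tuple R n @^-1` D) `\` (@row_of_tuple R n @^-1` B)); last first.
  by rewrite setDUK.
rewrite Rintegral_setU//; last 3 first.
- exact: measurableD.
- by rewrite setDUK//; exact: tame_integrable.
- by apply/eqP; rewrite setIC setDE -setIA setICl setI0.
apply: ltr_wpDr.
  by apply: Rintegral_ge0 => t [Dt _]; rewrite mulr_ge0 ?h0// ltW.
apply: (@lt_le_trans _ _ ((h y0 * w y0 / 2) * fine (lebesgue_tuple R n (@row_of_tuple R n @^-1` B)))).
  by rewrite mulr_gt0// [X in fine X]muB/= exprn_gt0// addr_gt0.
rewrite -Rintegral_cst//; apply: le_Rintegral => //.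
  apply/integrableP; split; first exact: measurable_cst.
  by rewrite integral_cst// [X in (_ * X)%E]muB ltry.
move=> t Bt /=; have := Hd' (row_of_tuple t) (fun i => le_lt_trans (Br _ Bt i) rd').
by rewrite ltr_norml; lra.
Qed.

Lemma tame_norm h : tame h -> tame (fun y => `|h y|).
Proof.
move=> [ch [C C0 H]]; split.
  by move=> y; apply: continuous_comp; [exact: ch|exact: norm_continuous].
by exists C => // y Dy; rewrite normr_id H.
Qed.

Lemma bernoulli_ineq (x : R) k : 0 <= x -> 1 + k%:R * x <= (1 + x) ^+ k.
Proof.
move=> x0; elim: k => [|k IH]; first by rewrite mul0r addr0 expr0.
rewrite exprS -natr1 mulrDl mul1r.
apply: (le_trans _ (ler_wpM2l _ IH)); last by rewrite addr_ge0.
have := mulr_ge0 (mulr_ge0 (ler0n R k) x0) x0; nra.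
Qed.

(* With [Q = P / theta], one has [Q ^ k * u >= - C] where [Q <= 1], and
   [Q ^ k * u >= c * k * (Q - 1)] where [Q >= 1], by Bernoulli's inequality. *)
Lemma concentration (u P : 'rV[R]_n -> R) y0 (theta c : R) :
  tame u -> tame P -> (forall y, D y -> 0 <= P y) ->
  0 < theta -> theta < P y0 ->
  (exists2 d, 0 < d & forall y : 'rV[R]_n, (forall i, `|y0 0 i - y 0 i| < d) -> D y) ->
  0 < c -> (forall y, D y -> theta <= P y -> c <= u y) ->
  ~ (forall k, wint (fun y => P y ^+ k * u y) = 0).
Proof.
move=> tu tP P0 th0 thP dD c0 cu H0.
have [cu' [C C0 uC]] := tu.
pose z y := theta^-1 * P y + (-1).
have tz : tame z by apply: tameD; [exact: tameZ|exact: tame_cst].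
(* [psi] is the positive part of Q - 1, written with an absolute value to make its continuity
   evident. *)
pose psi y := 2^-1 * (z y + `|z y|).
have tpsi : tame psi by apply/tameZ/tameD => //; exact: tame_norm.
have psi0 y : 0 <= psi y.
  by rewrite mulr_ge0 ?invr_ge0// -lerBlDl sub0r -normrN ler_norm.
have wpsi : 0 < wint psi.
  apply: (wint_gt0 tpsi _ _ dD) => //.
  have z0 : 0 < z y0 by rewrite /z subr_gt0 mulrC ltr_pdivlMr// mul1r.
  by rewrite mulr_gt0 ?invr_gt0// ltr_pwDl.
(* Pointwise, c k psi <= C + Q^k u; the last term has integral zero by assumption. Since [psi] has
   positive integral, a large [k] gives a contradiction. *)
have key k : c * k%:R * wint psi <= C * wint (cst 1).
  have t1 : tame (fun y => C * cst 1 y) by apply/tameZ/tame_cst.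
  have t2 : tame (fun y => c * k%:R * psi y) by exact: tameZ.
  have t3 : tame (fun y => theta^-1 ^+ k * (P y ^+ k * u y)).
    by apply/tameZ/tameM => //; exact: tameX.
  rewrite -!wintZ//; last exact: tame_cst.
  rewrite -[leRHS]add0r -(mulr0 (theta^-1 ^+ k)) -(H0 k) -wintZ; last first.
    by apply/tameM => //; exact: tameX.
  rewrite -wintD//; apply: le_wint => //; first exact: tameD.
  move=> y Dy; rewrite /cst mulr1 mulrA -exprMn.
  set Q := theta^-1 * P y.
  have Q0 : 0 <= Q by rewrite mulr_ge0 ?P0// invr_ge0 ltW.
  have [Q1|Q1] := leP Q 1.
    have -> : psi y = 0.
      by rewrite /psi /z -/Q ler0_norm; [rewrite subrr mulr0|rewrite subr_le0].
    rewrite mulr0 -lerBlDr sub0r.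
    have := uC y Dy; rewrite ler_norml => /andP[uC' _].
    have := exprn_ge0 k Q0; have := exprn_ile1 k Q0 Q1; nra.
  have -> : psi y = Q - 1.
    rewrite /psi /z -/Q ger0_norm ?subr_ge0 ?ltW//.
    by field.
  have cuy : c <= u y.
    by apply: cu => //; move: Q1; rewrite /Q mulrC ltr_pdivlMr// mul1r => /ltW.
  have B : 1 + k%:R * (Q - 1) <= Q ^+ k.
    by have := @bernoulli_ineq (Q - 1) k; rewrite subrKC; apply; rewrite subr_ge0 ltW.
  have kQ : 0 <= k%:R * (Q - 1) by rewrite mulr_ge0// subr_ge0 ltW.
  have : (1 + k%:R * (Q - 1)) * c <= Q ^+ k * u y.
    by apply: ler_pM => //; [rewrite addr_ge0|rewrite ltW].
  nra.
have cw0 : 0 < c * wint psi by rewrite mulr_gt0.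
have CW0 : 0 <= C * wint (cst 1) by have := key 0%N; rewrite mulr0 mul0r.
have := archi_boundP (divr_ge0 CW0 (ltW cw0)).
by rewrite ltr_pdivrMr// mulrCA mulrA ltNge key.
Qed.

End weighted.

(** * Calculus in conformal coordinates *)

Section calculus_rV.
Context (R : realType) (n : nat).
Implicit Types (F G : 'rV[R]_n -> R) (i : 'I_n) (y : 'rV[R]_n).

Lemma CkW k F : Ck k.+1 F -> Ck k F.
Proof.
elim: k F => [|k IH] F [cF HF]; first exact: cF.
by split=> // i; have [dF CF] := HF i; split=> //; exact: IH.
Qed.

Lemma Ck_continuous k F : Ck k F -> continuous F.
Proof. by case: k => [//|k] []. Qed.

Lemma continuous_addrV F G : continuous F -> continuous G ->
  continuous (fun y => F y + G y).
Proof. by move=> cF cG y; apply: cvgD; [exact: nbhs_filter|exact: cF|exact: cG]. Qed.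

Lemma continuous_mulrV F G : continuous F -> continuous G ->
  continuous (fun y => F y * G y).
Proof. by move=> cF cG y; apply: cvgM; [exact: nbhs_filter|exact: cF|exact: cG]. Qed.

Lemma partialD i F G : (forall y, derivable F y (delta_mx 0 i)) ->
  (forall y, derivable G y (delta_mx 0 i)) ->
  partial i (fun y => F y + G y) = (fun y => partial i F y + partial i G y).
Proof. by move=> dF dG; apply/funext => y; rewrite /partial -deriveD. Qed.

Lemma partialM i F G : (forall y, derivable F y (delta_mx 0 i)) ->
  (forall y, derivable G y (delta_mx 0 i)) ->
  partial i (fun y => F y * G y) =
  (fun y => partial i F y * G y + F y * partial i G y).
Proof.
move=> dF dG; apply/funext => y; rewrite /partial (deriveM (dF y) (dG y)).
by rewrite addrC -[_ *: _]/(_ * _) -[_ *: _]/(_ * _) [G y * _]mulrC.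
Qed.

Lemma partial_cst i (c : R) : partial i (fun=> c) = (fun=> 0) :> ('rV[R]_n -> R).
Proof. by apply/funext => y; rewrite /partial derive_cst. Qed.

Lemma is_derive_coord i y (v : 'rV[R]_n) : is_derive y v (fun z : 'rV[R]_n => z 0 i) (v 0 i).
Proof.
have E : (fun h : R => h^-1 *: ((h *: v + y) 0 i - y 0 i)) @ 0^' --> v 0 i.
  apply: cvg_near_cst; near=> h.
  rewrite !mxE addrK -[_ *: _]/(_ * _) mulKf//.
  by near: h; exact: nbhs_dnbhs_neq.
by split; [apply/cvg_ex; exists (v 0 i)|apply: cvg_lim].
Unshelve. all: by end_near. Qed.

Lemma partial_coord i j : partial i (fun z : 'rV[R]_n => z 0 j) = (fun=> (j == i)%:R).
Proof.
by apply/funext => y; rewrite /partial (@derive_val _ _ _ _ _ _ _ (is_derive_coord j y _)) mxE eqxx.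
Qed.

Lemma Ck_cst k (c : R) : Ck k (fun _ : 'rV[R]_n => c).
Proof.
elim: k c => [|k IH] c /=; first exact: cst_continuous.
split; first exact: cst_continuous.
by move=> i; rewrite partial_cst; split.
Qed.

Lemma CkD k F G : Ck k F -> Ck k G -> Ck k (fun y => F y + G y).
Proof.
elim: k F G => [|k IH] F G /=; first exact: continuous_addrV.
move=> [cF dF] [cG dG]; split; first exact: continuous_addrV.
move=> i; have [dFi CF] := dF i; have [dGi CG] := dG i; split.
  by move=> y; exact: derivableD.
by rewrite (partialD dFi dGi); exact: IH.
Qed.

Lemma CkM k F G : Ck k F -> Ck k G -> Ck k (fun y => F y * G y).
Proof.
elim: k F G => [|k IH] F G; first exact: continuous_mulrV.
move=> CF CG; have [cF dF] := CF; have [cG dG] := CG; split.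
  exact: continuous_mulrV.
move=> i; have [dFi CFi] := dF i; have [dGi CGi] := dG i; split.
  by move=> y; exact: derivableM.
by rewrite (partialM dFi dGi); apply: CkD; apply: IH => //; exact: CkW.
Qed.

Lemma Ck_coord k i : Ck k (fun y : 'rV[R]_n => y 0 i).
Proof.
case: k => [|k]; first exact: coord_continuous.
split; first exact: coord_continuous.
move=> j; split; first by move=> y; case: (is_derive_coord i y (delta_mx 0 j)).
rewrite partial_coord; exact: Ck_cst.
Qed.

Lemma CkZ k (c : R) F : Ck k F -> Ck k (fun y => c * F y).
Proof. by move=> CF; apply: CkM => //; exact: Ck_cst. Qed.

Lemma Ck_sum k (I : Type) (r : seq I) (F : I -> 'rV[R]_n -> R) :
  (forall j, Ck k (F j)) -> Ck k (fun y => \sum_(j <- r) F j y).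
Proof.
move=> CF; elim: r => [|j r IH].
  by under eq_fun do rewrite big_nil; exact: Ck_cst.
by under eq_fun do rewrite big_cons; exact: CkD.
Qed.

Lemma CkX k F m : Ck k F -> Ck k (fun y => F y ^+ m).
Proof.
move=> CF; elim: m => [|m IH].
  by under eq_fun do rewrite expr0; exact: Ck_cst.
by under eq_fun do rewrite exprS; exact: CkM.
Qed.

Lemma Ck_derivable k F i y : Ck k.+1 F -> derivable F y (delta_mx 0 i).
Proof. by move=> [_ /(_ i)[]]. Qed.

Lemma Ck_partial k F i : Ck k.+1 F -> Ck k (partial i F).
Proof. by move=> [_ /(_ i)[]]. Qed.

Lemma CkS k F : continuous F ->
  (forall i y, derivable F y (delta_mx 0 i)) -> (forall i, Ck k (partial i F)) ->
  Ck k.+1 F.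
Proof. by move=> cF dF CF; split=> // i; split. Qed.

Lemma partialZ i (c : R) F : (forall y, derivable F y (delta_mx 0 i)) ->
  partial i (fun y => c * F y) = (fun y => c * partial i F y).
Proof.
move=> dF; rewrite (partialM (fun y => derivable_cst c y _) dF) partial_cst.
by apply/funext => y; rewrite mul0r add0r.
Qed.

Lemma partial_sum i (I : Type) (r : seq I) (F : I -> 'rV[R]_n -> R) :
  (forall j y, derivable (F j) y (delta_mx 0 i)) ->
  (forall y, derivable (fun y => \sum_(j <- r) F j y) y (delta_mx 0 i)) /\
  partial i (fun y => \sum_(j <- r) F j y) = (fun y => \sum_(j <- r) partial i (F j) y).
Proof.
move=> dF; elim: r => [|j r [IH1 IH2]].
  under eq_fun do rewrite big_nil; rewrite partial_cst; split.
    by move=> y; exact: derivable_cst.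
  by apply/funext => y; rewrite big_nil.
under eq_fun do rewrite big_cons; split; first by move=> y; exact: derivableD.
by rewrite (partialD (dF j) IH1) IH2; apply/funext => y; rewrite big_cons.
Qed.

Lemma partialX i F m : (forall y, derivable F y (delta_mx 0 i)) ->
  (forall y, derivable (fun y => F y ^+ m) y (delta_mx 0 i)) /\
  partial i (fun y => F y ^+ m) = (fun y => m%:R * F y ^+ m.-1 * partial i F y).
Proof.
move=> dF; elim: m => [|m [IH1 IH2]].
  under eq_fun do rewrite expr0; rewrite partial_cst; split.
    by move=> y; exact: derivable_cst.
  by apply/funext => y; rewrite !mul0r.
under eq_fun do rewrite exprS; split; first by move=> y; exact: derivableM.
rewrite (partialM dF IH1) IH2; apply/funext => y /=.
case: m {IH1 IH2} => [|m] /=; first by rewrite !expr0; ring.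
by rewrite -[in RHS]natr1 exprS; ring.
Qed.

End calculus_rV.

(** * Laplacian and Green's identity for a metric rho^2 times the Euclidean one *)

Section conformal.
Context (R : realType) (M : riemannian R) (rho : 'rV[R]_(Defs.dim M) -> R).
Local Notation n := (Defs.dim M).
Hypothesis rho_gt0 : forall y, 0 < rho y.
Hypothesis metricE : forall a y, metric (r := M) a y = (rho y ^+ 2)%:M.

(** The coefficient sqrt(det g) g^ii of the Laplacian in divergence form, that is rho^(n-2). *)
Definition flux_density y : R := rho y ^+ n * (rho y ^+ 2)^-1.
Local Notation sigma := flux_density.

Definition conformal_laplacian (F : 'rV[R]_n -> R) y : R :=
  (rho y ^+ n)^-1 * \sum_i partial i (fun z => sigma z * partial i F z) y.

Lemma volume_densityE a y : volume_density (M := M) a y = rho y ^+ n.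
Proof.
rewrite /volume_density metricE det_scalar exprAC sqrtr_sqr ger0_norm//.
by rewrite exprn_ge0// ltW.
Qed.

Lemma gradE u a y i :
  grad (M := M) u a y 0 i = (rho y ^+ 2)^-1 * partial i (u \o param a) y.
Proof.
by rewrite /grad metricE invmx_scalar mul_mx_scalar !mxE.
Qed.

Lemma grad_norm2E u a y : grad_norm2 (M := M) u a y =
  (rho y ^+ 2)^-1 * \sum_i partial i (u \o param a) y ^+ 2.
Proof.
rewrite /grad_norm2; move: (gradE u a y); move: (grad u a y) => G GE.
rewrite metricE mul_mx_scalar -scalemxAl !mxE mulr_sumr mulr_sumr.
have r0 : rho y != 0 by rewrite gt_eqF.
by apply: eq_bigr => i _; rewrite mxE GE; field.
Qed.

Lemma laplacianE u a y :
  laplacian (M := M) u a y = conformal_laplacian (u \o param a) y.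
Proof.
rewrite /laplacian /divergence /conformal_laplacian volume_densityE.
congr (_ * _); apply: eq_bigr => i _; congr (partial i _ y).
by apply/funext => z; rewrite volume_densityE gradE mulrA.
Qed.

(** The vector field h grad u - u grad h, multiplied by the volume density. *)
Definition green_field (h u : 'rV[R]_n -> R) i y : R :=
  h y * (sigma y * partial i u y) + -1 * (u y * (sigma y * partial i h y)).

Hypothesis Crho : forall k, Ck k sigma.

Lemma Ck_green_field h u i : Ck 2 h -> Ck 2 u -> Ck 1 (green_field h u i).
Proof.
move=> Ch Cu; have Cs := Crho 1.
have C1 f : Ck 2 f -> Ck 1 (fun z => sigma z * partial i f z).
  by move=> Cf; exact: CkM Cs (Ck_partial i Cf).
exact: CkD (CkM (CkW Ch) (C1 _ Cu)) (CkZ _ (CkM (CkW Cu) (C1 _ Ch))).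
Qed.

(** In the divergence of h grad u - u grad h the products of first derivatives cancel. *)
Lemma green_pointwise h u y : Ck 2 h -> Ck 2 u ->
  (h y * conformal_laplacian u y - u y * conformal_laplacian h y) * rho y ^+ n =
  \sum_i partial i (green_field h u i) y.
Proof.
move=> Ch Cu; rewrite /conformal_laplacian.
have rn0 : rho y ^+ n != 0 by rewrite expf_neq0// gt_eqF.
transitivity (h y * \sum_i partial i (fun z => sigma z * partial i u z) y -
  u y * \sum_i partial i (fun z => sigma z * partial i h z) y).
  by rewrite [h y * (_^-1 * _)]mulrCA [u y * (_^-1 * _)]mulrCA -mulrBr mulrAC mulVf// mul1r.
rewrite !mulr_sumr -sumrB; apply: eq_bigr => i _.
have du z : derivable u z (delta_mx 0 i) by exact: Ck_derivable Cu.
have dh z : derivable h z (delta_mx 0 i) by exact: Ck_derivable Ch.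
have C1 f : Ck 2 f -> Ck 1 (fun z => sigma z * partial i f z).
  by move=> Cf; exact: CkM (Crho 1) (Ck_partial i Cf).
have dsu z := @Ck_derivable _ _ _ _ i z (C1 _ Cu).
have dsh z := @Ck_derivable _ _ _ _ i z (C1 _ Ch).
have dhsu z : derivable (fun z => h z * (sigma z * partial i u z)) z (delta_mx 0 i).
  exact: derivableM (dh z) (dsu z).
have dush z : derivable (fun z => u z * (sigma z * partial i h z)) z (delta_mx 0 i).
  exact: derivableM (du z) (dsh z).
have dush' z : derivable (fun z => -1 * (u z * (sigma z * partial i h z))) z (delta_mx 0 i).
  exact: derivableM (derivable_cst _ _ _) (dush z).
rewrite /green_field (partialD dhsu dush') (partialZ _ dush).
rewrite (partialM dh dsu) (partialM du dsh).
move: (partial i (fun z => sigma z * partial i u z) y) => A.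
move: (partial i (fun z => sigma z * partial i h z) y) => B.
move: (sigma y) (partial i u y) (partial i h y) (u y) (h y) => s u' h' v g.
by ring.
Qed.

End conformal.

(** * The conformal factor of stereographic projection *)

Section stereographic_factor.
Context (R : realType) (n : nat).
Implicit Types (y : 'rV[R]_n).

Definition stereo_factor y : R := 2 / (norm2 y + 1).
Local Notation rho := stereo_factor.

Lemma norm2_ge0 y : 0 <= norm2 y.
Proof. by apply: sumr_ge0 => i _; exact: sqr_ge0. Qed.

Lemma norm2D1_gt0 y : 0 < norm2 y + 1.
Proof. by rewrite ltr_wpDl// norm2_ge0. Qed.

Lemma stereo_factor_gt0 y : 0 < rho y.
Proof. by rewrite divr_gt0// norm2D1_gt0. Qed.

Lemma partial_norm2 i : (forall y, derivable (@norm2 R n) y (delta_mx 0 i)) /\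
  partial i (@norm2 R n) = (fun y => 2 * y 0 i).
Proof.
have dX j := @partialX R n i (fun y : 'rV[R]_n => y 0 j) 2 (fun y => @ex_derive _ _ _ _ _ _ _ (is_derive_coord j y _)).
have [d1 d2] := @partial_sum R n i _ (index_enum 'I_n) (fun j (y : 'rV[R]_n) => y 0 j ^+ 2) (fun j => (dX j).1).
split; first exact: d1.
rewrite [LHS]d2; apply/funext => y.
rewrite (bigD1 i)//= big1 ?addr0 => [|j ji]; rewrite (dX _).2 partial_coord.
  by rewrite eqxx mulr1 expr1.
by rewrite (negbTE ji) mulr0.
Qed.

Lemma continuous_norm2 : continuous (@norm2 R n).
Proof.
apply: (@Ck_continuous _ _ 0); apply: Ck_sum => j.
by apply: CkX; exact: Ck_coord.
Qed.

Lemma partial_stereo_factor i : (forall y, derivable rho y (delta_mx 0 i)) /\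
  partial i rho = (fun y => (-1 * (rho y * rho y)) * y 0 i).
Proof.
have [d1 d2] := partial_norm2 i.
have d1' y : derivable (fun y : 'rV[R]_n => norm2 y + 1) y (delta_mx 0 i).
  by apply: derivableD => //; exact: derivable_cst.
have nz y : norm2 y + 1 != 0 by rewrite gt_eqF// norm2D1_gt0.
have dV y : derivable (fun y : 'rV[R]_n => (norm2 y + 1)^-1) y (delta_mx 0 i).
  exact: derivableV.
split; first by move=> y; apply: derivableM => //; exact: derivable_cst.
rewrite /rho partialZ//; apply/funext => y.
rewrite {1}/partial deriveV//.
have -> : 'D_(delta_mx 0 i) (fun y : 'rV[R]_n => norm2 y + 1) y = 2 * y 0 i.
  rewrite -[LHS]/(partial i _ y) (partialD d1 (fun z => derivable_cst (1 : R) z _)).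
  by rewrite d2 partial_cst addr0.
rewrite -[_ *: _]/(_ * _); have := nz y.
by move=> ?; field.
Qed.

(** The derivative -rho^2 y_i is again a polynomial in rho and the coordinates, so smoothness
    follows by induction on the order. *)
Lemma Ck_stereo_factor k : Ck k rho.
Proof.
have c : continuous rho.
  apply: continuous_mulrV; first exact: cst_continuous.
  move=> y; apply: cvgV; [exact: nbhs_filter|by rewrite gt_eqF// norm2D1_gt0|].
  apply: continuous_addrV; [exact: continuous_norm2|exact: cst_continuous].
elim: k => [//|k IH]; apply: CkS => // i; first exact: (partial_stereo_factor i).1.
rewrite (partial_stereo_factor i).2.
by apply: CkM; [apply: CkZ; exact: CkM|exact: Ck_coord].
Qed.

End stereographic_factor.

(** * Sums and limits of integrals over cubes, integrability of products *)

Section box_integrals.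
Context (R : realType).
Local Notation mR := (measurableTypeR R).

Lemma integral_box_sum n (a b : 'I_n -> R) (I : Type) (r : seq I)
    (G : I -> 'rV[R]_n -> R) : (forall i, a i <= b i) -> (forall j, continuous (G j)) ->
  integral_rV (box a b) (fun y => \sum_(j <- r) G j y) =
  \sum_(j <- r) integral_rV (box a b) (G j).
Proof.
move=> ab cG; elim: r => [|j r IH].
  rewrite big_nil /integral_rV /Rintegral integral0_eq// => t _.
  by rewrite big_nil.
rewrite big_cons -IH /integral_rV -RintegralD//; last 3 first.
- exact: measurable_box.
- exact: integrable_box.
- apply: (@integrable_box _ _ _ _ (fun y => \sum_(j <- r) G j y)) => //.
  elim: r {IH} => [|k r IH]; under eq_fun do rewrite ?big_nil ?big_cons.
    exact: cst_continuous.
  exact: continuous_addrV.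
by apply: eq_Rintegral => t _; rewrite big_cons.
Qed.

Lemma integral_box_div n (Y : 'I_n -> 'rV[R]_n -> R) (a b e : R) : a < b ->
  (forall i, Ck 1 (Y i)) ->
  (forall i y, box (fun=> a) (fun=> b) y ->
    `|Y i (set_coord i b y) - Y i (set_coord i a y)| <= e) ->
  `|integral_rV (box (fun=> a) (fun=> b)) (fun y => \sum_i partial i (Y i) y)| <=
  n%:R * (e * (b - a) ^+ n.-1).
Proof.
move=> ab CY H; rewrite integral_box_sum => [||i]; last 2 first.
- by move=> _; exact: ltW.
- exact: Ck_continuous (Ck_partial i (CY i)).
apply: (le_trans (ler_norm_sum _ _ _)).
apply: (@le_trans _ _ (\sum_(i < n) e * (b - a) ^+ n.-1)); last first.
  by rewrite sumr_const card_ord mulr_natl.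
apply: ler_sum => i _; apply: integral_box_partial => //.
- exact: Ck_continuous (CY i).
- by move=> y; exact: Ck_derivable (CY i).
- exact: Ck_continuous (Ck_partial i (CY i)).
- exact: H.
Qed.

Lemma cvg_integral_cubes n (G : 'rV[R]_n -> R) : continuous G ->
  (lebesgue_tuple R n).-integrable setT (fun t => (G (row_of_tuple t))%:E) ->
  integral_rV (box (fun=> - k%:R) (fun=> k%:R)) G @[k --> \oo] --> integral_rV setT G.
Proof.
move=> cG iG.
pose B k : set (n.-tuple mR) := @row_of_tuple R n @^-1` box (fun=> - k%:R) (fun=> k%:R).
pose g (t : n.-tuple mR) : \bar R := (G (row_of_tuple t))%:E.
have mB k : measurable (B k) by exact: measurable_box.
have mg : measurable_fun setT g by exact: measurable_int iG.
have H : (\int[lebesgue_tuple R n]_t (g \_ (B k)) t @[k --> \oo] --> \int[lebesgue_tuple R n]_t g t)%E.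
  apply: (@dominated_cvg _ _ _ _ setT measurableT (fun k => g \_ (B k)) g (fun t => `|g t|%E)).
  - move=> k; apply/(measurable_restrictT _ (mB k)); exact: measurable_funS mg.
  - move=> t _; apply: cvg_near_cst.
    have [m mP] : exists m : nat, forall i, `|tnth t i| < m%:R.
      exists (\max_(i < n) Num.Def.archi_bound `|tnth t i|)%N => i.
      by rewrite (lt_le_trans (archi_boundP _))// ler_nat (leq_bigmax i).
    near=> k; rewrite /patch mem_set// => i; rewrite mxE.
    have mk : m%:R <= k%:R :> R by rewrite ler_nat; near: k; exact: nbhs_infty_ge.
    by have := mP i; rewrite ltr_norml => /andP[h1 h2]; rewrite (le_trans _ (ltW h1)) ?lerN2//= (lt_le_trans h2).
  - by move=> t _; rewrite /g.
  - exact: integrable_abse.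
  - by move=> k t _; rewrite /patch; case: ifPn => // _; rewrite abse0 abse_ge0.
have gfin : (\int[lebesgue_tuple R n]_t g t)%E \is a fin_num by exact: integrable_fin_num.
rewrite -(fineK gfin) in H.
rewrite (_ : (fun k : nat => integral_rV (box (fun=> - k%:R) (fun=> k%:R)) G) =
  (fun k => fine (\int[lebesgue_tuple R n]_t (g \_ (B k)) t)%E)); first exact: (fine_cvg H).
by apply/funext => k /=; rewrite -integral_mkcond.
Unshelve. all: by end_near. Qed.

(** Tonelli's theorem, one coordinate at a time. With f(x) = 2 / (1 + x^2) the product dominates the
    density of the sphere. *)
Lemma integrable_prod_tuple n (f : R -> R) : (forall x, 0 <= f x) -> continuous f ->
  (\int[@lebesgue_measure R]_x (f x)%:E < +oo)%E ->
  (\int[lebesgue_tuple R n]_t (\prod_(i < n) f (tnth t i))%:E < +oo)%E.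
Proof.
move=> f0 cf foo.
have mf : measurable_fun setT (f : mR -> mR) by exact: continuous_measurable_fun.
pose p m (t : m.-tuple mR) := \prod_(i < m) f (tnth t i).
have mp m : measurable_fun setT (p m : m.-tuple mR -> mR).
  apply: measurable_prod => i _; apply: measurableT_comp => //.
  exact: measurable_coord.
have p0 m t : 0 <= p m t by exact: prodr_ge0.
elim: n => [|n IH].
  under eq_integral do rewrite big_ord0.
  by rewrite integral_cst//= diracT mule1 ltry.
have mc := @measurable_cons_tuple R n.
have -> : (\int[lebesgue_tuple R n.+1]_t (p n.+1 t)%:E =
  \int[pushforward (@lebesgue_measure R \x lebesgue_tuple R n) (fun q : mR * n.-tuple mR => [tuple of q.1 :: q.2] : n.+1.-tuple mR)]_t (p n.+1 t)%:E)%E.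
  exact: eq_measure_integral.
rewrite ge0_integral_pushforward//; last 2 first.
- by apply/measurable_EFinP; exact: mp.
- by move=> t _; rewrite lee_fin p0.
rewrite preimage_setT.
have -> : (fun t => (p n.+1 t)%:E) \o (fun q : mR * n.-tuple mR => [tuple of q.1 :: q.2] : n.+1.-tuple mR) =
  (fun q => (f q.1 * p n q.2)%:E).
  apply/funext => -[x t] /=; rewrite /p big_ord_recl; congr (_ * _)%:E.
  by apply: eq_bigr => i _; rewrite tnthS.
rewrite fubini_tonelli1/=; last 2 first.
- apply/measurable_EFinP; apply: measurable_funM.
    exact: measurableT_comp.
  by apply: measurableT_comp; [exact: mp|exact: measurable_snd].
- by move=> q; rewrite lee_fin mulr_ge0.
have E x : (\int[lebesgue_tuple R n]_t (f x * p n t)%:E =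
    (f x)%:E * \int[lebesgue_tuple R n]_t (p n t)%:E)%E.
  under eq_integral do rewrite EFinM.
  rewrite ge0_integralZl//.
  - by apply/measurable_EFinP; exact: mp.
  - by move=> t _; rewrite lee_fin p0.
  - by rewrite lee_fin.
apply: (@le_lt_trans _ _ (\int[@lebesgue_measure R]_x ((f x)%:E * \int[lebesgue_tuple R n]_t (p n t)%:E))%E).
  by rewrite le_eqVlt; apply/orP; left; apply/eqP; apply: eq_integral => x _; exact: E.
rewrite ge0_integralZr//; last 3 first.
- exact/measurable_EFinP.
- by move=> x _; rewrite lee_fin.
- by apply: integral_ge0 => t _; rewrite lee_fin p0.
have If0 : (0 <= \int[@lebesgue_measure R]_x (f x)%:E)%E.
  by apply: integral_ge0 => x _; rewrite lee_fin.
by rewrite lte_mul_pinfty// ge0_fin_numE.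
Qed.

Lemma integral_cauchy_lty : (\int[@lebesgue_measure R]_x (2 / (1 + x ^+ 2))%:E < +oo)%E.
Proof.
have c : continuous (fun x : R => 2 / (1 + x ^+ 2)).
  by move=> x; apply: cvgM; [exact: cvg_cst|exact: continuous_oneDsqrV].
rewrite ge0_symfun_integralT//; last 2 first.
- by move=> x; rewrite divr_ge0// addr_ge0// sqr_ge0.
- by move=> x /=; rewrite sqrrN.
have -> : [set x : R | 0 <= x] = [set` `[0, +oo[ ] by rewrite set_itvcy.
under eq_integral do rewrite EFinM.
rewrite ge0_integralZl//=; last 2 first.
- apply/measurable_EFinP; apply: measurable_funTS; apply: continuous_measurable_fun.
  exact: continuous_oneDsqrV.
- by move=> x _; rewrite lee_fin invr_ge0 addr_ge0// sqr_ge0.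
by rewrite integral0y_oneDsqr -!EFinM ltry.
Qed.

End box_integrals.

(** * Lipschitz estimates from bounds on partial derivatives *)

Section lipschitz.
Context (R : realType) (n : nat).

(** The mean value theorem on the segment from [y] to [y + s *: v]; [Num.min] and [Num.max] cover
    both signs of [s]. *)
Lemma lipschitz_line (F : 'rV[R]_n -> R) (v y : 'rV[R]_n) (s L : R) :
  (forall z, derivable F z v) ->
  (forall t, Num.min 0 s <= t <= Num.max 0 s -> `|'D_v F (y + t *: v)| <= L) ->
  `|F (y + s *: v) - F y| <= L * `|s|.
Proof.
move=> dF FL.
have dl (t : R) : is_derive t 1 (fun t => F (y + t *: v)) ('D_v F (y + t *: v)).
  exact: is_derive_line.
have cl (I : set R) : {within I, continuous (fun t : R => F (y + t *: v))}.
  apply: continuous_subspaceT => t.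
  by apply: differentiable_continuous; apply/derivable1_diffP; case: (dl t).
have F0 : F y = F (y + 0 *: v) by rewrite scale0r addr0.
have [s0|/ltW s0] := leP 0 s.
  have [c] := MVT_segment s0 (fun t _ => dl t) (cl _).
  rewrite in_itv/= F0 subr0 => cs ->; rewrite normrM ler_wpM2r// FL//.
  by rewrite min_l// max_r.
have [c] := MVT_segment s0 (fun t _ => dl t) (cl _).
rewrite in_itv/= F0 distrC sub0r => cs ->; rewrite normrM normrN ler_wpM2r// FL//.
by rewrite min_r// max_l.
Qed.

Let hybrid (z z' : 'rV[R]_n) (k : nat) : 'rV[R]_n :=
  \row_(j < n) if (j < k)%N then z 0 j else z' 0 j.

(* Passing from [z'] to [z] one coordinate at a time. *)
Lemma C1_lipschitz_cube (F : 'rV[R]_n -> R) (r : R) : Ck 1 F ->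
  exists2 L, 0 <= L & forall z z' : 'rV[R]_n,
    (forall j, `|z 0 j| <= r) -> (forall j, `|z' 0 j| <= r) ->
    `|F z - F z'| <= L * \sum_j `|z 0 j - z' 0 j|.
Proof.
move=> CF.
have /choice[C HC] i : exists C, 0 <= C /\ forall y : 'rV[R]_n,
    (forall j, `|y 0 j| <= r) -> `|partial i F y| <= C.
  have [C C0 H] := box_bounded (fun=> - r) (fun=> r) (Ck_continuous (Ck_partial i CF)).
  by exists C; split=> // y yr; apply: H => j; rewrite -ler_norml.
exists (\sum_i C i) => [|z z' zr zr']; first by apply: sumr_ge0 => i _; case: (HC i).
have -> : F z - F z' = \sum_(k < n) (F (hybrid z z' k.+1) - F (hybrid z z' k)).
  rewrite -(big_mkord xpredT (fun k => F (hybrid z z' k.+1) - F (hybrid z z' k))).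
  rewrite telescope_sumr//; congr (F _ - F _); apply/rowP => j; rewrite mxE//.
  by rewrite ltn_ord.
rewrite mulr_sumr; apply: (le_trans (ler_norm_sum _ _ _)); apply: ler_sum => k _.
have -> : hybrid z z' k.+1 = hybrid z z' k + (z 0 k - z' 0 k) *: delta_mx 0 k.
  apply/rowP => j; rewrite !mxE eqxx/= ltnS.
  have [->|jk] := eqVneq j k; first by rewrite leqnn ltnn mulr1 subrKC.
  by rewrite leq_eqVlt (inj_eq val_inj) (negbTE jk) mulr0 addr0.
apply: lipschitz_line => [y|t Ht]; first exact: Ck_derivable CF.
apply: (@le_trans _ _ (C k)).
  apply: (HC k).2 => j; rewrite !mxE eqxx/=.
  have [->|jk] := eqVneq j k; last first.
    by rewrite mulr0 addr0; case: ifP.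
  rewrite ltnn mulr1; move: Ht (zr k) (zr' k); rewrite !ler_norml.
  by case: (leP 0 (z 0 k - z' 0 k)) => h; rewrite ?(min_l, max_r, min_r, max_l) ?(ltW h)// => /andP[h1 h2] /andP[h3 h4] /andP[h5 h6]; apply/andP; split; lra.
by rewrite (bigD1 k)//= lerDl; apply: sumr_ge0 => i _; case: (HC i).
Qed.

End lipschitz.

(** * The sphere *)

Section stereographic.
Context (R : realType) (n : nat).
Implicit Types (y : 'rV[R]_n) (s : bool).
Local Notation rho := (@stereo_factor R n).
Local Notation sgn s := ((-1) ^+ nat_of_bool s : R).

Lemma stereo_head s y (j : 'I_1) :
  stereo s y 0 (lshift n j) = sgn s * (1 - rho y).
Proof.
rewrite row_mxEl mxE (ord1 j) eqxx mulr1n; congr (_ * _).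
have : norm2 y + 1 != 0 by rewrite gt_eqF// norm2D1_gt0.
by rewrite /stereo_factor => ?; field.
Qed.

Lemma stereo_tail s y i : stereo s y 0 (rshift 1 i) = rho y * y 0 i.
Proof. by rewrite row_mxEr mxE. Qed.

(** The relation between |y|^2 and rho modulo which the later computations in the charts are
    polynomial identities. *)
Lemma norm2_factor y : norm2 y * rho y = 2 - rho y.
Proof.
have : norm2 y + 1 != 0 by rewrite gt_eqF// norm2D1_gt0.
by rewrite /stereo_factor => ?; field.
Qed.

Lemma partial_factor_coord i k :
  partial i (fun y : 'rV[R]_n => rho y * y 0 k) =
  (fun y => (-1 * (rho y * rho y)) * y 0 i * y 0 k + rho y * (k == i)%:R).
Proof.
rewrite (partialM (@partial_stereo_factor R n i).1 (fun y => @ex_derive _ _ _ _ _ _ _ (is_derive_coord k y _))).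
by rewrite (@partial_stereo_factor R n i).2 partial_coord.
Qed.

Lemma stereo_coordE s (k : 'I_(1 + n)) : (fun y : 'rV[R]_n => stereo s y 0 k) =
  (fun y : 'rV[R]_n => if fintype.split k is inr i then rho y * y 0 i else sgn s * (1 + -1 * rho y)).
Proof.
apply/funext => y; case: fintype.split_ordP => i ->.
  by rewrite stereo_head mulN1r.
by rewrite stereo_tail.
Qed.

Lemma differentiable_rV (m : nat) (f : 'rV[R]_n -> 'rV[R]_m) y :
  (forall k, differentiable (fun y => f y 0 k) y) -> differentiable f y.
Proof.
move=> df.
rewrite (_ : f = \sum_(k < m) (fun y => f y 0 k *: delta_mx 0 k)).
  by apply: differentiable_sum => k; exact: differentiableZl.
by apply/funext => z; rewrite fct_sumE [LHS]row_sum_delta.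
Qed.

Lemma differentiable_factor y : differentiable rho y.
Proof.
have dn : differentiable (fun y : 'rV[R]_n => norm2 y + 1) y.
  apply: differentiableD; last exact: differentiable_cst.
  rewrite (_ : @norm2 R n = \sum_(k < n) (fun y : 'rV[R]_n => y 0 k) ^+ 2).
    apply: differentiable_sum => k; apply: differentiableX.
    exact: differentiable_coord.
  by apply/funext => z; rewrite fct_sumE.
apply: differentiableM; first exact: differentiable_cst.
apply: (@differentiableV _ _ (fun y : 'rV[R]_n => norm2 y + 1)) => //.
by rewrite gt_eqF// norm2D1_gt0.
Qed.

Lemma differentiable_stereo s y : differentiable (stereo s) y.
Proof.
apply: differentiable_rV => k; rewrite stereo_coordE; case: fintype.split_ordP => i _.
  apply: differentiableM; first exact: differentiable_cst.
  apply: differentiableD; first exact: differentiable_cst.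
  apply: differentiableM; first exact: differentiable_cst.
  exact: differentiable_factor.
apply: differentiableM; first exact: differentiable_factor.
exact: differentiable_coord.
Qed.

Lemma jacobian_stereoE s y i k :
  ('J (stereo s) y) i k = partial i (fun y : 'rV[R]_n => stereo s y 0 k) y.
Proof.
have := deriveEjacobian (delta_mx 0 i) (differentiable_stereo s y).
rewrite -rowE => E.
have -> : 'J (stereo s) y i k = row i ('J (stereo s) y) 0 k by rewrite [RHS]mxE.
rewrite -E derive_mx; first by rewrite mxE.
exact: diff_derivable (differentiable_stereo s y).
Qed.

Lemma partial_stereo_head s i (j : 'I_1) y :
  partial i (fun y : 'rV[R]_n => stereo s y 0 (lshift n j)) y = sgn s * (rho y * rho y * y 0 i).
Proof.
have -> : (fun y : 'rV[R]_n => stereo s y 0 (lshift n j)) = (fun y => sgn s + (- sgn s) * rho y).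
  by apply/funext => z; rewrite stereo_head; ring.
have [d1 d2] := @partial_stereo_factor R n i.
have d3 z : derivable (fun z : 'rV[R]_n => - sgn s * rho z) z (delta_mx 0 i).
  by apply: (@Ck_derivable _ _ 0); apply: CkZ; exact: Ck_stereo_factor.
rewrite (partialD (fun z => derivable_cst (sgn s) z _) d3) (partialZ _ d1) d2.
by rewrite partial_cst; ring.
Qed.

(** Conformality of stereographic projection. Both charts have the same factor, since [s] only
    changes the sign of one ambient coordinate. *)
Lemma stereo_metric s y :
  'J (stereo s) y *m ('J (stereo s) y)^T = (rho y ^+ 2)%:M.
Proof.
apply/matrixP => i j; rewrite [LHS]mxE [RHS]mxE.
under eq_bigr do rewrite [X in _ * X]mxE !jacobian_stereoE.
rewrite big_split_ord/= big_ord1 !partial_stereo_head.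
have E k : partial i (fun y : 'rV[R]_n => stereo s y 0 (rshift 1 k)) y *
    partial j (fun y : 'rV[R]_n => stereo s y 0 (rshift 1 k)) y =
   rho y ^+ 2 * (rho y ^+ 2 * y 0 i * y 0 j * y 0 k ^+ 2
     - rho y * y 0 i * ((k == j)%:R * y 0 k) - rho y * y 0 j * ((k == i)%:R * y 0 k)
     + (k == i)%:R * (k == j)%:R).
  have -> : (fun y => stereo s y 0 (rshift 1 k)) = (fun y : 'rV[R]_n => rho y * y 0 k).
    by apply/funext => z; rewrite stereo_tail.
  rewrite !partial_factor_coord.
  set d1 : R := (k == i)%:R; set d2 : R := (k == j)%:R.
  by move: (rho y) (y 0 i) (y 0 j) (y 0 k) d1 d2 => r a b c d1 d2; ring.
under eq_bigr do rewrite E.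
rewrite -mulr_sumr !big_split/= !sumrN -!mulr_sumr.
have D (f : 'I_n -> R) l : \sum_k (k == l)%:R * f k = f l.
  by rewrite (bigD1 l)//= eqxx mul1r big1 ?addr0// => k /negbTE ->; rewrite mul0r.
rewrite !D -/(norm2 y).
have sg : sgn s * sgn s = 1 by rewrite -expr2 sqrr_sign.
have nf := norm2_factor y.
have -> : rho y ^+ 2 *+ (i == j) = rho y ^+ 2 * (i == j)%:R by rewrite mulr_natr.
set e : R := (i == j)%:R; set t := sgn s in sg *.
move: (rho y) (y 0 i) (y 0 j) e (norm2 y) t sg nf => r a b {}e N t sg nf.
have -> : t * (r * r * a) * (t * (r * r * b)) = r ^+ 4 * a * b.
  by transitivity ((t * t) * (r ^+ 4 * a * b)); [ring|rewrite sg mul1r].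
have -> : r ^+ 2 * (r ^+ 2 * a * b * N - r * a * b - r * b * a + e) =
  r ^+ 2 * (r * a * b * (N * r) - r * a * b - r * b * a + e) by ring.
by rewrite nf; ring.
Qed.

End stereographic.

(** * Change of charts, and decay of derivatives at infinity *)

Section sphere_charts.
Context (R : realType) (n : nat).
Implicit Types (y : 'rV[R]_n) (s : bool) (u : sphere_point R n -> R).
Local Notation rho := (@stereo_factor R n).

Lemma norm2_eq0 y : norm2 y = 0 -> y = 0.
Proof.
move=> /eqP; rewrite psumr_eq0 => [/allP H|i _]; last exact: sqr_ge0.
apply/rowP => i; rewrite mxE; have := H i; rewrite mem_index_enum => /(_ isT).
by rewrite sqrf_eq0 => /eqP.
Qed.

Lemma sqr_coord_le y i : y 0 i ^+ 2 <= norm2 y.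
Proof.
rewrite /norm2 (bigD1 i)//= lerDl; apply: sumr_ge0 => j _; exact: sqr_ge0.
Qed.

Lemma norm2Z (c : R) y : norm2 (c *: y) = c ^+ 2 * norm2 y.
Proof. by rewrite /norm2 mulr_sumr; apply: eq_bigr => i _; rewrite mxE exprMn. Qed.

(** The transition map between the two charts is the inversion in the unit sphere of R^n. It brings
    a neighbourhood of infinity to a bounded set, where continuity gives bounds. *)
Lemma sphere_param_inversion s y : norm2 y != 0 ->
  sphere_param (~~ s) y = sphere_param s ((norm2 y)^-1 *: y).
Proof.
move=> N0; apply: val_inj => /=; apply/rowP => k.
have N10 : norm2 y + 1 != 0 by rewrite gt_eqF// norm2D1_gt0.
have rE : rho ((norm2 y)^-1 *: y) = norm2 y * rho y.
  rewrite /stereo_factor norm2Z.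
  have N2 : norm2 y ^- 2 * norm2 y + 1 = (norm2 y + 1) / norm2 y by field.
  by rewrite exprVn N2; field; rewrite N0 N10.
case: (fintype.split_ordP k) => i ->.
  rewrite !stereo_head rE norm2_factor.
  have -> : (-1) ^+ nat_of_bool (~~ s) = - (-1) ^+ nat_of_bool s :> R.
    by case: s; rewrite /= ?expr1 ?expr0 ?opprK.
  by ring.
by rewrite !stereo_tail rE mxE; field.
Qed.

(* Near infinity the other chart is used: it turns [u] into a function of
   [y / |y|^2], and inversion contracts at [y] by a factor of order
   [1 / |y|^2]. *)
Lemma sphere_partial_decay s u : smooth (M := sphere R n) u ->
  exists2 C, 0 <= C & forall y i,
    `|partial i (fun y => u (sphere_param s y)) y| <= C * rho y.
Proof.
move=> su.
pose U y := u (sphere_param s y).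
pose V y := u (sphere_param (~~ s) y).
have CU : Ck 1 U by exact: su s 1%N.
have CV : Ck 1 V by exact: su (~~ s) 1%N.
(* Radius 3 suffices: for |y|^2 >= 1 and |h| <= 1/4, the images of [y] and of its translate under
   inversion have coordinates at most 5/2. *)
have [L L0 HL] := @C1_lipschitz_cube R n V 3 CV.
have /choice[C HC] i : exists C, 0 <= C /\ forall y : 'rV[R]_n,
    (forall j, `|y 0 j| <= 1) -> `|partial i U y| <= C.
  have [C C0 H] := box_bounded (fun=> -1) (fun=> 1) (Ck_continuous (Ck_partial i CU)).
  by exists C; split=> // y yr; apply: H => j; rewrite -ler_norml.
have sC0 : 0 <= \sum_i C i by apply: sumr_ge0 => i _; case: (HC i).
exists (\sum_i C i + 8 * L * n%:R) => [|y i].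
  by rewrite addr_ge0// !mulr_ge0.
have r0 := stereo_factor_gt0 y.
have N0 := norm2_ge0 y.
set N := norm2 y in N0.
rewrite mulrDl; have [N1|/ltW N1] := leP N 1.
  apply: ler_wpDr; first by apply: mulr_ge0; [rewrite ?mulr_ge0|exact: ltW].
  apply: (@le_trans _ _ (C i)).
    apply: (HC i).2 => j; rewrite -(@expr_le1 _ 2)// real_normK ?num_real//.
    exact: le_trans (sqr_coord_le y j) N1.
  apply: (@le_trans _ _ (\sum_i C i)).
    by rewrite (bigD1 i)//= lerDl; apply: sumr_ge0 => j _; case: (HC j).
  by rewrite ler_peMr// /stereo_factor ler_pdivlMr ?norm2D1_gt0// mul1r -/N; lra.
apply: ler_wpDl; first by apply: mulr_ge0; [rewrite ?mulr_ge0|exact: ltW].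
have cu := @Ck_derivable _ _ _ _ i y CU.
(* The Lipschitz bound for [V] is applied to the difference quotients of [U] and passes to their
   limit. *)
have cq : (`|h^-1 *: (U (h *: delta_mx 0 i + y) - U y)| @[h --> 0^']) --> `|partial i U y|.
  by apply: cvg_norm; exact: cu.
rewrite -(cvg_lim _ cq)//.
apply: limr_le; first by apply/cvg_ex; exists (`|partial i U y|).
near=> h.
have h0 : h != 0 by near: h; exact: nbhs_dnbhs_neq.
have h4 : `|h| <= 4^-1.
  by near: h; apply: dnbhs0_le; rewrite invr_gt0.
have hh : 0 < `|h| by rewrite normr_gt0.
have yN j : `|y 0 j| <= N.
  rewrite -(@ler_pXn2r _ 2) ?nnegrE// real_normK ?num_real//.
  by apply: (le_trans (sqr_coord_le y j)); rewrite -/N expr2 ler_peMr.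
have yy j : `|y 0 j| * `|y 0 i| <= N.
  have := sqr_coord_le y j; have := sqr_coord_le y i; rewrite -/N.
  rewrite -[y 0 i ^+ 2]real_normK ?num_real// -[y 0 j ^+ 2]real_normK ?num_real//.
  by have := sqr_ge0 (`|y 0 j| - `|y 0 i|); nra.
pose y' := h *: delta_mx 0 i + y.
have y'E j : y' 0 j = h * (j == i)%:R + y 0 j by rewrite !mxE eqxx.
have N'E : norm2 y' = N + 2 * h * y 0 i + h ^+ 2.
  have E2 : \sum_(j < n | j != i) y' 0 j ^+ 2 = \sum_(j < n | j != i) y 0 j ^+ 2.
    by apply: eq_bigr => j ji; rewrite y'E (negbTE ji) mulr0 add0r.
  rewrite /N /norm2 [LHS](bigD1 i)//= [in RHS](bigD1 i)//= E2 y'E eqxx mulr1.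
  by move: (\sum_(j < n | j != i) _) => S; ring.
(* Here |2 h y_i| <= N / 2, because |h| <= 1/4 and |y_i| <= N. *)
have N'N : N / 2 <= norm2 y'.
  have : `|2 * h * y 0 i| <= N / 2.
    rewrite !normrM [`|2|]ger0_norm//.
    by have := ler_pM (normr_ge0 _) (normr_ge0 _) h4 (yN i); lra.
  by rewrite ler_norml N'E; have := sqr_ge0 h; lra.
set N' := norm2 y' in N'E N'N.
have N'0 : 0 < N' by lra.
have NN0 : 0 < N by lra.
have UE : U y = V (N^-1 *: y).
  by rewrite /U /V -sphere_param_inversion ?negbK// -/N gt_eqF.
have UE' : U y' = V (N'^-1 *: y').
  by rewrite /U /V -sphere_param_inversion ?negbK// -/N' gt_eqF.
rewrite -/y' UE UE' -[_ *: _]/(_ * _) normrM normfV mulrC ler_pdivrMr//.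
apply: le_trans (HL _ _ _ _) _.
- move=> j; rewrite mxE normrM gtr0_norm ?invr_gt0// mulrC ler_pdivrMr// y'E.
  apply: (le_trans (ler_normD _ _)); rewrite normrM.
  have : `|h| * `|(j == i)%:R| <= 4^-1 :> R.
    by case: eqP; rewrite ?normr1 ?normr0 ?mulr1 ?mulr0.
  by have := yN j; lra.
- move=> j; rewrite mxE normrM gtr0_norm ?invr_gt0// mulrC ler_pdivrMr//.
  by have := yN j; lra.
have -> : 8 * L * n%:R * rho y * `|h| = L * (\sum_(j < n) 8 * (rho y * `|h|)).
  by rewrite sumr_const card_ord -mulr_natl; ring.
apply: ler_wpM2l => //.
apply: ler_sum => j _; rewrite [(N'^-1 *: y') 0 j]mxE y'E [(N^-1 *: y) 0 j]mxE.
(* The numerator is at most 4 N |h|; with N' >= N / 2 and 1 / N <= rho, each coordinate of the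
   difference is at most 8 rho |h|, which explains the constant 8. *)
have -> : N'^-1 * (h * (j == i)%:R + y 0 j) - N^-1 * y 0 j =
   (h * ((j == i)%:R * N - y 0 j * (2 * y 0 i + h))) / (N * N').
  rewrite N'E; set d : R := (j == i)%:R; field.
  by rewrite -N'E !gt_eqF.
rewrite normrM normrM normfV [`|N * N'|]gtr0_norm ?mulr_gt0//.
rewrite mulrA [leRHS]mulrC -[leLHS]mulrA; apply: ler_wpM2l => //.
have num : `|(j == i)%:R * N - y 0 j * (2 * y 0 i + h)| <= 4 * N.
  apply: (le_trans (ler_normB _ _)); rewrite !normrM.
  have : `|(j == i)%:R| * `|N| <= N :> R.
    by rewrite (ger0_norm N0); case: eqP => _; rewrite ?normr1 ?normr0 ?mul1r ?mul0r.
  have : `|y 0 j| * `|2 * y 0 i + h| <= 3 * N.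
    apply: (@le_trans _ _ (`|y 0 j| * (2 * `|y 0 i| + `|h|))).
      apply: ler_wpM2l => //; apply: (le_trans (ler_normD _ _)).
      by rewrite normrM [`|2|]ger0_norm.
    by have := ler_pM (normr_ge0 _) (normr_ge0 _) (yN j) h4; have := yy j; lra.
  lra.
rewrite ler_pdivrMr ?mulr_gt0//; apply: (le_trans num).
have r1 : N^-1 <= rho y.
  by rewrite /stereo_factor -/N ler_pdivlMr ?norm2D1_gt0// mulrC ler_pdivrMr//; lra.
have : 1 <= rho y * N by rewrite -ler_pdivrMr// mul1r.
by nra.
Unshelve. all: by end_near. Qed.

End sphere_charts.

(** * Integration and Green's formula on the sphere *)

Section sphere_green.
Context (R : realType) (n : nat).
Implicit Types (y : 'rV[R]_n) (u h : sphere_point R n -> R).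
Local Notation mR := (measurableTypeR R).
Local Notation rho := (@stereo_factor R n).
Local Notation S := (sphere R n).

Definition sphere_density y : R := rho y ^+ n.

Lemma measurable_rowT : measurable (@row_of_tuple R n @^-1` setT : set (n.-tuple mR)).
Proof. by rewrite preimage_setT. Qed.

Lemma continuous_sphere_density : continuous sphere_density.
Proof. by apply: (@Ck_continuous _ _ 0); apply: CkX; exact: Ck_stereo_factor. Qed.

Lemma sphere_density_gt0 y : 0 < sphere_density y.
Proof. by rewrite exprn_gt0// stereo_factor_gt0. Qed.

(** Since |y|^2 >= y_i^2 for every i, the n factors of rho^n are bounded by the functions 2 / (1 +
    y_i^2) of one variable each. *)
Lemma integrable_sphere_density :
  (lebesgue_tuple R n).-integrable (@row_of_tuple R n @^-1` setT)
    (fun t => (sphere_density (row_of_tuple t))%:E).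
Proof.
pose f (x : R) := 2 / (1 + x ^+ 2).
have f0 x : 0 <= f x by rewrite divr_ge0// addr_ge0// sqr_ge0.
have cf : continuous f.
  by move=> x; apply: cvgM; [exact: cvg_cst|exact: continuous_oneDsqrV].
apply/integrableP; split.
  by apply/measurable_EFinP; apply: measurable_funTS; apply: measurable_row_of_tuple;
    exact: continuous_sphere_density.
under eq_integral do rewrite gee0_abs ?lee_fin ?ltW ?sphere_density_gt0//.
apply: le_lt_trans (integrable_prod_tuple n f0 cf (integral_cauchy_lty R)).
apply: ge0_le_integral => //.
- exact: measurable_rowT.
- by move=> t _; rewrite lee_fin ltW ?sphere_density_gt0.
- apply/measurable_EFinP; apply: measurable_funTS; apply: measurable_row_of_tuple.
  exact: continuous_sphere_density.
- apply/measurable_EFinP; apply: measurable_funTS; apply: measurable_prod => i _.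
  apply: measurableT_comp; first exact: continuous_measurable_fun.
  exact: measurable_coord.
move=> t _; rewrite lee_fin.
rewrite /sphere_density -[in X in _ ^+ X](card_ord n) -prodr_const.
apply: ler_prod => i _; rewrite ltW ?stereo_factor_gt0//=.
rewrite /stereo_factor ler_pM2l// lef_pV2 ?posrE ?norm2D1_gt0//.
  by rewrite addrC lerD2r; have := sqr_coord_le (row_of_tuple t) i; rewrite mxE.
by rewrite ltr_pwDl// sqr_ge0.
Qed.

(** A point outside the unit ball of one chart lies in the unit ball of the other, so two compact
    balls give the bound. *)
Lemma smooth_sphere_tame s u : smooth (M := S) u ->
  tame setT (fun y => u (sphere_param s y)).
Proof.
move=> su; pose U b y := u (sphere_param b y).
have cU b : continuous (U b) by exact: su b 0%N.
split; first exact: cU.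
have [C C0 HC] := box_bounded (fun=> -1) (fun=> 1) (cU s).
have [C' C'0 HC'] := box_bounded (fun=> -1) (fun=> 1) (cU (~~ s)).
have small y i : norm2 y <= 1 -> `|y 0 i| <= 1.
  move=> N1; rewrite -(@expr_le1 _ 2)// real_normK ?num_real//.
  exact: le_trans (sqr_coord_le y i) N1.
exists (C + C') => [|y _]; first exact: addr_ge0.
have [N1|N1] := leP (norm2 y) 1.
  by apply: ler_wpDr => //; apply: HC => i; rewrite -ler_norml small.
have N0 : norm2 y != 0 by rewrite gt_eqF// (lt_trans _ N1).
have -> : u (sphere_param s y) = U (~~ s) ((norm2 y)^-1 *: y).
  by rewrite /U -sphere_param_inversion ?negbK.
apply: ler_wpDl => //; apply: HC' => i; rewrite -ler_norml small// norm2Z.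
by rewrite exprVn expr2 invfM -mulrA mulVf// mulr1 invf_le1 ?ltW// (lt_trans _ N1).
Qed.

Lemma sphere_metricE (a : chart S) (y : 'rV[R]_(Defs.dim S)) :
  metric (r := S) a y = (rho y ^+ 2)%:M.
Proof. exact: stereo_metric. Qed.

Hypothesis n2 : (1 < n)%N.

(** For n >= 2 the exponent is a natural number, so smoothness is inherited from rho. *)
Lemma sphere_flux_density : @flux_density R S rho = fun y => rho y ^+ n.-2.
Proof.
apply/funext => y; rewrite /flux_density /=.
have r0 : rho y != 0 by rewrite gt_eqF// stereo_factor_gt0.
have E : n = n.-2.+2 by case: n n2 => [|[]].
have -> : rho y ^+ n = rho y ^+ n.-2 * rho y ^+ 2 by rewrite -exprD addn2; congr (_ ^+ _).
by rewrite mulfK// expf_neq0.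
Qed.

Lemma Ck_sphere_flux k : Ck k (@flux_density R S rho).
Proof. by rewrite sphere_flux_density; apply: CkX; exact: Ck_stereo_factor. Qed.

(* On the boundary of the cube [-k, k]^n the flux density is O(k^(2 - 2 n)),
   while the boundary has area O(k^(n - 1)). *)
Lemma sphere_green (u h : sphere_point R n -> R) (Lu Lh : 'rV[R]_n -> R) :
  smooth (M := S) u -> smooth (M := S) h ->
  (forall y, laplacian (M := S) u false y = Lu y) ->
  (forall y, laplacian (M := S) h false y = Lh y) ->
  tame setT Lu -> tame setT Lh ->
  wint setT sphere_density (fun y => h (sphere_param false y) * Lu y) =
  wint setT sphere_density (fun y => u (sphere_param false y) * Lh y).
Proof.
move=> su sh ELu ELh tLu tLh.
pose U y := u (sphere_param false y).
pose H y := h (sphere_param false y).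
have tU : tame setT U by exact: smooth_sphere_tame.
have tH : tame setT H by exact: smooth_sphere_tame.
pose g y := H y * Lu y + -1 * (U y * Lh y).
have tg : tame setT g by apply: tameD; [exact: tameM|apply/tameZ/tameM].
have iw := integrable_sphere_density.
have mT := measurable_rowT; have cw := continuous_sphere_density.
suff g0 : wint setT sphere_density g = 0.
  apply/eqP; rewrite -subr_eq0 -mulN1r -(wintZ mT cw iw (-1) (tameM tU tLh)).
  by rewrite -(wintD mT cw iw (tameM tH tLu) (tameZ (-1) (tameM tU tLh))) g0.
pose Y := @green_field R S rho H U.
have CU : Ck 2 U by exact: su false 2%N.
have CH : Ck 2 H by exact: sh false 2%N.
have CY i : Ck 1 (Y i) := @Ck_green_field R S rho Ck_sphere_flux H U i CH CU.
have sg0 : forall y : 'rV[R]_(Defs.dim S), 0 < rho y by exact: stereo_factor_gt0.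
have gE y : g y * sphere_density y = \sum_i partial i (Y i) y.
  rewrite -(@green_pointwise R S rho sg0 Ck_sphere_flux H U y CH CU).
  rewrite -(laplacianE sg0 sphere_metricE u false) -(laplacianE sg0 sphere_metricE h false).
  by rewrite ELu ELh /g mulN1r.
(* The flux density is rho^(n-2), the functions are bounded, and their derivatives contribute one
   more factor rho. *)
have [B B0 HB] : exists2 B, 0 <= B & forall i y, `|Y i y| <= B * rho y ^+ n.-1.
  have [_ [A A0 HA]] := tU; have [_ [A' A'0 HA']] := tH.
  have [C C0 HC] := sphere_partial_decay false su.
  have [C' C'0 HC'] := sphere_partial_decay false sh.
  exists (A' * C + A * C') => [|i y]; first by rewrite addr_ge0// mulr_ge0.
  have r0 := stereo_factor_gt0 y.
  have rn0 : 0 <= rho y ^+ n.-2 by rewrite exprn_ge0// ltW.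
  have -> : (A' * C + A * C') * rho y ^+ n.-1 =
     A' * (rho y ^+ n.-2 * (C * rho y)) + A * (rho y ^+ n.-2 * (C' * rho y)).
    have -> : n.-1 = n.-2.+1 by case: n n2 => [|[]].
    by rewrite exprS; ring.
  rewrite /Y /green_field sphere_flux_density; apply: (le_trans (ler_normD _ _)).
  rewrite mulN1r normrN; apply: lerD; rewrite normrM; apply: ler_pM => //.
  - exact: HA'.
  - by rewrite normrM (ger0_norm rn0) ler_wpM2l//; exact: HC.
  - exact: HA.
  - by rewrite normrM (ger0_norm rn0) ler_wpM2l//; exact: HC'.
have ig := tame_integrable mT cw iw tg.
have cg : continuous (fun y => g y * sphere_density y).
  by apply: continuous_mulrV => //; case: tg.
have lim_cube := cvg_integral_cubes cg ig.
(* On the faces rho <= 2 / k^2, and the sides have length 2 k, so each pair of faces contributes at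
   most 2 B (4 / k)^(n-1). For k >= 4 and n >= 2 this is at most 2 B * 4 / k. *)
pose K := n%:R * (2 * B) * 4.
have cube_le k : (4 <= k)%N ->
    `|integral_rV (box (fun=> - k%:R) (fun=> k%:R)) (fun y => g y * sphere_density y)| <= K / k%:R.
  move=> k4; have k0 : 0 < k%:R :> R by rewrite ltr0n (leq_trans _ k4).
  have -> : (fun y => g y * sphere_density y) = (fun y => \sum_i partial i (Y i) y).
    by apply/funext => y; exact: gE.
  have [nn n1] : n = n.-1.+1 /\ (0 < n.-1)%N by case: n n2 => [|[]].
  apply: le_trans (integral_box_div (e := 2 * B * (2 / k%:R ^+ 2) ^+ n.-1) _ CY _) _.
  - by rewrite gtrN.
  - move=> i y _.
    have bd c : c ^+ 2 = k%:R ^+ 2 -> `|Y i (set_coord i c y)| <= B * (2 / k%:R ^+ 2) ^+ n.-1.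
      move=> ck; apply: (le_trans (HB _ _)); apply: ler_wpM2l => //.
      have h2 : rho (set_coord i c y) <= 2 / k%:R ^+ 2.
        rewrite /stereo_factor ler_pM2l// lef_pV2 ?posrE ?norm2D1_gt0 ?exprn_gt0//.
        have := sqr_coord_le (set_coord i c y) i; rewrite mxE eqxx -ck => h1.
        by rewrite (le_trans h1)// lerDl.
      have r0 := stereo_factor_gt0 (set_coord i c y).
      by apply: lerXn2r => //; rewrite nnegrE ltW// (lt_le_trans r0).
    apply: (le_trans (ler_normB _ _)); rewrite -mulrA mulr_natl mulr2n.
    by apply: lerD; apply: bd; rewrite ?sqrrN.
  - rewrite opprK.
    have -> : 2 * B * (2 / k%:R ^+ 2) ^+ n.-1 * (k%:R + k%:R) ^+ n.-1 =
        2 * B * (4 / k%:R) ^+ n.-1.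
      rewrite -mulrA -exprMn; congr (_ * _ ^+ _); field.
      by rewrite gt_eqF.
    rewrite /K -!mulrA; do 3 (apply: ler_wpM2l => //).
    have q1 : 0 <= (4 / k%:R : R) <= 1.
      by rewrite divr_ge0//= ler_pdivrMr// mul1r ler_nat.
    have /andP[q0 q2] := q1.
    by case: (n.-1) n1 => // m _; rewrite exprS ler_piMr// exprn_ile1.
apply/eqP; case: eqP => // /eqP g0.
have d0 : 0 < `|wint setT sphere_density g| / 2 by rewrite divr_gt0// normr_gt0.
have /cvgrPdist_lt/(_ _ d0) near1 := lim_cube.
have [k [k4 kK near_k]] : exists k : nat, [/\ (4 <= k)%N,
   K / k%:R < `|wint setT sphere_density g| / 2 &
   `|wint setT sphere_density g - integral_rV (box (fun=> - k%:R) (fun=> k%:R)) (fun y => g y * sphere_density y)| < `|wint setT sphere_density g| / 2].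
  near \oo => k; exists k; split; [near: k; exact: nbhs_infty_ge| |near: k; exact: near1].
  have k0 : 0 < k%:R :> R by rewrite ltr0n; near: k; exact: nbhs_infty_gt.
  rewrite ltr_pdivrMr// mulrC -ltr_pdivrMr//.
  near: k; exact: nbhs_infty_gtr.
have := cube_le k k4.
set I := integral_rV _ _ in near_k *; set J := wint _ _ _ in kK near_k d0 *.
have : `|J| <= `|J - I| + `|I| by rewrite -{1}(subrK I J) ler_normD.
lra.
Unshelve. all: by end_near. Qed.

End sphere_green.

(** * Product and power rules for the Laplacian *)

Section carre_du_champ.
Context (R : realType) (M : riemannian R) (rho : 'rV[R]_(Defs.dim M) -> R).
Local Notation n := (Defs.dim M).
Hypothesis rho_gt0 : forall y, 0 < rho y.
Hypothesis Csigma : forall k, Ck k (flux_density (M := M) rho).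
Local Notation sigma := (flux_density (M := M) rho).
Local Notation L := (conformal_laplacian (M := M) rho).

(** The inner product of the gradients of [F] and [G]; twice this is the defect in the Leibniz rule
    for the Laplacian. *)
Definition carre_du_champ (F G : 'rV[R]_n -> R) y : R :=
  (rho y ^+ 2)^-1 * \sum_i partial i F y * partial i G y.
Local Notation Gamma := carre_du_champ.

Let rn0 y : rho y ^+ n != 0. Proof. by rewrite expf_neq0// gt_eqF. Qed.

Let Csp i F : Ck 2 F -> Ck 1 (fun z => sigma z * partial i F z).
Proof. by move=> CF; exact: CkM (Csigma 1) (Ck_partial i CF). Qed.

Let sum_comb (g f s : R) (A B C : 'I_n -> R) :
  \sum_i (g * A i + f * B i + s * C i) =
  g * (\sum_i A i) + f * (\sum_i B i) + s * \sum_i C i.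
Proof. by rewrite !big_split/= -!mulr_sumr. Qed.

Let divE y (c : R) : (rho y ^+ n)^-1 * (sigma y * c) = (rho y ^+ 2)^-1 * c.
Proof. by rewrite /flux_density -[_ * _^-1 * c]mulrA mulKf. Qed.

Lemma laplacianM F G y : Ck 2 F -> Ck 2 G ->
  L (fun z => F z * G z) y = F y * L G y + G y * L F y + 2 * Gamma F G y.
Proof.
move=> CF CG.
have dF i z : derivable F z (delta_mx 0 i) by exact: Ck_derivable CF.
have dG i z : derivable G z (delta_mx 0 i) by exact: Ck_derivable CG.
have dsF i z := @Ck_derivable _ _ _ _ i z (Csp i CF).
have dsG i z := @Ck_derivable _ _ _ _ i z (Csp i CG).
have E i : partial i (fun z => sigma z * partial i (fun z => F z * G z) z) y =
    G y * partial i (fun z => sigma z * partial i F z) y +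
    F y * partial i (fun z => sigma z * partial i G z) y +
    (sigma y * 2) * (partial i F y * partial i G y).
  rewrite (partialM (dF i) (dG i)).
  have -> : (fun z => sigma z * (partial i F z * G z + F z * partial i G z)) =
    (fun z => G z * (sigma z * partial i F z) + F z * (sigma z * partial i G z)).
    by apply/funext => z; move: (sigma z) (partial i F z) (partial i G z) (F z) (G z) => *; ring.
  have d1 z : derivable (fun z => G z * (sigma z * partial i F z)) z (delta_mx 0 i).
    exact: derivableM (dG i z) (dsF i z).
  have d2 z : derivable (fun z => F z * (sigma z * partial i G z)) z (delta_mx 0 i).
    exact: derivableM (dF i z) (dsG i z).
  rewrite (partialD d1 d2) (partialM (dG i) (dsF i)) (partialM (dF i) (dsG i)).
  move: (partial i (fun z => sigma z * partial i F z) y) (partial i (fun z => sigma z * partial i G z) y) => A B.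
  by move: (sigma y) (partial i F y) (partial i G y) (F y) (G y) => *; ring.
pose A := \sum_i partial i (fun z => sigma z * partial i F z) y.
pose B := \sum_i partial i (fun z => sigma z * partial i G z) y.
pose C := \sum_i partial i F y * partial i G y.
have LFG : L (fun z => F z * G z) y = (rho y ^+ n)^-1 * (G y * A + F y * B + sigma y * 2 * C).
  by rewrite -sum_comb; congr (_ * _); apply: eq_bigr => i _; exact: E.
rewrite LFG -[L F y]/((rho y ^+ n)^-1 * A) -[L G y]/((rho y ^+ n)^-1 * B).
rewrite -[Gamma F G y]/((rho y ^+ 2)^-1 * C) -[sigma y * 2 * _]mulrA mulrDr divE.
move: (F y) (G y) ((rho y ^+ n)^-1) ((rho y ^+ 2)^-1) A B C {LFG} => f g r1 r2 A B C.
by ring.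
Qed.

Lemma laplacianX F k y : Ck 2 F ->
  L (fun z => F z ^+ k) y =
  k%:R * F y ^+ k.-1 * L F y + k%:R * k.-1%:R * F y ^+ k.-2 * Gamma F F y.
Proof.
move=> CF.
have dF i z : derivable F z (delta_mx 0 i) by exact: Ck_derivable CF.
have dsF i z := @Ck_derivable _ _ _ _ i z (Csp i CF).
(* The summand [0 * 0] only fills the middle slot of [sum_comb]. *)
have E i : partial i (fun z => sigma z * partial i (fun z => F z ^+ k) z) y =
    k%:R * F y ^+ k.-1 * partial i (fun z => sigma z * partial i F z) y +
    0 * 0 + (sigma y * (k%:R * k.-1%:R * F y ^+ k.-2)) * (partial i F y * partial i F y).
  rewrite (partialX k (dF i)).2.
  have -> : (fun z => sigma z * (k%:R * F z ^+ k.-1 * partial i F z)) =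
    (fun z => k%:R * (F z ^+ k.-1 * (sigma z * partial i F z))).
    by apply/funext => z; move: (sigma z) (partial i F z) (F z ^+ k.-1) (k%:R : R) => *; ring.
  have [dX1 dX2] := partialX k.-1 (dF i).
  have d1 z : derivable (fun z => F z ^+ k.-1 * (sigma z * partial i F z)) z (delta_mx 0 i).
    exact: derivableM (dX1 z) (dsF i z).
  rewrite (partialZ _ d1) (partialM dX1 (dsF i)) dX2.
  move: (partial i (fun z => sigma z * partial i F z) y) (sigma y) (partial i F y) => A s f.
  by move: (F y ^+ k.-1) (F y ^+ k.-2) (k%:R : R) (k.-1%:R : R) => *; ring.
pose A := \sum_i partial i (fun z => sigma z * partial i F z) y.
pose C := \sum_i partial i F y * partial i F y.
have LFk : L (fun z => F z ^+ k) y = (rho y ^+ n)^-1 * (k%:R * F y ^+ k.-1 * A +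
    0 * (\sum_(i < n) 0) + sigma y * (k%:R * k.-1%:R * F y ^+ k.-2) * C).
  by rewrite -sum_comb; congr (_ * _); apply: eq_bigr => i _; exact: E.
rewrite LFk -[L F y]/((rho y ^+ n)^-1 * A) -[Gamma F F y]/((rho y ^+ 2)^-1 * C).
rewrite mul0r addr0 -[sigma y * _ * _]mulrA mulrDr divE.
move: (F y ^+ k.-1) (F y ^+ k.-2) (k%:R : R) (k.-1%:R : R) ((rho y ^+ n)^-1) ((rho y ^+ 2)^-1) A C {LFk} => *.
by ring.
Qed.

Lemma carre_du_champX F G a b y : Ck 2 F -> Ck 2 G ->
  Gamma (fun z => F z ^+ a) (fun z => G z ^+ b) y =
  a%:R * b%:R * F y ^+ a.-1 * G y ^+ b.-1 * Gamma F G y.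
Proof.
move=> CF CG; rewrite /Gamma [RHS]mulrCA; congr (_ * _).
rewrite mulr_sumr; apply: eq_bigr => i _.
rewrite (partialX a (fun z => @Ck_derivable _ _ _ _ i z CF)).2.
rewrite (partialX b (fun z => @Ck_derivable _ _ _ _ i z CG)).2.
move: (partial i F y) (partial i G y) (F y ^+ a.-1) (G y ^+ b.-1) (a%:R : R) (b%:R : R) => *; ring.
Qed.

End carre_du_champ.

(** * Linear coordinates on the sphere *)

Section zonal.
Context (R : realType) (n : nat).
Implicit Types (y : 'rV[R]_n) (s : bool) (p x : sphere_point R n).
Local Notation rho := (@stereo_factor R n).
Local Notation S := (sphere R n).
Local Notation L := (@conformal_laplacian R S rho).
Local Notation Gamma := (@carre_du_champ R S rho).
Hypothesis n2 : (1 < n)%N.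

Definition height p x : R := \sum_k val x 0 k * val p 0 k.

Let height_y p s y : R := height p (sphere_param s y).
(** The height of the pole from which the chart projects, hence the limit of [height_y] at
    infinity. *)
Let pole p s : R := (-1) ^+ nat_of_bool s * val p 0 (lshift n ord0).
Let ell p y : R := \sum_i val p 0 (rshift 1 i) * y 0 i.

Let heightE p s y : height_y p s y = pole p s + rho y * (ell p y + -1 * pole p s).
Proof.
rewrite /height_y /height big_split_ord/= big_ord1 stereo_head /pole.
under eq_bigr do rewrite stereo_tail -mulrA [_ * val p _ _]mulrC.
by rewrite -mulr_sumr /ell; move: (\sum_(_ < n) _) (rho y) ((-1) ^+ s) (val p _ _) => *; ring.
Qed.

Let Ck_ell k p : Ck k (ell p).
Proof. by apply: Ck_sum => i; apply: CkZ; exact: Ck_coord. Qed.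

Let Ck_height k p s : Ck k (height_y p s).
Proof.
rewrite (_ : height_y p s = fun y => pole p s + rho y * (ell p y + -1 * pole p s)); last first.
  by apply/funext => y; rewrite heightE.
apply: CkD; first exact: Ck_cst.
by apply: CkM; [exact: Ck_stereo_factor|apply: CkD; [exact: Ck_ell|exact: Ck_cst]].
Qed.

Lemma smooth_height p : smooth (M := S) (height p).
Proof. by move=> s k; exact: Ck_height. Qed.

Let partial_ell i p : partial i (ell p) = (fun=> val p 0 (rshift 1 i)).
Proof.
have d j y : derivable (fun y : 'rV[R]_n => val p 0 (rshift 1 j) * y 0 j) y (delta_mx 0 i).
  by apply: (@Ck_derivable _ _ 0); apply: CkZ; exact: Ck_coord.
rewrite /ell (partial_sum _ d).2; apply/funext => y.
have E j : partial i (fun y : 'rV[R]_n => val p 0 (rshift 1 j) * y 0 j) y =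
    val p 0 (rshift 1 j) * (j == i)%:R.
  rewrite partialZ ?partial_coord// => z.
  by apply: (@Ck_derivable _ _ 0); exact: Ck_coord.
rewrite (bigD1 i)//= E eqxx mulr1 big1 ?addr0// => j /negbTE ji.
by rewrite E ji mulr0.
Qed.

Let partial_height i p s : partial i (height_y p s) = fun y =>
  rho y * (val p 0 (rshift 1 i) + (pole p s + -1 * ell p y) * rho y * y 0 i).
Proof.
rewrite (_ : height_y p s = fun y => pole p s + rho y * (ell p y + -1 * pole p s)); last first.
  by apply/funext => y; rewrite heightE.
have [d1 d2] := @partial_stereo_factor R n i.
have d3 y : derivable (fun y => ell p y + -1 * pole p s) y (delta_mx 0 i).
  by apply: (@Ck_derivable _ _ 0); apply: CkD; [exact: Ck_ell|exact: Ck_cst].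
have d4 y : derivable (fun y => rho y * (ell p y + -1 * pole p s)) y (delta_mx 0 i).
  exact: derivableM (d1 y) (d3 y).
rewrite (partialD (fun y => derivable_cst (pole p s) y _) d4) (partialM d1 d3) d2.
have d5 y : derivable (ell p) y (delta_mx 0 i) by exact: (@Ck_derivable _ _ 0).
rewrite (partialD d5 (fun y => derivable_cst (-1 * pole p s) y _)) partial_ell !partial_cst.
apply/funext => y; move: (rho y) (y 0 i) (ell p y) (pole p s) (val p _ _) => *; ring.
Qed.

Let sum_ell p y : \sum_i val p 0 (rshift 1 i) * y 0 i = ell p y. Proof. by []. Qed.

Let norm2_pole p s : \sum_i val p 0 (rshift 1 i) ^+ 2 = 1 - pole p s ^+ 2.
Proof.
have /eqP := valP p; rewrite /norm2 big_split_ord/= big_ord1 => E.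
by rewrite /pole exprMn sqrr_sign mul1r; apply/eqP; rewrite eq_sym subr_eq addrC E.
Qed.

(** Geometrically, the gradient of <x,p> is the tangential part p - <x,p> x of p, and |p| = |x| =
    1. *)
Lemma carre_du_champ_height p s y :
  Gamma (height_y p s) (height_y p s) y = 1 - height_y p s y ^+ 2.
Proof.
rewrite /carre_du_champ.
have r0 : rho y != 0 by rewrite gt_eqF// stereo_factor_gt0.
have E i : partial i (height_y p s) y * partial i (height_y p s) y =
   rho y ^+ 2 * (val p 0 (rshift 1 i) ^+ 2
    + 2 * ((pole p s - ell p y) * rho y) * (val p 0 (rshift 1 i) * y 0 i)
    + ((pole p s - ell p y) * rho y) ^+ 2 * (y 0 i ^+ 2)).
  rewrite !partial_height mulN1r.
  by move: (val p _ _) (y 0 i) (rho y) (pole p s) (ell p y) => *; ring.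
rewrite (eq_bigr _ (fun i _ => E i)) -mulr_sumr !big_split/= -!mulr_sumr.
rewrite (norm2_pole p s) sum_ell -/(norm2 y) mulKf ?expf_neq0// heightE.
have nf := norm2_factor y.
move: (norm2 y) (rho y) (pole p s) (ell p y) nf => N r c l nf.
transitivity (1 - c ^+ 2 + 2 * ((c - l) * r) * l + (c - l) ^+ 2 * r * (N * r)).
  by ring.
by rewrite nf; ring.
Qed.

(** Linear forms are the spherical harmonics of degree 1. In the chart, every term of the divergence
    contains rho^n, which cancels the inverse volume density. *)
Lemma laplacian_height p s y : L (height_y p s) y = - n%:R * height_y p s y.
Proof.
rewrite /conformal_laplacian.
have n0 : n = n.-2.+2 by case: n n2 => [|[]].
have r0 z : rho z != 0 by rewrite gt_eqF// stereo_factor_gt0.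
have rX z k : (0 < k)%N -> rho z ^+ k = rho z * rho z ^+ k.-1.
  by case: k => // k _; rewrite exprS.
have n1 : (0 < n)%N by exact: ltnW.
have n1' : (0 < n.-1)%N by case: n n2 => [|[]].
pose q i := val p 0 (rshift 1 i); pose c := pole p s.
have E i : partial i (fun z => @flux_density R S rho z * partial i (height_y p s) z) y =
   rho y ^+ n * (- n%:R * (q i * y 0 i) + (c - ell p y) * 1
     + - n%:R * ((c - ell p y) * rho y) * (y 0 i ^+ 2)).
  have -> : (fun z => @flux_density R S rho z * partial i (height_y p s) z) =
     (fun z => q i * rho z ^+ n.-1 + (c + -1 * ell p z) * (rho z ^+ n * z 0 i)).
    apply/funext => z; rewrite sphere_flux_density// partial_height.
    rewrite (rX _ n)// (rX _ n.-1)//.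
    by rewrite -/(q i) -/c; move: (q i) (rho z) (rho z ^+ n.-2) (ell p z) (z 0 i) => *; ring.
  have dr z : derivable rho z (delta_mx 0 i) := (@partial_stereo_factor R n i).1 z.
  have [dX1 dX2] := partialX n.-1 dr.
  have [dY1 dY2] := partialX n dr.
  have dc z : derivable (fun z : 'rV[R]_n => z 0 i) z (delta_mx 0 i).
    by apply: (@Ck_derivable _ _ 0); exact: Ck_coord.
  have dYc z : derivable (fun z : 'rV[R]_n => rho z ^+ n * z 0 i) z (delta_mx 0 i).
    exact: derivableM (dY1 z) (dc z).
  have del z : derivable (ell p) z (delta_mx 0 i) by exact: (@Ck_derivable _ _ 0).
  have dml z : derivable (fun z => -1 * ell p z) z (delta_mx 0 i).
    exact: derivableM (derivable_cst _ _ _) (del z).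
  have dcl z : derivable (fun z => c + -1 * ell p z) z (delta_mx 0 i).
    exact: derivableD (derivable_cst _ _ _) (dml z).
  have dqX z : derivable (fun z => q i * rho z ^+ n.-1) z (delta_mx 0 i).
    exact: derivableM (derivable_cst _ _ _) (dX1 z).
  have dP z : derivable (fun z => (c + -1 * ell p z) * (rho z ^+ n * z 0 i)) z (delta_mx 0 i).
    exact: derivableM (dcl z) (dYc z).
  rewrite (partialD dqX dP) (partialZ _ dX1) dX2 (partialM dcl dYc) (partialM dY1 dc) dY2.
  rewrite (partialD (fun z => derivable_cst c z _) dml) (partialZ _ del) partial_ell partial_cst.
  rewrite (@partial_stereo_factor R n i).2 partial_coord eqxx [_ * true%:R]mulr1 -/(q i).
  have -> : n.-1%:R = n%:R - 1 :> R by rewrite -[in RHS](prednK n1) -natr1 addrK.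
  rewrite (rX _ n)// (rX _ n.-1)//.
  move: (q i) (rho y) (rho y ^+ n.-2) (ell p y) (y 0 i) (n%:R : R) => *; ring.
rewrite (eq_bigr _ (fun i _ => E i)) -mulr_sumr mulKf ?expf_neq0//.
rewrite !big_split/= -!mulr_sumr sum_ell -/(norm2 y) sumr_const card_ord heightE -/c.
have nf := norm2_factor y.
move: (norm2 y) (rho y) c (ell p y) (n%:R : R) nf {E} => N r {}c l m nf.
transitivity (- m * l + (c - l) * m - m * (c - l) * (N * r)); first by ring.
by rewrite nf; ring.
Qed.

End zonal.

(** * Moments of eigenfunctions on the sphere *)

Section sphere_spectrum.
Context (R : realType) (n : nat).
Implicit Types (y : 'rV[R]_n) (s : bool) (p x : sphere_point R n).
Implicit Types (u h : sphere_point R n -> R).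
Local Notation rho := (@stereo_factor R n).
Local Notation S := (sphere R n).
Hypothesis n2 : (1 < n)%N.

Definition sphere_integral (h : 'rV[R]_n -> R) : R := wint setT (@sphere_density R n) h.
Local Notation E := sphere_integral.
Local Notation tame := (tame (setT : set 'rV[R]_n)).

Let mT := @measurable_rowT R n.
Let cw := @continuous_sphere_density R n.
Let iw := @integrable_sphere_density R n.
Let r0 : forall y : 'rV[R]_(Defs.dim S), 0 < rho y := @stereo_factor_gt0 R n.
Let Cs := @Ck_sphere_flux R n n2.

Lemma integralM_sphere u : integralM (M := S) u = E (fun y => u (sphere_param false y)).
Proof.
rewrite /integralM /integral_coord /E /wint; congr (integral_rV _ _).
by apply/funext => y; rewrite (volume_densityE r0 (@sphere_metricE R n)).
Qed.

Lemma laplacian_sphereE u s y : laplacian (M := S) u s y =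
  conformal_laplacian (M := S) rho (fun y => u (sphere_param s y)) y.
Proof. exact: (laplacianE r0 (@sphere_metricE R n)). Qed.

Lemma smooth_affine_height a p k : smooth (M := S) (fun x => (a + height p x) ^+ k).
Proof.
move=> s m; apply: (@CkX _ _ m (fun y : 'rV[R]_n => a + height p (sphere_param s y))).
by apply: CkD; [exact: Ck_cst|exact: smooth_height].
Qed.

Lemma tame_affine_height a p k : tame (fun y => (a + height p (sphere_param false y)) ^+ k).
Proof. exact: smooth_sphere_tame (smooth_affine_height a p k). Qed.

(** The chain rule combined with the Laplacian and the gradient of the height. Below, [a] is 0 for
    the even moments and 1 for the powers concentrating at [p]. *)
Lemma laplacian_affine_heightX a p k s y :
  laplacian (M := S) (fun x => (a + height p x) ^+ k) s y =
  k%:R * (a + height p (sphere_param s y)) ^+ k.-1 * (- n%:R * height p (sphere_param s y)) +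
  k%:R * k.-1%:R * (a + height p (sphere_param s y)) ^+ k.-2 *
    (1 - height p (sphere_param s y) ^+ 2).
Proof.
rewrite laplacian_sphereE.
pose T (y : 'rV[R]_n) := a + height p (sphere_param s y).
have dH i z : derivable (fun y : 'rV[R]_n => height p (sphere_param s y)) z (delta_mx 0 i).
  exact: (@Ck_derivable _ _ 0 _ _ _ (@smooth_height R n p s 1%N)).
have pT i : partial i T = partial i (fun y : 'rV[R]_n => height p (sphere_param s y)).
  rewrite (partialD (fun z => derivable_cst a z _) (dH i)) partial_cst.
  by apply/funext => z; rewrite add0r.
have CT : Ck 2 T by apply: CkD; [exact: Ck_cst|exact: smooth_height].
have := @laplacianX R S rho r0 Cs T k y CT.
have LH := laplacian_height n2 p s y.
have LT : conformal_laplacian (M := S) rho T y =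
    conformal_laplacian (M := S) rho (fun y : 'rV[R]_n => height p (sphere_param s y)) y.
  rewrite /conformal_laplacian; apply: congr1; apply: eq_bigr => i _; congr (partial i _ y).
  by apply/funext => z; congr (_ * _); exact: (congr1 (fun f => f z) (pT i)).
rewrite LT LH.
have -> // : carre_du_champ (M := S) rho T T y = 1 - height p (sphere_param s y) ^+ 2.
apply: etrans (carre_du_champ_height p s y); congr (_ * _).
by apply: eq_bigr => i _; rewrite pT.
Qed.

Section moments.
Variables (u : sphere_point R n -> R) (lambda : R).
Hypothesis su : smooth (M := S) u.
Hypothesis Lu : forall y, laplacian (M := S) u false y = - lambda * u (sphere_param false y).

Let U y := u (sphere_param false y).
Let tU : tame U. Proof. exact: smooth_sphere_tame. Qed.

Let green a p k (F : 'rV[R]_n -> R) : tame F ->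
  (forall y, laplacian (M := S) (fun x => (a + height p x) ^+ k) false y = F y) ->
  - lambda * E (fun y => (a + height p (sphere_param false y)) ^+ k * U y) =
  E (fun y => U y * F y).
Proof.
move=> tF LF.
have tL : tame (fun y => - lambda * U y) by exact: tameZ.
rewrite -[RHS](sphere_green n2 su (smooth_affine_height a p k) Lu LF tL tF).
rewrite -(wintZ mT cw iw _ (tameM (tame_affine_height a p k) tU)).
by apply: eq_wint => y _; rewrite mulrCA.
Qed.

(** The Laplacian of s^k is k (k-1) s^(k-2) - k (k+n-1) s^k; Green's formula moves it onto [u],
    where it becomes multiplication by -lambda. *)
Lemma sphere_moment_height p k :
  (k%:R * (k%:R + n%:R - 1) - lambda) *
    E (fun y => height p (sphere_param false y) ^+ k * U y) =
  k%:R * (k%:R - 1) * E (fun y => height p (sphere_param false y) ^+ k.-2 * U y).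
Proof.
pose H y := height p (sphere_param false y).
have tH m : tame (fun y => H y ^+ m).
  rewrite (_ : (fun y => _) = fun y => (0 + H y) ^+ m); first exact: tame_affine_height.
  by apply/funext => y; rewrite add0r.
pose F y := k%:R * (k%:R - 1) * H y ^+ k.-2 + (- (k%:R * (k%:R + n%:R - 1))) * H y ^+ k.
have tF : tame F by apply: tameD; apply: tameZ.
have G : - lambda * E (fun y => H y ^+ k * U y) = E (fun y => U y * F y).
  rewrite -(@green 0 p k F tF) => [|y]; first by congr (_ * E _); apply/funext => y; rewrite add0r.
  rewrite laplacian_affine_heightX add0r -/(H y) /F.
  (* For k = 0 and k = 1 the truncated predecessors occur with coefficient zero. *)
  case: k {F tF} => [|[|k]] /=; first by ring.
    by rewrite !expr0 !expr1; ring.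
  rewrite -!natr1 !exprS; move: (k%:R : R) (H y) (H y ^+ k) (n%:R : R) => *; ring.
transitivity (k%:R * (k%:R + n%:R - 1) * E (fun y => H y ^+ k * U y) +
    (- lambda * E (fun y => H y ^+ k * U y))); first by rewrite -mulrDl.
rewrite G (_ : E (fun y => U y * F y) = k%:R * (k%:R - 1) * E (fun y => H y ^+ k.-2 * U y) +
    (- (k%:R * (k%:R + n%:R - 1))) * E (fun y => H y ^+ k * U y)).
  by rewrite addrCA -mulrDl subrr mul0r addr0.
have t1 := tameM (tH k.-2) tU; have t2 := tameM (tH k) tU.
rewrite -(wintZ mT cw iw _ t1) -(wintZ mT cw iw _ t2).
rewrite -(wintD mT cw iw (tameZ _ t1) (tameZ _ t2)).
by apply: eq_wint => y _; rewrite /F; ring.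
Qed.

(** With T = 1 + s one has |grad s|^2 = 1 - s^2 = T (2 - T), so the term in T^(k-2) is absorbed and
    the recursion goes down by a single step. *)
Lemma sphere_moment_cap p k :
  (k%:R * (k%:R + n%:R - 1) - lambda) *
    E (fun y => (1 + height p (sphere_param false y)) ^+ k * U y) =
  k%:R * (2 * k%:R - 2 + n%:R) *
    E (fun y => (1 + height p (sphere_param false y)) ^+ k.-1 * U y).
Proof.
pose T y := 1 + height p (sphere_param false y).
have tT m : tame (fun y => T y ^+ m) by exact: tame_affine_height.
pose F y := k%:R * (2 * k%:R - 2 + n%:R) * T y ^+ k.-1 +
  (- (k%:R * (k%:R + n%:R - 1))) * T y ^+ k.
have tF : tame F by apply: tameD; apply: tameZ.
have G : - lambda * E (fun y => T y ^+ k * U y) = E (fun y => U y * F y).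
  apply: (@green 1 p k F tF) => y.
  rewrite laplacian_affine_heightX /F.
  have -> : height p (sphere_param false y) = T y - 1 by rewrite /T addrC addKr.
  rewrite subrKC.
  case: k {F tF} => [|[|k]] /=; first by ring.
    by rewrite !expr0 !expr1; ring.
  rewrite -!natr1 !exprS; move: (k%:R : R) (T y) (T y ^+ k) (n%:R : R) => *; ring.
transitivity (k%:R * (k%:R + n%:R - 1) * E (fun y => T y ^+ k * U y) +
    (- lambda * E (fun y => T y ^+ k * U y))); first by rewrite -mulrDl.
rewrite G (_ : E (fun y => U y * F y) = k%:R * (2 * k%:R - 2 + n%:R) * E (fun y => T y ^+ k.-1 * U y) +
    (- (k%:R * (k%:R + n%:R - 1))) * E (fun y => T y ^+ k * U y)).
  by rewrite addrCA -mulrDl subrr mul0r addr0.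
have t1 := tameM (tT k.-1) tU; have t2 := tameM (tT k) tU.
rewrite -(wintZ mT cw iw _ t1) -(wintZ mT cw iw _ t2).
rewrite -(wintD mT cw iw (tameZ _ t1) (tameZ _ t2)).
by apply: eq_wint => y _; rewrite /F; ring.
Qed.

(** The factor k (k+n-1) - lambda never vanishes: it is -lambda for k = 0, and k (k+n-1) >= n >
    lambda for k >= 1. At k = 0 the right-hand side is zero. *)
Lemma sphere_cap_moments0 p k : 0 < lambda < n%:R ->
  E (fun y => (1 + height p (sphere_param false y)) ^+ k * U y) = 0.
Proof.
move=> /andP[l0 ln]; elim: k => [|k IH].
  have := sphere_moment_cap p 0; rewrite !mul0r sub0r => /eqP.
  by rewrite mulf_eq0 oppr_eq0 gt_eqF//= => /eqP.
have := sphere_moment_cap p k.+1; rewrite [k.+1.-1]/= IH mulr0 => /eqP.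
rewrite mulf_eq0 => /orP[|/eqP//]; rewrite subr_eq0 => /eqP H; exfalso.
have n1 : 0 < n%:R :> R by rewrite ltr0n ltnW.
have := ler0n R k; move: H; rewrite -natr1; nra.
Qed.

(** The equation k (k+n-1) = n holds for no natural k except k = 1, and the recursion in steps of
    two from k = 0 avoids it. *)
Lemma sphere_even_moments0 p k : lambda = n%:R ->
  E (fun y => height p (sphere_param false y) ^+ k.*2 * U y) = 0.
Proof.
move=> ln; have n1 : 1 < n%:R :> R by rewrite ltr1n.
elim: k => [|k IH].
  have := sphere_moment_height p 0; rewrite !mul0r sub0r ln => /eqP.
  by rewrite mulf_eq0 oppr_eq0 gt_eqF//= ?(lt_trans ltr01)// => /eqP.
have := sphere_moment_height p k.*2.+2; rewrite [k.*2.+2.-2]/= IH mulr0 => /eqP.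
rewrite mulf_eq0 => /orP[|/eqP//]; rewrite subr_eq0 ln => /eqP H; exfalso.
have := ler0n R k.*2; move: H; rewrite -!natr1; nra.
Qed.

End moments.

End sphere_spectrum.

(** The set [first_eigenvalue] has at most one element, by antisymmetry; [l] inhabits it, so [xget]
    does not return its default value. *)
Lemma lambda1E (R : realType) (M : riemannian R) (l : R) :
  laplace_eigenvalue M l -> 0 < l ->
  (forall mu, 0 < mu < l -> ~ laplace_eigenvalue M mu) -> lambda1 M = l.
Proof.
move=> el l0 H.
have fl : first_eigenvalue M l.
  split=> // mu emu mu0; rewrite leNgt; apply/negP => mul.
  by apply: (H mu) => //; rewrite mu0.
have [e1 p1 m1] : first_eigenvalue M (lambda1 M).
  by apply: (@xgetPex _ 0); exists l.
have [_ _ m2] := fl.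
by apply/le_anti; rewrite m1//= m2.
Qed.

(** * The first eigenvalue of the sphere *)

Section sphere_conclusion.
Context (R : realType) (n : nat).
Implicit Types (y : 'rV[R]_n) (s : bool) (p x : sphere_point R n).
Implicit Types (u h : sphere_point R n -> R).
Local Notation rho := (@stereo_factor R n).
Local Notation S := (sphere R n).
Hypothesis n2 : (1 < n)%N.
Local Notation tame := (tame (setT : set 'rV[R]_n)).

Let mT := @measurable_rowT R n.
Let cw := @continuous_sphere_density R n.
Let w0 := @sphere_density_gt0 R n.
Let iw := @integrable_sphere_density R n.

Lemma norm2_split (m : nat) (x : 'rV[R]_(1 + m)) :
  norm2 x = x 0 (lshift m ord0) ^+ 2 + \sum_i x 0 (rshift 1 i) ^+ 2.
Proof. by rewrite /norm2 big_split_ord/= big_ord1. Qed.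

Lemma sphere_param_surj x : exists s y, x = sphere_param s y.
Proof.
have /eqP := valP x; rewrite norm2_split.
set a := val x 0 (lshift n ord0) => Nx.
(* The case a = 1 is the pole missed by the chart [false]; it is the origin of the chart [true]. *)
have [a1|a1] := eqVneq a 1.
  exists true, 0; apply: val_inj; apply/rowP => k /=.
  have r00 : rho 0 = 2.
    rewrite /stereo_factor (_ : norm2 0 = 0) ?add0r ?divr1//.
    by rewrite /norm2 big1// => i _; rewrite mxE expr0n.
  case: (fintype.split_ordP k) => i ->.
    by rewrite (ord1 i) stereo_head r00 -/a a1 expr1; ring.
  rewrite stereo_tail mxE mulr0; apply/eqP; rewrite -sqrf_eq0.
  move: Nx => /eqP; rewrite a1 expr1n -subr_eq0 addrAC subrr add0r.
  rewrite psumr_eq0 => [/allP/(_ i)|j _]; last exact: sqr_ge0.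
  by rewrite mem_index_enum => /(_ isT).
have a1' : 1 - a != 0 by rewrite subr_eq0 eq_sym.
exists false, (\row_i (val x 0 (rshift 1 i) / (1 - a))).
set y := \row_i _.
have Ny : norm2 y = (1 + a) / (1 - a).
  have -> : norm2 y = (1 - a ^+ 2) / (1 - a) ^+ 2.
    have <- : \sum_i val x 0 (rshift 1 i) ^+ 2 = 1 - a ^+ 2.
      by apply/eqP; rewrite eq_sym subr_eq addrC Nx.
    rewrite /norm2 mulr_suml; apply: eq_bigr => i _.
    by rewrite mxE expr_div_n.
  by field.
have ry : rho y = 1 - a.
  rewrite /stereo_factor Ny; field; rewrite a1' /=.
  by rewrite (_ : 1 + a + (1 - a) = 2) ?pnatr_eq0//; ring.
apply: val_inj; apply/rowP => k /=; case: (fintype.split_ordP k) => i ->.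
  by rewrite (ord1 i) stereo_head ry -/a expr0; ring.
by rewrite stereo_tail ry mxE; field.
Qed.

(** The integrals see only the chart [false], which misses one point; by continuity [u] cannot be
    nonzero at that point alone. *)
Lemma sphere_nonzero_chart u : smooth (M := S) u -> u <> cst 0 ->
  exists y, u (sphere_param false y) != 0.
Proof.
move=> su u0; apply: contrapT => H; apply: u0; apply/funext => x.
have U0 y : u (sphere_param false y) = 0.
  by apply/eqP; apply: contrapT => /negP yn0; apply: H; exists y.
have V0 y : norm2 y != 0 -> u (sphere_param true y) = 0.
  by move=> y0; rewrite -[true]/(~~ false) sphere_param_inversion.
have [s [y ->]] := sphere_param_surj x; case: s; last exact: U0.
have [y0|y0] := eqVneq (norm2 y) 0; last exact: V0.
apply/eqP; apply: contrapT => /negP Vn0.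
have cV : continuous (fun y => u (sphere_param true y)) by exact: su true 0%N.
have e0 : 0 < `|u (sphere_param true y)| by rewrite normr_gt0.
have [d d0 Hd] := (continuous_rVP _ _).1 (cV y) _ e0.
pose i0 : 'I_n := Ordinal (ltnW n2).
(* A nonzero point within distance [d] of the origin of the chart [true]; it is also covered by the
   chart [false], where [u] vanishes. *)
pose z : 'rV[R]_n := \row_i ((i == i0)%:R * (d / 2)).
have z0 : norm2 z != 0.
  rewrite gt_eqF// (lt_le_trans _ (sqr_coord_le z i0))// mxE eqxx mul1r.
  by rewrite exprn_gt0// divr_gt0.
have := Hd z; rewrite (V0 z z0) subr0 => Hz; have := Hz _; rewrite ltxx => /(_ _)/negP; apply=> // i.
rewrite (norm2_eq0 y0) !mxE sub0r normrN.
case: eqP => _; rewrite ?mul1r ?mul0r ?normr0// ger0_norm ?ltr_pdivrMr//; last first.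
  by rewrite divr_ge0// ltW.
by rewrite mulr_natr mulr2n ltrDl.
Qed.

Lemma height_self p : height p p = 1.
Proof.
by have /eqP := valP p => <-; rewrite /norm2 /height; apply: eq_bigr => i _; rewrite expr2.
Qed.

Lemma height_norm p x : -1 <= height p x <= 1.
Proof.
have hp : 0 <= \sum_k (val x 0 k + val p 0 k) ^+ 2 by apply: sumr_ge0 => k _; exact: sqr_ge0.
have hm : 0 <= \sum_k (val x 0 k - val p 0 k) ^+ 2 by apply: sumr_ge0 => k _; exact: sqr_ge0.
have /eqP := valP p; have /eqP := valP x; rewrite /norm2 => Nx Np.
have E1 : \sum_k (val x 0 k + val p 0 k) ^+ 2 = 1 + 2 * height p x + 1.
  transitivity (\sum_k val x 0 k ^+ 2 + 2 * height p x + \sum_k val p 0 k ^+ 2); last by rewrite Nx Np.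
  rewrite /height mulr_sumr -!big_split/=.
  by apply: eq_bigr => k _; ring.
have E2 : \sum_k (val x 0 k - val p 0 k) ^+ 2 = 1 - 2 * height p x + 1.
  transitivity (\sum_k val x 0 k ^+ 2 - 2 * height p x + \sum_k val p 0 k ^+ 2); last by rewrite Nx Np.
  rewrite /height mulr_sumr -sumrB -big_split/=.
  by apply: eq_bigr => k _; ring.
by apply/andP; split; lra.
Qed.

(** Both sides are half the squared chordal distance of the two points of the sphere, the right-hand
    side being its expression in stereographic coordinates. *)
Lemma height_chart y0 y : 1 - height (sphere_param false y0) (sphere_param false y) =
  rho y * rho y0 * norm2 (y - y0) / 2.
Proof.
rewrite /height big_split_ord/= big_ord1 !stereo_head expr0 !mul1r.
have nf := norm2_factor y; have nf0 := norm2_factor y0.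
under eq_bigr do rewrite !stereo_tail.
have -> : \sum_i rho y * y 0 i * (rho y0 * y0 0 i) = rho y * rho y0 * \sum_i y 0 i * y0 0 i.
  by rewrite mulr_sumr; apply: eq_bigr => i _; ring.
have -> : norm2 (y - y0) = norm2 y + norm2 y0 - 2 * \sum_i y 0 i * y0 0 i.
  rewrite /norm2 mulr_sumr -big_split -sumrB/=; apply: eq_bigr => i _.
  by rewrite !mxE; ring.
move: (\sum_i _) (norm2 y) (norm2 y0) (rho y) (rho y0) nf nf0 => s N N0 r q nf nf0.
have -> : r * q * (N + N0 - 2 * s) / 2 = (q * (N * r) + r * (N0 * q)) / 2 - r * q * s.
  by field.
by rewrite nf nf0; field.
Qed.

(** A small spherical cap around a point of the chart stays in a prescribed cube; in particular it
    avoids a neighbourhood of infinity. *)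
Lemma height_cap y0 (d : R) : 0 < d -> exists2 eta, 0 < eta < 1 & forall y,
  2 - eta <= 1 + height (sphere_param false y0) (sphere_param false y) ->
  forall i, `|y0 0 i - y 0 i| < d.
Proof.
move=> d0; pose N0 := norm2 y0.
have N00 : 0 <= N0 by exact: norm2_ge0.
have d20 : 0 < d ^+ 2 by rewrite exprn_gt0.
(* With D = |y - y0|^2, closeness on the sphere gives 2 D <= kappa (|y|^2 + 1), and |y|^2 <= 2 D + 2
   N0. Hence 2 (1 - kappa) D <= kappa (1 + 2 N0). The denominator makes kappa <= 1/2 and the
   right-hand side smaller than d^2, so D < d^2. *)
pose den := 2 * d ^+ 2 + 1 + 2 * N0.
have den0 : 0 < den by rewrite /den; nra.
pose kappa := d ^+ 2 / den.
have k0 : 0 < kappa by rewrite divr_gt0.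
have k12 : kappa * 2 <= 1 by rewrite /kappa mulrAC ler_pdivrMr// mul1r /den; lra.
have kd : kappa * (1 + 2 * N0) < d ^+ 2.
  by rewrite /kappa mulrAC ltr_pdivrMr// ltr_pM2l// /den; lra.
have N10 : 0 < 1 + N0 by lra.
exists (kappa / (1 + N0)).
  by rewrite divr_gt0//= ltr_pdivrMr// mul1r; lra.
move=> y Hy i; have /esym E1 := height_chart y0 y.
pose Dd := norm2 (y - y0).
have Dle : rho y * rho y0 * Dd / 2 <= kappa / (1 + N0) by rewrite E1; lra.
have N1 := norm2D1_gt0 y; have N2 := norm2D1_gt0 y0.
have rr : rho y * rho y0 * Dd / 2 = 2 * Dd / ((norm2 y + 1) * (1 + N0)).
  by rewrite /stereo_factor /N0; field; rewrite !gt_eqF// addrC.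
have D0 : 0 <= Dd by exact: norm2_ge0.
have NyD : norm2 y <= 2 * Dd + 2 * N0.
  rewrite /Dd /N0 /norm2 !mulr_sumr -big_split/=; apply: ler_sum => j _.
  by rewrite !mxE; have := sqr_ge0 (y 0 j - 2 * y0 0 j); nra.
have Dk : 2 * Dd <= kappa * (norm2 y + 1).
  move: Dle; rewrite rr ler_pdivrMr ?mulr_gt0//.
  have -> // : kappa / (1 + N0) * ((norm2 y + 1) * (1 + N0)) = kappa * (norm2 y + 1).
  by field; rewrite gt_eqF.
have Dd2 : Dd < d ^+ 2.
  have h1 : 0 <= (1 - kappa * 2) * Dd by rewrite mulr_ge0// subr_ge0.
  have h2 : 0 <= kappa * (2 * Dd + 2 * N0 - norm2 y) by rewrite mulr_ge0 ?subr_ge0// ltW.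
  nra.
have : (y0 0 i - y 0 i) ^+ 2 < d ^+ 2.
  apply: le_lt_trans Dd2; have := sqr_coord_le (y - y0) i.
  by rewrite !mxE -[X in X <= _]sqrrN opprB.
by rewrite -real_normK ?num_real// ltr_pXn2r// nnegrE// ltW.
Qed.

Lemma sphere_no_small_eigenvalue (mu : R) : 0 < mu < n%:R -> ~ laplace_eigenvalue S mu.
Proof.
move=> mun [_ [u [su Lu] u0]].
have [y0 U0] := sphere_nonzero_chart su u0.
pose U y := u (sphere_param false y).
have tU : tame U by exact: smooth_sphere_tame.
(* The sign making the eigenfunction positive at [y0]; near that point it stays above half of its
   value there. *)
pose e : R := if 0 < U y0 then 1 else -1.
pose c := `|U y0| / 2.
have c0 : 0 < c by rewrite divr_gt0// normr_gt0.
have eU : e * U y0 = 2 * c.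
  rewrite /c [RHS]mulrC divfK// /e; case: ifPn => h; first by rewrite mul1r gtr0_norm.
  by rewrite mulN1r ler0_norm// leNgt.
have cU : continuous (fun y => e * U y).
  apply: continuous_mulrV; first exact: cst_continuous.
  by case: tU.
have [d d0 Hd] := (continuous_rVP _ _).1 (cU y0) _ c0.
have [eta /andP[eta0 eta1] Heta] := height_cap y0 d0.
pose P y := 1 + height (sphere_param false y0) (sphere_param false y).
have tP : tame P.
  rewrite (_ : P = fun y => P y ^+ 1); first exact: tame_affine_height.
  by apply/funext => y; rewrite expr1.
(* The base takes its maximum 2 at [y0]; above the threshold 2 - eta the point lies in the cube
   where [e * U] exceeds [c]. *)
apply: (@concentration R n setT _ mT cw w0 iw (fun y => e * U y) P y0 (2 - eta) c).
- exact: tameZ.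
- exact: tP.
- by move=> y _; have := height_norm (sphere_param false y0) (sphere_param false y); rewrite /P; lra.
- lra.
- by rewrite /P height_self; lra.
- by exists 1.
- exact: c0.
- move=> y _ Py; have := Hd y (Heta y Py); rewrite ltr_norml eU; lra.
- move=> k.
  have tPU := tameM (tameX k tP) tU.
  rewrite (_ : (fun y => _) = fun y => e * (P y ^+ k * U y)); last first.
    by apply/funext => y; rewrite mulrCA.
  rewrite (wintZ mT cw iw _ tPU).
  have m0 := sphere_cap_moments0 n2 su (Lu false) (sphere_param false y0) k mun.
  by rewrite [X in _ * X]m0 mulr0.
Qed.

Lemma laplacian_heightX p k s y : laplacian (M := S) (fun x => height p x ^+ k) s y =
  k%:R * height p (sphere_param s y) ^+ k.-1 * (- n%:R * height p (sphere_param s y)) +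
  k%:R * k.-1%:R * height p (sphere_param s y) ^+ k.-2 *
    (1 - height p (sphere_param s y) ^+ 2).
Proof.
have := laplacian_affine_heightX n2 0 p k s y.
rewrite (_ : (fun x => (0 + height p x) ^+ k) = (fun x => height p x ^+ k)) ?add0r//.
by apply/funext => x; rewrite add0r.
Qed.

Lemma sphere_lambda1 : lambda1 S = n%:R.
Proof.
have n0 : 0 < n%:R :> R by rewrite ltr0n ltnW.
apply: lambda1E => //; last exact: sphere_no_small_eigenvalue.
split; first exact: ltW.
pose p : sphere_point R n := sphere_param false 0.
exists (height p).
  split=> [|s y]; first exact: smooth_height.
  have := laplacian_heightX p 1 s y.
  rewrite (_ : (fun x => height p x ^+ 1) = height p); last first.
    by apply/funext => x; rewrite expr1.
  move=> ->; rewrite !expr0 [1.-1%:R]/(0 : R) mulr0 !mul0r addr0 mulr1 mul1r.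
  by [].
move=> /(congr1 (fun f => f p)); rewrite height_self => /eqP.
by rewrite oner_eq0.
Qed.

End sphere_conclusion.

(** * The example on the sphere *)

Section sphere_theorem.
Context (R : realType) (n : nat).
Local Notation rho := (@stereo_factor R n).
Local Notation S := (sphere R n).
Local Notation E := (@sphere_integral R n).
Local Notation tame := (tame (setT : set 'rV[R]_n)).
Hypothesis n2 : (1 < n)%N.

Let mT := @measurable_rowT R n.
Let cw := @continuous_sphere_density R n.
Let w0 := @sphere_density_gt0 R n.
Let iw := @integrable_sphere_density R n.
Let r0 : forall y : 'rV[R]_(Defs.dim S), 0 < rho y := @stereo_factor_gt0 R n.

Let p : sphere_point R n := sphere_param false 0.
Let H (y : 'rV[R]_n) : R := height p (sphere_param false y).
Let m k := E (fun y => H y ^+ k).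

Let tH k : tame (fun y => H y ^+ k).
Proof.
rewrite (_ : (fun y => _) = fun y => (0 + H y) ^+ k); first exact: tame_affine_height.
by apply/funext => y; rewrite add0r.
Qed.

Let smooth_heightX k : smooth (M := S) (fun x => height p x ^+ k).
Proof.
rewrite (_ : (fun x => _) = fun x => (0 + height p x) ^+ k); first exact: smooth_affine_height.
by apply/funext => x; rewrite add0r.
Qed.

(** The general recursion for the constant eigenfunction, of eigenvalue 0, divided by the common
    factor k + 2. *)
Let moment k : (k%:R + n%:R + 1) * m k.+2 = (k%:R + 1) * m k.
Proof.
have s1 : smooth (M := S) (fun=> 1 : R) by move=> s j; exact: Ck_cst.
have L1 y : laplacian (M := S) (fun=> 1 : R) false y = - 0 * 1.
  have := laplacian_heightX n2 p 0 false y.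
  rewrite (_ : (fun x => height p x ^+ 0) = (fun=> 1)); last first.
    by apply/funext => x; rewrite expr0.
  by move=> ->; rewrite !mul0r addr0 oppr0 mul0r.
have := sphere_moment_height n2 s1 L1 p k.+2.
have X1 j : E (fun y => height p (sphere_param false y) ^+ j * 1) = m j.
  by apply: eq_wint => y _; rewrite mulr1.
rewrite !X1 subr0 [k.+2.-2]/= => M.
have k0 : k.+2%:R != 0 :> R by rewrite pnatr_eq0.
apply: (mulfI k0); rewrite -!natr1 in M *.
have -> : (k%:R + 1 + 1) * ((k%:R + n%:R + 1) * m k.+2) =
  (k%:R + 1 + 1) * (k%:R + 1 + 1 + n%:R - 1) * m k.+2 by ring.
by rewrite M; ring.
Qed.

Let m0_gt0 : 0 < m 0.
Proof.
apply: (wint_gt0 mT cw w0 iw (y0 := 0) (tH 0)).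
- by move=> y _; rewrite expr0.
- by rewrite expr0.
- by exists 1.
Qed.

Lemma sphere_case : exists f phi : sphere_point R n -> R,
    [/\ smooth (M := S) f,
        forall x, 0 < f x,
        forall u, laplace_eigenspace (M := S) (lambda1 S) u -> orthoL2 (M := S) f u
      & [/\ smooth (M := S) phi,
            integralM (M := S) (fun x => f x * phi x) = 0
          & dirichlet (M := S) phi < lambda1 S * integralM (M := S) (fun x => phi x ^+ 2)]].
Proof.
rewrite (sphere_lambda1 R n2).
have N2 : 2 <= n%:R :> R by rewrite ler_nat.
set N : R := n%:R in N2 *.
have := moment 0; have := moment 2; have := moment 4; have := moment 6; have := moment 8.
rewrite -/N mulr0n !add0r mul1r => M8 M6 M4 M2 M0.
(* This normalization turns the moments of order 0, 2 and 4 into polynomials in n times [b]. *)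
pose b := m 0 / ((N + 1) * (N + 3)).
have b0 : 0 < b by rewrite divr_gt0// mulr_gt0//; lra.
have E0 : m 0 = (N + 1) * (N + 3) * b.
  by rewrite /b; field; apply/andP; split; rewrite gt_eqF//; lra.
have E2 : m 2 = (N + 3) * b.
  apply: (mulfI (_ : N + 1 != 0)); first by rewrite gt_eqF//; lra.
  by rewrite M0 E0; ring.
have E4 : m 4 = 3 * b.
  apply: (mulfI (_ : 2%:R + N + 1 != 0)); first by rewrite gt_eqF//; lra.
  by rewrite M2 E2; ring.
have m6 : 0 < m 6.
  have : 0 < (4%:R + N + 1) * m 6 by rewrite M4 E4; nra.
  by rewrite pmulr_rgt0//; lra.
have m8 : 0 < m 8.
  have : 0 < (6%:R + N + 1) * m 8 by rewrite M6; nra.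
  by rewrite pmulr_rgt0//; lra.
(* The ratios m 2 / m 0 = 1/(n+1) and m 10 / m 8 = 9/(n+9) are the means of s^2 for the weights 1
   and s^8. A value of r strictly between them gives phi opposite signs against these weights. The
   energy inequality wants r large: for n = 2 it holds above about 0.755, which admits 7/9 but not
   5/7, the value of 5/(n+5). *)
pose r := 7 / (N + 7).
have rN : r * (N + 7) = 7 by rewrite divfK// gt_eqF//; lra.
have r_gt0 : 0 < r by rewrite divr_gt0//; lra.
have num : 0 < m 10 - r * m 8.
  have N9 : 0 < (8%:R + N + 1) * (N + 7) by rewrite mulr_gt0//; lra.
  rewrite -(pmulr_rgt0 _ N9).
  have -> : (8%:R + N + 1) * (N + 7) * (m 10 - r * m 8) =
     (N + 7) * ((8%:R + N + 1) * m 10) - (8%:R + N + 1) * (r * (N + 7)) * m 8 by ring.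
  by rewrite M8 rN; nra.
have den : 0 < r * m 0 - m 2.
  rewrite E0 E2 -(pmulr_rgt0 _ (_ : 0 < N + 7)); last lra.
  have -> : (N + 7) * (r * ((N + 1) * (N + 3) * b) - (N + 3) * b) =
    (r * (N + 7) * (N + 1) - (N + 7)) * ((N + 3) * b) by ring.
  by rewrite rN mulr_gt0//; nra.
(* The numerator is the integral of s^8 phi and the denominator that of -phi; both are positive, and
   their quotient makes f and phi orthogonal. *)
pose delta := (m 10 - r * m 8) / (r * m 0 - m 2).
have delta0 : 0 < delta by rewrite divr_gt0.
exists (fun x => height p x ^+ 8 + delta), (fun x => height p x ^+ 2 + -1 * r).
have sphi : smooth (M := S) (fun x => height p x ^+ 2 + -1 * r).
  by move=> s j; apply: CkD; [exact: (smooth_heightX 2)|exact: Ck_cst].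
split.
- by move=> s j; apply: CkD; [exact: (smooth_heightX 8)|exact: Ck_cst].
- by move=> x; rewrite ltr_wpDl// -[8%N]/(4 * 2)%N exprM sqr_ge0.
- move=> u [su Lu]; rewrite /orthoL2 integralM_sphere.
  have tU := smooth_sphere_tame false su.
  have O k := sphere_even_moments0 n2 su (Lu false) p k erefl.
  transitivity (E (fun y => H y ^+ 8 * u (sphere_param false y) +
      delta * (H y ^+ 0 * u (sphere_param false y)))).
    by apply: eq_wint => y _; rewrite expr0 mul1r mulrDl.
  rewrite [LHS](wintD mT cw iw (tameM (tH 8) tU) (tameZ delta (tameM (tH 0) tU))).
  rewrite (wintZ mT cw iw _ (tameM (tH 0) tU)).
  by rewrite [X in X + _](O 4%N) [X in _ + _ * X](O 0%N) mulr0 addr0.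
split=> //.
- rewrite integralM_sphere.
  transitivity (E (fun y => H y ^+ 10 + (- r * H y ^+ 8 + (delta * H y ^+ 2 + - (delta * r) * H y ^+ 0)))).
    by apply: eq_wint => y _; rewrite -/(H y); ring.
  rewrite [LHS](wintD mT cw iw (tH 10) (tameD (tameZ _ (tH 8)) (tameD (tameZ _ (tH 2)) (tameZ _ (tH 0))))).
  rewrite (wintD mT cw iw (tameZ _ (tH 8)) (tameD (tameZ _ (tH 2)) (tameZ _ (tH 0)))).
  rewrite (wintD mT cw iw (tameZ _ (tH 2)) (tameZ _ (tH 0))).
  rewrite (wintZ mT cw iw _ (tH 8)) (wintZ mT cw iw _ (tH 2)) (wintZ mT cw iw _ (tH 0)).
  rewrite -[wint _ _ (fun y => H y ^+ 10)]/(m 10) -[wint _ _ (fun y => H y ^+ 8)]/(m 8).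
  rewrite -[wint _ _ (fun y => H y ^+ 2)]/(m 2) -[wint _ _ (fun y => H y ^+ 0)]/(m 0).
  have D : delta * (r * m 0 - m 2) = m 10 - r * m 8 by rewrite divfK// gt_eqF.
  transitivity ((m 10 - r * m 8) - delta * (r * m 0 - m 2)); first by ring.
  by rewrite D subrr.
have -> : dirichlet (M := S) (fun x => height p x ^+ 2 + -1 * r) = 4 * (m 2 - m 4).
  transitivity (E (fun y => 4 * H y ^+ 2 + - 4 * H y ^+ 4)); last first.
    rewrite [LHS](wintD mT cw iw (tameZ _ (tH 2)) (tameZ _ (tH 4))).
    rewrite (wintZ mT cw iw _ (tH 2)) (wintZ mT cw iw _ (tH 4)).
    by rewrite -/(m 2) -/(m 4) /m /E; ring.
  rewrite /dirichlet /integral_coord /E /wint; congr (integral_rV _ _).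
  apply/funext => y; rewrite (volume_densityE r0 (@sphere_metricE R n)); congr (_ * _).
  rewrite (grad_norm2E r0 (@sphere_metricE R n)).
  have CH : Ck 2 H by exact: (@smooth_height R n p false 2%N).
  have CH2 : Ck 1 (fun y => H y ^+ 2) by apply: CkX; exact: CkW.
  have pE i : partial i (fun y => H y ^+ 2 + -1 * r) = partial i (fun y => H y ^+ 2).
    rewrite (partialD (fun z => @Ck_derivable _ _ _ _ i z CH2) (fun z => derivable_cst (-1 * r) z _)).
    by rewrite partial_cst; apply/funext => z; rewrite addr0.
  transitivity (carre_du_champ (M := S) rho (fun y => H y ^+ 2) (fun y => H y ^+ 2) y).
    rewrite /carre_du_champ; congr (_ * _); apply: eq_bigr => i _.
    by rewrite -expr2; congr (_ ^+ 2); exact: (congr1 (fun f => f y) (pE i)).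
  rewrite (@carre_du_champX R S rho H H 2 2 y CH CH).
  have -> : carre_du_champ (M := S) rho H H y = 1 - H y ^+ 2 by exact: carre_du_champ_height.
  by rewrite !expr1; move: (H y) => z; ring.
have -> : integralM (M := S) (fun x => (height p x ^+ 2 + -1 * r) ^+ 2) =
    m 4 + (- 2 * r) * m 2 + r ^+ 2 * m 0.
  rewrite integralM_sphere.
  transitivity (E (fun y => H y ^+ 4 + ((- 2 * r) * H y ^+ 2 + r ^+ 2 * H y ^+ 0))).
    by apply: eq_wint => y _; rewrite -/(H y); ring.
  rewrite [LHS](wintD mT cw iw (tH 4) (tameD (tameZ _ (tH 2)) (tameZ _ (tH 0)))).
  rewrite (wintD mT cw iw (tameZ _ (tH 2)) (tameZ _ (tH 0))).
  by rewrite (wintZ mT cw iw _ (tH 2)) (wintZ mT cw iw _ (tH 0)) addrA.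
(* The energy is 4 n b. The margin has the sign of 34 n^2 + 42 n - 196, which equals 24 at n = 2. *)
rewrite E0 E2 E4 -subr_gt0.
have -> : N * (3 * b + - 2 * r * ((N + 3) * b) + r ^+ 2 * ((N + 1) * (N + 3) * b)) -
    4 * ((N + 3) * b - 3 * b) =
    N * b * (34 * N ^+ 2 + 42 * N - 196) / (N + 7) ^+ 2.
  by rewrite /r; field; rewrite gt_eqF//; lra.
have N0 : 0 < N by lra.
have N7 : 0 < N + 7 by lra.
apply: divr_gt0; last exact: exprn_gt0.
by apply: mulr_gt0; [exact: mulr_gt0|nra].
Qed.

End sphere_theorem.

(** * The torus *)

Section trigonometric.
Context (R : realType) (n : nat).
Implicit Types (y : 'rV[R]_n) (i j : 'I_n) (c : R).

(** The phase [c] makes the family closed under differentiation: a derivative is a shift by pi / 2,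
    which also covers the sines. *)
Definition cos_coord i c y : R := cos (y 0 i + c).

Lemma is_derive_cos_coord i c y (v : 'rV[R]_n) :
  is_derive y v (cos_coord i c) (v 0 i * cos_coord i (c + pi / 2) y).
Proof.
have E : (fun h : R => h^-1 *: (cos_coord i c (h *: v + y) - cos_coord i c y)) =
  (fun h : R => h^-1 *: ((fun t : R => cos (v 0 i * t + (y 0 i + c))) (h *: 1 + 0) -
     (fun t : R => cos (v 0 i * t + (y 0 i + c))) 0)).
  apply/funext => h; rewrite /cos_coord !mxE addr0 mulr0 add0r [h *: 1]mulr1.
  by rewrite mulrC addrA.
have D : is_derive (0 : R) (1 : R) (fun t : R => cos (v 0 i * t + (y 0 i + c)))
    (v 0 i * cos_coord i (c + pi / 2) y).
  have -> : v 0 i * cos_coord i (c + pi / 2) y = - (v 0 i * sin (v 0 i * 0 + (y 0 i + c))).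
    rewrite /cos_coord mulr0 add0r addrA cosDpihalf mulrN //.
  have dl : is_derive (0 : R) (1 : R) (fun t : R => v 0 i * t + (y 0 i + c)) (v 0 i).
    by apply: is_derive_eq; rewrite addr0 [_ *: 1]mulr1 //.
  rewrite -mulrN mulrC; exact: (@is_derive1_comp _ cos).
by case: D => d1 d2; split; rewrite ?/derivable ?/derive /= E.
Qed.

Lemma derivable_cos_coord i c y (v : 'rV[R]_n) : derivable (cos_coord i c) y v.
Proof. by case: (is_derive_cos_coord i c y v). Qed.

Lemma partial_cos_coord i j c : partial i (cos_coord j c) =
  (fun y => (j == i)%:R * cos_coord j (c + pi / 2) y).
Proof.
apply/funext => y.
by rewrite /partial (@derive_val _ _ _ _ _ _ _ (is_derive_cos_coord j c y _)) mxE eqxx.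
Qed.

Lemma continuous_cos_coord i c : continuous (cos_coord i c).
Proof.
move=> y; apply: (@continuous_comp _ _ _ (fun y : 'rV[R]_n => y 0 i + c) cos).
  by apply: continuous_addrV; [exact: coord_continuous|exact: cst_continuous].
exact: continuous_cos.
Qed.

Lemma Ck_cos_coord k i c : Ck k (cos_coord i c).
Proof.
elim: k c => [|k IH] c; first exact: continuous_cos_coord.
apply: CkS => [|j y|j]; [exact: continuous_cos_coord|exact: derivable_cos_coord|].
by rewrite partial_cos_coord; exact: CkZ.
Qed.

Lemma cos_periodic (x : R) (k : int) : cos (x + k%:~R * (2 * pi)) = cos x.
Proof.
have P1 (z : R) : cos (z + 2 * pi) = cos z.
  by rewrite mulr_natl mulr2n addrA !cosDpi opprK.
have Pn (m : nat) (z : R) : cos (z + m%:R * (2 * pi)) = cos z.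
  elim: m z => [|m IH] z; first by rewrite mul0r addr0.
  by rewrite -natr1 mulrDl mul1r addrA P1 IH.
case: k => m; first by rewrite -pmulrn Pn.
by rewrite NegzE mulrNz mulNr -pmulrn -(Pn m.+1 (x - _)) subrK.
Qed.

End trigonometric.

(** * Monomials in cosines and their Laplacians *)

Section conformal_cos.
Context (R : realType).
Local Notation T := (torus R).
Local Notation rho := (fun=> 1 : R).
Local Notation L := (@conformal_laplacian R T rho).
Local Notation Gamma := (@carre_du_champ R T rho).

Lemma torus_flux_density : @flux_density R T rho = (fun=> 1).
Proof. by apply/funext => y; rewrite /flux_density !expr1n invr1 mulr1. Qed.

Lemma Ck_torus_flux k : Ck k (@flux_density R T rho).
Proof. by rewrite torus_flux_density; exact: Ck_cst. Qed.

Let r0 (y : 'rV[R]_(Defs.dim T)) : 0 < rho y :> R. Proof. by []. Qed.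

Lemma torus_metricE (a : chart T) (y : 'rV[R]_(Defs.dim T)) :
  metric (r := T) a y = (rho y ^+ 2)%:M.
Proof. by rewrite expr1n. Qed.

(** Used with [al] = 0 for trigonometric polynomials, and with [al] = 1 and a phase for the powers
    that concentrate at a point. *)
Definition affine_cos (al : R) (i : 'I_2) (c : R) (y : 'rV[R]_2) : R := al + cos_coord i c y.

Lemma Ck_affine_cos k al i c : Ck k (affine_cos al i c).
Proof. by apply: CkD; [exact: Ck_cst|exact: Ck_cos_coord]. Qed.

Lemma partial_affine_cos al i j c : partial i (affine_cos al j c) =
  (fun y => (j == i)%:R * cos_coord j (c + pi / 2) y).
Proof.
rewrite (partialD (fun y => derivable_cst al y _) (fun y => @derivable_cos_coord R 2 j c y _)).
by rewrite partial_cst partial_cos_coord; apply/funext => y; rewrite add0r.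
Qed.

Lemma carre_du_champ_cos al be i j c d (y : 'rV[R]_2) :
  Gamma (affine_cos al i c) (affine_cos be j d) y =
  (i == j)%:R * (cos_coord i (c + pi / 2) y * cos_coord j (d + pi / 2) y).
Proof.
rewrite /carre_du_champ expr1n invr1 mul1r.
rewrite (eq_bigr (fun k => (k == i)%:R * ((k == j)%:R *
   (cos_coord i (c + pi / 2) y * cos_coord j (d + pi / 2) y)))); last first.
  by move=> k _; rewrite !partial_affine_cos [i == k]eq_sym [j == k]eq_sym mulrACA -mulrA.
rewrite (bigD1 i)//= eqxx mul1r big1 ?addr0// => k /negbTE ->.
by rewrite mul0r.
Qed.

Lemma carre_du_champ_cos_self al i c (y : 'rV[R]_2) :
  Gamma (affine_cos al i c) (affine_cos al i c) y = 1 - cos_coord i c y ^+ 2.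
Proof.
rewrite carre_du_champ_cos eqxx mul1r /cos_coord addrA cosDpihalf mulrNN -expr2.
by rewrite sin2cos2.
Qed.

Lemma laplacian_cos al i c (y : 'rV[R]_2) : L (affine_cos al i c) y = - cos_coord i c y.
Proof.
rewrite /conformal_laplacian torus_flux_density expr1n invr1 mul1r.
have E j : partial j (fun z => 1 * partial j (affine_cos al i c) z) y =
    (j == i)%:R * - cos_coord i c y.
  have -> : (fun z => 1 * partial j (affine_cos al i c) z) =
    (fun z => (i == j)%:R * cos_coord i (c + pi / 2) z).
    by apply/funext => z; rewrite mul1r partial_affine_cos.
  rewrite (partialZ _ (fun z => @derivable_cos_coord R 2 i _ z _)) partial_cos_coord.
  have -> : cos_coord i (c + pi / 2 + pi / 2) y = - cos_coord i c y.
    by rewrite /cos_coord !addrA cosDpihalf sinDpihalf.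
  by rewrite [i == j]eq_sym; case: eqP => _; rewrite ?mul0r ?mul1r.
rewrite (eq_bigr _ (fun j _ => E j)) (bigD1 i)//= eqxx mul1r big1 ?addr0// => j /negbTE ->.
by rewrite mul0r.
Qed.

Definition cos_monomial al c d a b (y : 'rV[R]_2) : R :=
  affine_cos al ord0 c y ^+ a * affine_cos al ord_max d y ^+ b.

Lemma Ck_cos_monomial k al c d a b : Ck k (cos_monomial al c d a b).
Proof. by apply: CkM; apply: CkX; exact: Ck_affine_cos. Qed.

(** The two factors depend on different coordinates, so their gradients are orthogonal and the
    Leibniz rule has no mixed term. *)
Lemma laplacian_cos_monomial al c d a b (y : 'rV[R]_2) :
  L (cos_monomial al c d a b) y =
  affine_cos al ord_max d y ^+ b *
   (a%:R * affine_cos al ord0 c y ^+ a.-1 * (al - affine_cos al ord0 c y) +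
    a%:R * a.-1%:R * affine_cos al ord0 c y ^+ a.-2 * (1 - (affine_cos al ord0 c y - al) ^+ 2)) +
  affine_cos al ord0 c y ^+ a *
   (b%:R * affine_cos al ord_max d y ^+ b.-1 * (al - affine_cos al ord_max d y) +
    b%:R * b.-1%:R * affine_cos al ord_max d y ^+ b.-2 * (1 - (affine_cos al ord_max d y - al) ^+ 2)).
Proof.
have C2 i e : Ck 2 (affine_cos al i e) by exact: Ck_affine_cos.
have CX2 i e k : Ck 2 (fun y => affine_cos al i e y ^+ k) by exact: CkX.
have aE i e : affine_cos al i e y - al = cos_coord i e y by rewrite /affine_cos addrC addKr.
have aE' i e : al - affine_cos al i e y = - cos_coord i e y by rewrite -aE opprB.
rewrite [LHS](@laplacianM R T rho r0 Ck_torus_flux _ _ y (CX2 ord0 c a) (CX2 ord_max d b)).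
rewrite (@carre_du_champX R T rho _ _ a b y (C2 ord0 c) (C2 ord_max d)).
rewrite carre_du_champ_cos mul0r !mulr0 addr0.
rewrite (@laplacianX R T rho r0 Ck_torus_flux _ a y (C2 ord0 c)).
rewrite (@laplacianX R T rho r0 Ck_torus_flux _ b y (C2 ord_max d)).
by rewrite !carre_du_champ_cos_self !laplacian_cos !aE !aE' addrC.
Qed.

End conformal_cos.

(** * Periodic functions and Green's formula on the torus *)

Section torus_green.
Context (R : realType).
Implicit Types (y : 'rV[R]_2) (u h : torus_point R -> R).
Local Notation T := (torus R).
Local Notation rho := (fun=> 1 : R).
Local Notation mR := (measurableTypeR R).

Definition periodic_rV (F : 'rV[R]_2 -> R) := forall x y, torus_rel x y -> F x = F y.

(** Evaluation at the chosen representative, a meaningful descent to the quotient only for periodic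
    [F]. *)
Definition torus_lift (F : 'rV[R]_2 -> R) (p : torus_point R) : R := F (repr p).

Lemma torus_pi_eq (x y : 'rV[R]_2) : torus_rel x y ->
  (\pi_(torus_point R) x = \pi_(torus_point R) y)%qT.
Proof. by move=> xy; apply/eqmodP. Qed.

Lemma torus_liftE F y : periodic_rV F -> torus_lift F (\pi_(torus_point R) y)%qT = F y.
Proof. by move=> pF; apply: pF; apply/eqmodP; rewrite reprK. Qed.

Lemma torus_lift_comp F (a : chart T) : periodic_rV F ->
  torus_lift F \o (@param _ T a) = F.
Proof. by move=> pF; apply/funext => y; exact: torus_liftE. Qed.

Lemma periodic_pi u : periodic_rV (fun y => u (\pi_(torus_point R) y)%qT).
Proof. by move=> x y xy; rewrite (torus_pi_eq xy). Qed.

Lemma torus_relD (x y v : 'rV[R]_2) : torus_rel x y -> torus_rel (v + x) (v + y).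
Proof.
move=> /asboolP xy; apply/asboolP => i; have [k xyk] := xy i.
by exists k; rewrite -xyk !mxE; ring.
Qed.

Lemma periodic_partial i F : periodic_rV F -> periodic_rV (partial i F).
Proof.
move=> pF x y xy; rewrite /partial /derive.
have E : (fun h : R => h^-1 *: ((F \o shift x) (h *: delta_mx 0 i) - F x)) =
   (fun h : R => h^-1 *: ((F \o shift y) (h *: delta_mx 0 i) - F y)).
  by apply/funext => h /=; rewrite (pF _ _ xy) (pF _ _ (torus_relD _ xy)).
by rewrite E.
Qed.

Lemma periodic_set_coord F i y : periodic_rV F ->
  F (set_coord i (2 * pi) y) = F (set_coord i 0 y).
Proof.
move=> pF; apply: pF; apply/asboolP => j; rewrite !mxE; case: eqP => _.
  by exists 1; rewrite subr0 mul1r.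
by exists 0; rewrite subrr mul0r.
Qed.

Let D : set 'rV[R]_2 := box (fun=> 0) (fun=> 2 * pi).

Lemma pi2_gt0 : 0 < 2 * pi :> R. Proof. by rewrite mulr_gt0// pi_gt0. Qed.

Definition torus_integral (h : 'rV[R]_2 -> R) : R := wint D (fun=> 1) h.

Lemma torus_measurable : measurable (@row_of_tuple R 2 @^-1` D : set (2.-tuple mR)).
Proof. exact: measurable_box. Qed.

Lemma continuous_torus_density : continuous (fun _ : 'rV[R]_2 => 1 : R).
Proof. exact: cst_continuous. Qed.

Lemma torus_density_gt0 y : 0 < (fun _ : 'rV[R]_2 => 1 : R) y. Proof. by []. Qed.

Lemma integrable_torus_density :
  (lebesgue_tuple R 2).-integrable (@row_of_tuple R 2 @^-1` D)
    (fun t => ((fun _ : 'rV[R]_2 => 1 : R) (row_of_tuple t))%:E).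
Proof.
apply: (@integrable_box _ _ _ _ (fun _ : 'rV[R]_2 => 1 : R)).
  exact: continuous_torus_density.
by move=> _; exact: ltW pi2_gt0.
Qed.

Lemma continuous_torus_tame (F : 'rV[R]_2 -> R) : continuous F -> tame D F.
Proof.
move=> cF; split=> //; have [C C0 HC] := box_bounded (fun=> 0) (fun=> 2 * pi) cF.
by exists C => // y Dy; apply: HC => i; have /andP[-> /ltW ->] := Dy i.
Qed.

Lemma Ck_torus_tame k (F : 'rV[R]_2 -> R) : Ck k F -> tame D F.
Proof. by move=> CF; apply: continuous_torus_tame; exact: Ck_continuous CF. Qed.

Let r0 (y : 'rV[R]_(Defs.dim T)) : 0 < rho y :> R. Proof. by []. Qed.

Lemma laplacian_torusE u (a : chart T) y : laplacian (M := T) u a y =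
  conformal_laplacian (M := T) rho (u \o @param _ T a) y.
Proof. exact: (laplacianE r0 (@torus_metricE R)). Qed.

Lemma integralM_torus u : integralM (M := T) u =
  torus_integral (fun y => u (\pi_(torus_point R) y)%qT).
Proof.
rewrite /integralM /integral_coord /torus_integral /wint; congr (integral_rV _ _).
by apply/funext => y; rewrite (volume_densityE r0 (@torus_metricE R)) expr1n.
Qed.

(** The Green field is periodic, so its values on opposite faces of the fundamental square agree and
    the boundary estimate applies with bound 0. *)
Lemma torus_green (U H : 'rV[R]_2 -> R) : periodic_rV U -> periodic_rV H ->
  Ck 2 U -> Ck 2 H ->
  continuous (conformal_laplacian (M := T) rho U) ->
  continuous (conformal_laplacian (M := T) rho H) ->
  torus_integral (fun y => H y * conformal_laplacian (M := T) rho U y) =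
  torus_integral (fun y => U y * conformal_laplacian (M := T) rho H y).
Proof.
move=> pU pH CU CH cLU cLH.
set LU := conformal_laplacian (M := T) rho U in cLU *.
set LH := conformal_laplacian (M := T) rho H in cLH *.
have tU := Ck_torus_tame CU; have tH := Ck_torus_tame CH.
have tLU := continuous_torus_tame cLU; have tLH := continuous_torus_tame cLH.
pose g y := H y * LU y + -1 * (U y * LH y).
have iw := integrable_torus_density.
have mT := torus_measurable; have cw := continuous_torus_density.
suff g0 : torus_integral g = 0.
  apply/eqP; rewrite -subr_eq0 -mulN1r /torus_integral -(wintZ mT cw iw (-1) (tameM tU tLH)).
  by rewrite -(wintD mT cw iw (tameM tH tLU) (tameZ (-1) (tameM tU tLH))) [X in X == _]g0.
pose Y := @green_field R T rho H U.
have CY i : Ck 1 (Y i) := @Ck_green_field R T rho (@Ck_torus_flux R) H U i CH CU.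
have gE y : g y * 1 = \sum_i partial i (Y i) y.
  rewrite -(@green_pointwise R T rho r0 (@Ck_torus_flux R) H U y CH CU).
  by rewrite expr1n /g mulN1r.
rewrite /torus_integral /wint.
have -> : (fun y => g y * 1) = (fun y => \sum_i partial i (Y i) y).
  by apply/funext => y; exact: gE.
apply/eqP; rewrite -normr_le0.
apply: le_trans (integral_box_div (e := 0) pi2_gt0 CY _) _; last first.
  by rewrite mul0r mulr0.
move=> i y _.
have pY : periodic_rV (Y i).
  move=> x z xz; rewrite /Y /green_field torus_flux_density.
  by rewrite (pU _ _ xz) (pH _ _ xz) (periodic_partial i pU xz) (periodic_partial i pH xz).
by rewrite (periodic_set_coord i y pY) subrr normr0.
Qed.

End torus_green.

(** * Moments of eigenfunctions on the torus *)

Section torus_spectrum.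
Context (R : realType).
Implicit Types (y : 'rV[R]_2) (u h : torus_point R -> R).
Local Notation T := (torus R).
Local Notation rho := (fun=> 1 : R).
Local Notation L := (@conformal_laplacian R T rho).
Local Notation E := (@torus_integral R).
Let D : set 'rV[R]_2 := box (fun=> 0) (fun=> 2 * pi).
Let mT := @torus_measurable R.
Let cw := @continuous_torus_density R.
Let iw := @integrable_torus_density R.

Lemma periodic_cos_monomial al c d a b : periodic_rV (@cos_monomial R al c d a b).
Proof.
have P i e : periodic_rV (@affine_cos R al i e).
  move=> x y /asboolP /(_ i)[k xyk]; rewrite /affine_cos /cos_coord.
  by rewrite -(cos_periodic (y 0 i + e) k) -xyk; congr (_ + cos _); ring.
by move=> x y xy; rewrite /cos_monomial (P _ _ _ _ xy) (P _ _ _ _ xy).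
Qed.

Lemma tame_cos_monomial al c d a b : tame D (@cos_monomial R al c d a b).
Proof. exact: Ck_torus_tame (Ck_cos_monomial 0 al c d a b). Qed.

Section moments.
Variables (u : torus_point R -> R) (lambda : R).
Hypothesis su : smooth (M := T) u.
Hypothesis Lu : forall (a : chart T) y,
  laplacian (M := T) u a y = - lambda * u (@param _ T a y).

Let U y := u (\pi_(torus_point R) y)%qT.
Let CU k : Ck k U. Proof. exact: su tt k. Qed.
Let tU : tame D U. Proof. exact: Ck_torus_tame (CU 0). Qed.
Let LU y : L U y = - lambda * U y.
Proof. by rewrite -[RHS](Lu tt) laplacian_torusE. Qed.

Let green al c d a b (F : 'rV[R]_2 -> R) : continuous F ->
  (forall y, L (cos_monomial al c d a b) y = F y) ->
  - lambda * E (fun y => cos_monomial al c d a b y * U y) = E (fun y => U y * F y).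
Proof.
move=> cF LF.
have LUE : L U = (fun y => - lambda * U y) by apply/funext => y; exact: LU.
have LME : L (cos_monomial al c d a b) = F by apply/funext => y; exact: LF.
have cLU : continuous (L U).
  by rewrite LUE; apply: continuous_mulrV; [exact: cst_continuous|exact: Ck_continuous (CU 0)].
have cLM : continuous (L (cos_monomial al c d a b)) by rewrite LME.
have := torus_green (periodic_pi u) (periodic_cos_monomial al c d a b)
  (CU 2) (Ck_cos_monomial 2 al c d a b) cLU cLM.
rewrite LME LUE => <-.
rewrite -(wintZ mT cw iw _ (tameM (tame_cos_monomial al c d a b) tU)).
by apply: eq_wint => y _; rewrite mulrCA.
Qed.

(** The analogue of the recursion on the sphere, with two exponents; each one drops by two because
    (cos^k)'' = k (k-1) cos^(k-2) - k^2 cos^k. *)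
Lemma torus_moment_cos a b :
  (a%:R ^+ 2 + b%:R ^+ 2 - lambda) * E (fun y => cos_monomial 0 0 0 a b y * U y) =
  a%:R * (a%:R - 1) * E (fun y => cos_monomial 0 0 0 a.-2 b y * U y) +
  b%:R * (b%:R - 1) * E (fun y => cos_monomial 0 0 0 a b.-2 y * U y).
Proof.
pose M a b := @cos_monomial R 0 0 0 a b.
have tM a' b' : tame D (M a' b') by exact: tame_cos_monomial.
pose F y := (a%:R * (a%:R - 1)) * M a.-2 b y + ((b%:R * (b%:R - 1)) * M a b.-2 y +
   (- (a%:R ^+ 2 + b%:R ^+ 2)) * M a b y).
have tF : tame D F by apply: tameD; [|apply: tameD]; apply: tameZ; exact: tM.
have G : - lambda * E (fun y => M a b y * U y) = E (fun y => U y * F y).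
  apply: (@green 0 0 0 a b F tF.1) => y.
  rewrite laplacian_cos_monomial /F /M /cos_monomial.
  have one (k : nat) (x : R) : k%:R * x ^+ k.-1 * (0 - x) + k%:R * k.-1%:R * x ^+ k.-2 * (1 - (x - 0) ^+ 2) =
      k%:R * (k%:R - 1) * x ^+ k.-2 - k%:R ^+ 2 * x ^+ k.
    case: k => [|[|k]] /=; first by ring.
      by rewrite !expr0 !expr1; ring.
    by rewrite -!natr1 !exprS; move: (k%:R : R) (x ^+ k) => *; ring.
  rewrite !one.
  move: (affine_cos 0 ord0 0 y ^+ a) (affine_cos 0 ord_max 0 y ^+ b) (affine_cos 0 ord0 0 y ^+ a.-2) (affine_cos 0 ord_max 0 y ^+ b.-2) (a%:R : R) (b%:R : R) => *.
  by ring.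
transitivity ((a%:R ^+ 2 + b%:R ^+ 2) * E (fun y => M a b y * U y) +
    (- lambda * E (fun y => M a b y * U y))); first by rewrite -mulrDl.
have t1 := tameM (tM a.-2 b) tU; have t2 := tameM (tM a b.-2) tU; have t3 := tameM (tM a b) tU.
rewrite G (_ : E (fun y => U y * F y) = (a%:R * (a%:R - 1)) * E (fun y => M a.-2 b y * U y) +
    ((b%:R * (b%:R - 1)) * E (fun y => M a b.-2 y * U y) +
     (- (a%:R ^+ 2 + b%:R ^+ 2)) * E (fun y => M a b y * U y))).
  by rewrite /M; move: (E _) (E _) (E _) => *; ring.
rewrite -(wintZ mT cw iw _ t1) -(wintZ mT cw iw _ t2) -(wintZ mT cw iw _ t3).
rewrite -(wintD mT cw iw (tameZ _ t2) (tameZ _ t3)).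
rewrite -(wintD mT cw iw (tameZ _ t1) (tameD (tameZ _ t2) (tameZ _ t3))).
by apply: eq_wint => y _; rewrite /F; ring.
Qed.

(** As on the sphere, sin^2 = T (2 - T) for T = 1 + cos, so each exponent drops by one only. The
    phases are free and will place the maximum at any given point. *)
Lemma torus_moment_cap c d a b :
  (a%:R ^+ 2 + b%:R ^+ 2 - lambda) * E (fun y => cos_monomial 1 c d a b y * U y) =
  a%:R * (2 * a%:R - 1) * E (fun y => cos_monomial 1 c d a.-1 b y * U y) +
  b%:R * (2 * b%:R - 1) * E (fun y => cos_monomial 1 c d a b.-1 y * U y).
Proof.
pose M a b := @cos_monomial R 1 c d a b.
have tM a' b' : tame D (M a' b') by exact: tame_cos_monomial.
pose F y := (a%:R * (2 * a%:R - 1)) * M a.-1 b y + ((b%:R * (2 * b%:R - 1)) * M a b.-1 y +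
   (- (a%:R ^+ 2 + b%:R ^+ 2)) * M a b y).
have tF : tame D F by apply: tameD; [|apply: tameD]; apply: tameZ; exact: tM.
have G : - lambda * E (fun y => M a b y * U y) = E (fun y => U y * F y).
  apply: (@green 1 c d a b F tF.1) => y.
  rewrite laplacian_cos_monomial /F /M /cos_monomial.
  have one (k : nat) (x : R) : k%:R * x ^+ k.-1 * (1 - x) + k%:R * k.-1%:R * x ^+ k.-2 * (1 - (x - 1) ^+ 2) =
      k%:R * (2 * k%:R - 1) * x ^+ k.-1 - k%:R ^+ 2 * x ^+ k.
    case: k => [|[|k]] /=; first by ring.
      by rewrite !expr0 !expr1; ring.
    by rewrite -!natr1 !exprS; move: (k%:R : R) (x ^+ k) => *; ring.
  rewrite !one.
  move: (affine_cos 1 ord0 c y ^+ a) (affine_cos 1 ord_max d y ^+ b) (affine_cos 1 ord0 c y ^+ a.-1) (affine_cos 1 ord_max d y ^+ b.-1) (a%:R : R) (b%:R : R) => *.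
  by ring.
transitivity ((a%:R ^+ 2 + b%:R ^+ 2) * E (fun y => M a b y * U y) +
    (- lambda * E (fun y => M a b y * U y))); first by rewrite -mulrDl.
have t1 := tameM (tM a.-1 b) tU; have t2 := tameM (tM a b.-1) tU; have t3 := tameM (tM a b) tU.
rewrite G (_ : E (fun y => U y * F y) = (a%:R * (2 * a%:R - 1)) * E (fun y => M a.-1 b y * U y) +
    ((b%:R * (2 * b%:R - 1)) * E (fun y => M a b.-1 y * U y) +
     (- (a%:R ^+ 2 + b%:R ^+ 2)) * E (fun y => M a b y * U y))).
  by rewrite /M; move: (E _) (E _) (E _) => *; ring.
rewrite -(wintZ mT cw iw _ t1) -(wintZ mT cw iw _ t2) -(wintZ mT cw iw _ t3).
rewrite -(wintD mT cw iw (tameZ _ t2) (tameZ _ t3)).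
rewrite -(wintD mT cw iw (tameZ _ t1) (tameD (tameZ _ t2) (tameZ _ t3))).
by apply: eq_wint => y _; rewrite /F; ring.
Qed.

(** Induction on a + b. The factor a^2 + b^2 - lambda is -lambda for a = b = 0 and positive
    otherwise; a zero exponent comes with coefficient zero. *)
Lemma torus_cap_moments0 c d a b : 0 < lambda < 1 ->
  E (fun y => cos_monomial 1 c d a b y * U y) = 0.
Proof.
move=> /andP[l0 l1]; have [k] := ubnP (a + b); elim: k a b => // k IH a b abk.
have := torus_moment_cap c d a b.
have -> : a%:R * (2 * a%:R - 1) * E (fun y => cos_monomial 1 c d a.-1 b y * U y) = 0.
  case: a abk => [|a] abk; first by rewrite !mul0r.
  by rewrite IH ?mulr0.
have -> : b%:R * (2 * b%:R - 1) * E (fun y => cos_monomial 1 c d a b.-1 y * U y) = 0.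
  case: b abk => [|b] abk; first by rewrite !mul0r.
  by rewrite IH ?mulr0// -ltnS -addnS.
rewrite addr0 => /eqP; rewrite mulf_eq0 => /orP[|/eqP//].
rewrite subr_eq0 => /eqP H; exfalso.
case: a {abk} H => [|a]; first case: b => [|b].
- by rewrite !expr0n/=; lra.
- by rewrite -natr1; have := ler0n R b; nra.
- by rewrite -natr1; have := ler0n R a; have := sqr_ge0 (b%:R : R); nra.
Qed.

End moments.

End torus_spectrum.

(** * The first eigenvalue of the torus *)

Section torus_theorem.
Context (R : realType).
Implicit Types (y : 'rV[R]_2) (u h : torus_point R -> R).
Local Notation T := (torus R).
Local Notation rho := (fun=> 1 : R).
Local Notation E := (@torus_integral R).
Let D : set 'rV[R]_2 := box (fun=> 0) (fun=> 2 * pi).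
Let mT := @torus_measurable R.
Let cw := @continuous_torus_density R.
Let w0 := @torus_density_gt0 R.
Let iw := @integrable_torus_density R.
Let pi0 : 0 < pi :> R := pi_gt0 R.

(** The cosine is close to 1 near every multiple of 2 pi; the bound 2 pi - d on |t| excludes the
    neighbouring periods. For |t| > pi one reflects at pi, and the cosine decreases on [0, pi]. *)
Lemma cos_close (t d : R) : 0 < d < pi -> `|t| < 2 * pi - d -> cos d <= cos t -> `|t| <= d.
Proof.
move=> /andP[d0 dpi] td; apply: contraTT; rewrite -!ltNge => dt.
rewrite (_ : cos t = cos `|t|); last by have [|] := ger0P t; rewrite ?cosN.
have id : d \in `[0, pi] by rewrite in_itv/= !ltW.
have [tpi|tpi] := leP `|t| pi.
  have it : `|t| \in `[0, pi] by rewrite in_itv/= normr_ge0.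
  by rewrite (ltr_cos id it).
have -> : cos `|t| = cos (2 * pi - `|t|).
  by rewrite -[RHS]cosN opprB -[RHS](cos_periodic _ 1) mulr1z mul1r subrK.
have it : 2 * pi - `|t| \in `[0, pi] by rewrite in_itv/=; apply/andP; split; lra.
by rewrite (ltr_cos id it); lra.
Qed.

(** Concentration needs a whole neighbourhood of the point inside the fundamental square. A
    representative reduced modulo 2 pi may lie on an edge, and continuity allows it to be moved
    inwards. *)
Lemma torus_nonzero_interior u : smooth (M := T) u -> u <> cst 0 ->
  exists y, (forall i, 0 < y 0 i < 2 * pi) /\ u (\pi_(torus_point R) y)%qT != 0.
Proof.
move=> su u0.
have [p up] : exists p, u p != 0.
  apply: contrapT => H; apply: u0; apply/funext => p.
  by apply/eqP; apply: contrapT => /negP up; apply: H; exists p.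
pose U y := u (\pi_(torus_point R) y)%qT.
have cU : continuous U by exact: su tt 0%N.
have p2 := pi2_gt0 R.
pose y1 : 'rV[R]_2 := \row_i (repr p 0 i - (Num.floor (repr p 0 i / (2 * pi)))%:~R * (2 * pi)).
have y1D i : 0 <= y1 0 i < 2 * pi.
  have /andP[h1 h2] := floor_itv (repr p 0 i / (2 * pi)).
  rewrite mxE subr_ge0 -ler_pdivlMr// h1/= ltrBlDl -[X in _ < _ + X]mul1r -mulrDl.
  by rewrite -ltr_pdivrMr// -[1 in X in _ < X]/(1%:~R) -intrD.
have U1 : U y1 != 0.
  suff -> : U y1 = u p by [].
  rewrite /U (@torus_pi_eq R y1 (repr p)) ?reprK//; apply/asboolP => i.
  exists (- Num.floor (repr p 0 i / (2 * pi))); rewrite mxE addrAC subrr add0r.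
  by rewrite intrN mulNr.
have e0 : 0 < `|U y1| by rewrite normr_gt0.
have [d d0 Hd] := (continuous_rVP _ _).1 (cU y1) _ e0.
(* Half of the minimum keeps each coordinate below 2 pi and within [d]; it is positive, so the
   coordinate also leaves 0. *)
pose s i := Num.min d (2 * pi - y1 0 i) / 2.
have sP i : [/\ 0 < s i, s i < d & s i < 2 * pi - y1 0 i].
  have /andP[h1 h2] := y1D i.
  have m0 : 0 < Num.min d (2 * pi - y1 0 i) by rewrite lt_min d0 subr_gt0.
  have m1 : Num.min d (2 * pi - y1 0 i) <= d by rewrite ge_min lexx.
  have m2 : Num.min d (2 * pi - y1 0 i) <= 2 * pi - y1 0 i by rewrite ge_min lexx orbT.
  by rewrite /s; split; lra.
pose y2 : 'rV[R]_2 := \row_i (y1 0 i + s i).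
exists y2; split.
  by move=> i; rewrite mxE; have := sP i; have := y1D i => /andP[h1 h2] [h3 h4 h5]; apply/andP; split; lra.
apply/negP => /eqP V0; have : `|U y1 - U y2| < `|U y1|.
  apply: Hd => i; rewrite [y2 0 i]mxE opprD addrA subrr add0r normrN gtr0_norm; by case: (sP i).
by rewrite [U y2]V0 subr0 ltxx.
Qed.

Lemma torus_no_small_eigenvalue (mu : R) : 0 < mu < 1 -> ~ laplace_eigenvalue T mu.
Proof.
move=> mu1 [_ [u [su Lu] u0]].
have [y0 [y0D U0]] := torus_nonzero_interior su u0.
pose U y := u (\pi_(torus_point R) y)%qT.
have cU : continuous U by exact: su tt 0%N.
have tU : tame D U by exact: continuous_torus_tame.
pose e : R := if 0 < U y0 then 1 else -1.
pose c := `|U y0| / 2.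
have c0 : 0 < c by rewrite divr_gt0// normr_gt0.
have eU : e * U y0 = 2 * c.
  rewrite /c [RHS]mulrC divfK// /e; case: ifPn => h; first by rewrite mul1r gtr0_norm.
  by rewrite mulN1r ler0_norm// leNgt.
have ceU : continuous (fun y => e * U y).
  by apply: continuous_mulrV; [exact: cst_continuous|].
have [d d0 Hd] := (continuous_rVP _ _).1 (ceU y0) _ c0.
(* The cube of radius [b] around [y0] fits in the open square, which provides both the neighbourhood
   for [concentration] and the period exclusion for [cos_close]. *)
have [b [b0 bpi bd bD]] : exists b : R, [/\ 0 < b, b < pi, b < d &
    forall i, b < y0 0 i /\ b < 2 * pi - y0 0 i].
  have /andP[a1 a2] := y0D ord0; have /andP[a3 a4] := y0D ord_max.
  pose m := Num.min (Num.min pi d) (Num.min (Num.min (y0 0 ord0) (2 * pi - y0 0 ord0))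
     (Num.min (y0 0 ord_max) (2 * pi - y0 0 ord_max))).
  have m0 : 0 < m by rewrite !lt_min pi0 d0 a1 a3 !subr_gt0 a2 a4.
  have : m <= m by []; rewrite {2}/m !le_min => /andP[/andP[h1 h2]].
  move=> /andP[/andP[h3 h4] /andP[h5 h6]].
  exists (m / 2); split; try lra.
  move=> i; have [->|->] : i = ord0 \/ i = ord_max.
    by case: i => [[|[|//]] ?]; [left|right]; exact: val_inj.
    by split; lra.
  by split; lra.
pose P y := affine_cos 1 ord0 (- y0 0 ord0) y * affine_cos 1 ord_max (- y0 0 ord_max) y.
have PE k y : P y ^+ k = cos_monomial 1 (- y0 0 ord0) (- y0 0 ord_max) k k y.
  by rewrite /P exprMn.
have tP : tame D P.
  rewrite (_ : P = cos_monomial 1 (- y0 0 ord0) (- y0 0 ord_max) 1 1).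
    exact: tame_cos_monomial.
  by apply/funext => y; rewrite -PE expr1.
have A0 i (x : R) y : 0 <= affine_cos 1 i x y <= 2.
  by rewrite /affine_cos /cos_coord; have := cos_geN1 (y 0 i + x); have := cos_le1 (y 0 i + x); lra.
have cb : -1 < cos b < 1.
  by rewrite -{2}cos0 -cospi !ltr_cos ?in_itv/= ?lexx ?ltW// b0 bpi.
(* Both factors of [P] are at most 2, so a product of at least 2 (1 + cos b) forces each of them to
   be at least 1 + cos b. *)
apply: (@concentration R 2 D _ mT cw w0 iw (fun y => e * U y) P y0 (2 * (1 + cos b)) c).
- exact: tameZ.
- exact: tP.
- move=> y _; rewrite /P mulr_ge0//.
    by case/andP: (A0 ord0 (- y0 0 ord0) y).
  by case/andP: (A0 ord_max (- y0 0 ord_max) y).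
- lra.
- by rewrite /P /affine_cos /cos_coord !subrr cos0; lra.
- exists b => // y Hy i; have [h1 h2] := bD i; have := Hy i.
  by rewrite ltr_norml => /andP[h3 h4]; apply/andP; split; lra.
- exact: c0.
- move=> y Dy Py.
  have close i : 1 + cos b <= affine_cos 1 i (- y0 0 i) y -> `|y0 0 i - y 0 i| < d.
    rewrite lerD2l /cos_coord => h; rewrite distrC (le_lt_trans _ bd)//.
    apply: cos_close => //; first by rewrite b0.
    have [h1 h2] := bD i; have /andP[h3 h4] := Dy i.
    by rewrite ltr_norml; apply/andP; split; lra.
  have h0 := A0 ord0 (- y0 0 ord0) y; have h1 := A0 ord_max (- y0 0 ord_max) y.
  have : `|e * U y0 - e * U y| < c.
    apply: Hd => i; have [->|->] : i = ord0 \/ i = ord_max.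
      by case: i => [[|[|//]] ?]; [left|right]; exact: val_inj.
      by apply: close; move: Py; rewrite /P; nra.
    by apply: close; move: Py; rewrite /P; nra.
  by rewrite ltr_norml eU; lra.
- move=> k.
  have tPU := tameM (tameX k tP) tU.
  transitivity (wint D (fun=> 1) (fun y => e * (P y ^+ k * U y))).
    by apply: eq_wint => y _; rewrite mulrCA.
  have m0 : E (fun y => P y ^+ k * U y) = 0.
    rewrite -(torus_cap_moments0 su Lu (- y0 0 ord0) (- y0 0 ord_max) k k mu1).
    by apply: eq_wint => y _; rewrite PE.
  by rewrite (wintZ mT cw iw _ tPU) [X in _ * X]m0 mulr0.
Qed.

Lemma torus_lambda1 : lambda1 T = 1.
Proof.
apply: lambda1E => //; last exact: torus_no_small_eigenvalue.
split=> //; pose F : 'rV[R]_2 -> R := cos_monomial 0 0 0 1 0.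
have pF : periodic_rV F by exact: periodic_cos_monomial.
exists (torus_lift F).
  split=> [a k|a y]; first by rewrite torus_lift_comp//; exact: Ck_cos_monomial.
  rewrite laplacian_torusE torus_lift_comp// laplacian_cos_monomial.
  rewrite (_ : torus_lift F _ = F y); last exact: torus_liftE.
  by rewrite /F /cos_monomial !expr0 /=; ring.
move=> /(congr1 (fun f => f (\pi_(torus_point R) (0 : 'rV[R]_2))%qT)).
rewrite torus_liftE// /F /cos_monomial /affine_cos /cos_coord !mxE addr0 cos0 => /eqP.
by rewrite expr1 expr0 mulr1 add0r oner_eq0.
Qed.

End torus_theorem.

(** * The example on the torus *)

Section torus_example.
Context (R : realType).
Local Notation T := (torus R).
Local Notation rho := (fun=> 1 : R).
Local Notation E := (@torus_integral R).
Let D : set 'rV[R]_2 := box (fun=> 0) (fun=> 2 * pi).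
Let mT := @torus_measurable R.
Let cw := @continuous_torus_density R.
Let w0 := @torus_density_gt0 R.
Let iw := @integrable_torus_density R.
Let pi0 : 0 < pi :> R := pi_gt0 R.
Let r0 (y : 'rV[R]_(Defs.dim T)) : 0 < rho y :> R. Proof. by []. Qed.

Let X (y : 'rV[R]_2) : R := affine_cos 0 ord0 0 y.
Let Y (y : 'rV[R]_2) : R := affine_cos 0 ord_max 0 y.
Let M a b : 'rV[R]_2 -> R := cos_monomial 0 0 0 a b.
Let m a b : R := E (M a b).
Let tM a b : tame D (M a b). Proof. exact: tame_cos_monomial. Qed.

(** A polynomial in cos x and cos y as a list of coefficients and exponent pairs, so that integrals
    and derivatives reduce to those of monomials by computation on the list. *)
Let trig_poly (l : seq (R * (nat * nat))) (y : 'rV[R]_2) : R :=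
  \sum_(t <- l) t.1 * M t.2.1 t.2.2 y.

Let Ck_trig_poly k l : Ck k (trig_poly l).
Proof. by apply: Ck_sum => t; apply: CkZ; exact: Ck_cos_monomial. Qed.

Let periodic_trig_poly l : periodic_rV (trig_poly l).
Proof. by move=> x y xy; apply: eq_bigr => t _; rewrite /M (periodic_cos_monomial _ _ _ _ _ xy). Qed.

Let trig_polyM l (h : 'rV[R]_2 -> R) : tame D h ->
  E (fun y => trig_poly l y * h y) = \sum_(t <- l) t.1 * E (fun y => M t.2.1 t.2.2 y * h y).
Proof.
move=> th; elim: l => [|t l IH].
  rewrite big_nil -[RHS](mul0r (E (cst 0))) -(wintZ mT cw iw 0 (tame_cst D 0)).
  by apply: eq_wint => y _; rewrite /trig_poly big_nil !mul0r.
rewrite big_cons -IH.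
have t1 := tameM (tM t.2.1 t.2.2) th.
have t2 : tame D (fun y => trig_poly l y * h y).
  by apply: tameM => //; exact: Ck_torus_tame (Ck_trig_poly 0 l).
rewrite -(wintZ mT cw iw _ t1) -(wintD mT cw iw (tameZ _ t1) t2).
by apply: eq_wint => y _; rewrite /trig_poly big_cons mulrDl mulrA.
Qed.

Let integral_trig_poly l : E (trig_poly l) = \sum_(t <- l) t.1 * m t.2.1 t.2.2.
Proof.
transitivity (E (fun y => trig_poly l y * cst 1 y)).
  by apply: eq_wint => y _; rewrite /cst mulr1.
rewrite trig_polyM; last exact: tame_cst.
apply: eq_bigr => t _; congr (_ * _).
by apply: eq_wint => y _; rewrite /cst mulr1.
Qed.

Let moment a b : (a%:R ^+ 2 + b%:R ^+ 2) * m a b =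
  a%:R * (a%:R - 1) * m a.-2 b + b%:R * (b%:R - 1) * m a b.-2.
Proof.
have s1 : smooth (M := T) (fun=> 1 : R) by move=> s j; exact: Ck_cst.
have L1 (c : chart T) y : laplacian (M := T) (fun=> 1 : R) c y = - 0 * 1.
  rewrite laplacian_torusE.
  have -> : (fun=> 1 : R) \o @param _ T c = cos_monomial 0 0 0 0 0.
    by apply/funext => z; rewrite /cos_monomial !expr0 /= mulr1.
  by rewrite laplacian_cos_monomial; ring.
have := torus_moment_cos s1 L1 a b.
have X1 i j : E (fun y => cos_monomial 0 0 0 i j y * 1) = m i j.
  by apply: eq_wint => y _; rewrite mulr1.
by rewrite !X1 subr0.
Qed.

Let m0_gt0 : 0 < m 0 0.
Proof.
apply: (wint_gt0 mT cw w0 iw (y0 := const_mx pi) (tM 0 0)).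
- by move=> y _; rewrite /M /cos_monomial !expr0 mulr1.
- by rewrite /M /cos_monomial !expr0 mulr1.
- exists pi => // y Hy i; have := Hy i; rewrite mxE ltr_norml => /andP[h1 h2].
  by apply/andP; split; lra.
Qed.

(** Minus the sine of the first coordinate, as it arises from differentiating its cosine. *)
Let SX := @cos_coord R 2 ord0 (0 + pi / 2).
Let SY := @cos_coord R 2 ord_max (0 + pi / 2).

Let sqr_SX y : SX y ^+ 2 = 1 - X y ^+ 2.
Proof.
rewrite /SX /X /affine_cos /cos_coord !add0r addr0 cosDpihalf sqrrN.
by rewrite sin2cos2.
Qed.

Let sqr_SY y : SY y ^+ 2 = 1 - Y y ^+ 2.
Proof.
rewrite /SY /Y /affine_cos /cos_coord !add0r addr0 cosDpihalf sqrrN.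
by rewrite sin2cos2.
Qed.

Let partial_monomial i a b y : partial i (M a b) y =
  (ord0 == i)%:R * SX y * (a%:R * X y ^+ a.-1 * Y y ^+ b) +
  (ord_max == i)%:R * SY y * (b%:R * X y ^+ a * Y y ^+ b.-1).
Proof.
have dX z : derivable X z (delta_mx 0 i) := @Ck_derivable _ _ 0 _ i z (Ck_affine_cos 1 0 ord0 0).
have dY z : derivable Y z (delta_mx 0 i) := @Ck_derivable _ _ 0 _ i z (Ck_affine_cos 1 0 ord_max 0).
have [dX1 dX2] := partialX a dX; have [dY1 dY2] := partialX b dY.
rewrite (partialM dX1 dY1) dX2 dY2 !partial_affine_cos -/(SX y) -/(SY y) -/(X y) -/(Y y).
by set d1 : R := (ord0 == i)%:R; set d2 : R := (ord_max == i)%:R; ring.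
Qed.

Let partial_trig_poly i l y : partial i (trig_poly l) y =
  \sum_(t <- l) t.1 * partial i (M t.2.1 t.2.2) y.
Proof.
have dM a b z : derivable (M a b) z (delta_mx 0 i) := @Ck_derivable _ _ 0 _ i z (Ck_cos_monomial 1 0 0 0 a b).
have dt (t : R * (nat * nat)) z : derivable (fun y => t.1 * M t.2.1 t.2.2 y) z (delta_mx 0 i).
  exact: derivableM (derivable_cst _ _ _) (dM _ _ z).
rewrite [LHS](congr1 (fun f => f y) (partial_sum l dt).2).
by apply: eq_bigr => t _; rewrite (partialZ _ (dM _ _)).
Qed.

Lemma torus_case : exists f phi : torus_point R -> R,
    [/\ smooth (M := T) f,
        forall x, 0 < f x,
        forall u, laplace_eigenspace (M := T) (lambda1 T) u -> orthoL2 (M := T) f u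
      & [/\ smooth (M := T) phi,
            integralM (M := T) (fun x => f x * phi x) = 0
          & dirichlet (M := T) phi < lambda1 T * integralM (M := T) (fun x => phi x ^+ 2)]].
Proof.
rewrite torus_lambda1.
have m00 := m0_gt0.
have m11 : m 1 1 = 0 by have := moment 1 1; rewrite /=; lra.
have m20 : m 2 0 = m 0 0 / 2 by have := moment 2 0; rewrite /=; lra.
have m02 : m 0 2 = m 0 0 / 2 by have := moment 0 2; rewrite /=; lra.
have m22 : m 2 2 = m 0 0 / 4 by have := moment 2 2; rewrite /= m20 m02; lra.
have m31 : m 3 1 = 0 by have := moment 3 1; rewrite /= m11; lra.
have m13 : m 1 3 = 0 by have := moment 1 3; rewrite /= m11; lra.
have m40 : m 4 0 = m 0 0 * 3 / 8 by have := moment 4 0; rewrite /= m20; lra.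
have m04 : m 0 4 = m 0 0 * 3 / 8 by have := moment 0 4; rewrite /= m02; lra.
have sumE (l : seq (R * (nat * nat))) (g : nat -> nat -> R) :
    \sum_(t <- l) t.1 * g t.2.1 t.2.2 = foldr (fun t s => t.1 * g t.2.1 t.2.2 + s) 0 l.
  by elim: l => [|t l IH]; [rewrite big_nil|rewrite big_cons IH].
(* The mean of phi is 25 and that of (X + Y)^2 phi is 33 - 24 - 10 = -1, which dictates the constant
   1/25. *)
pose lf : seq (R * (nat * nat)) :=
  [:: (1 : R, (2, 0)%N); (2 : R, (1, 1)%N); (1 : R, (0, 2)%N); (25^-1 : R, (0, 0)%N)].
(* This is phi = 25 - 48 cos x cos y - 4 cos 2x - 4 cos 2y. The second harmonics raise the value of
   c allowed by (X + Y)^2 from 24 to 26, while the energy inequality becomes c^2 > 624; c = 25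
   satisfies both. *)
pose lphi : seq (R * (nat * nat)) :=
  [:: (33 : R, (0, 0)%N); (-48 : R, (1, 1)%N); (-8 : R, (2, 0)%N); (-8 : R, (0, 2)%N)].
have fE y : trig_poly lf y = (X y + Y y) ^+ 2 + 25^-1.
  rewrite /trig_poly (sumE lf (fun a b => M a b y)) /= /M /cos_monomial -/(X y) -/(Y y).
  by move: (X y) (Y y) => x z; ring.
have phiE y : trig_poly lphi y = 33 - 48 * X y * Y y - 8 * X y ^+ 2 - 8 * Y y ^+ 2.
  rewrite /trig_poly (sumE lphi (fun a b => M a b y)) /= /M /cos_monomial -/(X y) -/(Y y).
  by move: (X y) (Y y) => x z; ring.
have pf := periodic_trig_poly lf; have pphi := periodic_trig_poly lphi.
exists (torus_lift (trig_poly lf)), (torus_lift (trig_poly lphi)).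
have sphi : smooth (M := T) (torus_lift (trig_poly lphi)).
  by move=> a k; rewrite torus_lift_comp.
split=> //.
- by move=> a k; rewrite torus_lift_comp.
- by move=> x; rewrite /torus_lift fE ltr_wpDl ?sqr_ge0// invr_gt0.
- move=> u [su Lu]; rewrite /orthoL2 integralM_torus.
  pose U y := u (\pi_(torus_point R) y)%qT.
  have tU : tame D U by exact: continuous_torus_tame (su tt 0%N).
  (* For eigenvalue 1 the factor a^2 + b^2 - 1 vanishes only at exponents (1,0) and (0,1), which do
     not occur in the recursion for the monomials of f. *)
  have mom a b := torus_moment_cos su Lu a b.
  pose mu a b := E (fun y => M a b y * U y).
  have mu00 : mu 0%N 0%N = 0 by have := mom 0%N 0%N; rewrite -/(mu 0%N 0%N) /=; lra.
  have mu11 : mu 1%N 1%N = 0.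
    have := mom 1%N 1%N; rewrite -/(mu 1%N 1%N) -/(mu 0%N 1%N) -/(mu 1%N 0%N) /=; lra.
  have mu20 : mu 2%N 0%N = 0.
    have := mom 2%N 0%N; rewrite -/(mu 2%N 0%N) -/(mu 0%N 0%N) mu00 /=; lra.
  have mu02 : mu 0%N 2%N = 0.
    have := mom 0%N 2%N; rewrite -/(mu 0%N 2%N) -/(mu 0%N 0%N) mu00 /=; lra.
  transitivity (E (fun y => trig_poly lf y * U y)).
    by apply: eq_wint => y _; rewrite torus_liftE.
  rewrite (trig_polyM lf tU) (sumE lf mu) /= mu00 mu11 mu20 mu02.
  by rewrite !mulr0 !addr0.
split=> //.
- rewrite integralM_torus.
  pose l : seq (R * (nat * nat)) :=
    [:: (33 - 8 / 25 : R, (2, 0)%N); (33 - 8 / 25 : R, (0, 2)%N); (66 - 48 / 25 : R, (1, 1)%N);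
        (-64 : R, (3, 1)%N); (-64 : R, (1, 3)%N); (-8 : R, (4, 0)%N); (-8 : R, (0, 4)%N);
        (-112 : R, (2, 2)%N); (33 / 25 : R, (0, 0)%N)].
  transitivity (E (trig_poly l)).
    apply: eq_wint => y _; rewrite !torus_liftE// fE phiE.
    rewrite /trig_poly (sumE l (fun a b => M a b y)) /= /M /cos_monomial -/(X y) -/(Y y).
    by move: (X y) (Y y) => x z; field.
  rewrite integral_trig_poly (sumE l m) /= m11 m20 m02 m22 m31 m13 m40 m04.
  by move: (m 0 0) => z; field.
(* In terms of the harmonics the mean of phi^2 is 625 + 576 + 16, from the constant, cos x cos y,
   and the second harmonics. *)
have -> : integralM (M := T) (fun x => torus_lift (trig_poly lphi) x ^+ 2) = 1217 * m 0 0.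
  rewrite integralM_torus.
  pose l : seq (R * (nat * nat)) :=
    [:: (1089 : R, (0, 0)%N); (2432 : R, (2, 2)%N); (64 : R, (4, 0)%N); (64 : R, (0, 4)%N);
        (-3168 : R, (1, 1)%N); (-528 : R, (2, 0)%N); (-528 : R, (0, 2)%N); (768 : R, (3, 1)%N);
        (768 : R, (1, 3)%N)].
  transitivity (E (trig_poly l)).
    apply: eq_wint => y _; rewrite torus_liftE// phiE.
    rewrite /trig_poly (sumE l (fun a b => M a b y)) /= /M /cos_monomial -/(X y) -/(Y y).
    by move: (X y) (Y y) => x z; ring.
  rewrite integral_trig_poly (sumE l m) /= m11 m20 m02 m22 m31 m13 m40 m04.
  by move: (m 0 0) => z; field.
(* The same squared norms weighted by the eigenvalues 0, 2 and 4 give 1152 + 64, one less than the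
   mean of phi^2. *)
have -> : dirichlet (M := T) (torus_lift (trig_poly lphi)) = 1216 * m 0 0.
  pose l : seq (R * (nat * nat)) :=
    [:: (2560 : R, (2, 0)%N); (2560 : R, (0, 2)%N); (3072 : R, (1, 1)%N); (-4608 : R, (2, 2)%N);
        (-1536 : R, (3, 1)%N); (-1536 : R, (1, 3)%N); (-256 : R, (4, 0)%N); (-256 : R, (0, 4)%N)].
  transitivity (E (trig_poly l)); last first.
    rewrite integral_trig_poly (sumE l m) /= m11 m20 m02 m22 m31 m13 m40 m04.
    by move: (m 0 0) => z; field.
  rewrite /dirichlet /integral_coord /torus_integral /wint; congr (integral_rV _ _).
  apply/funext => y; rewrite (volume_densityE r0 (@torus_metricE R)) expr1n; congr (_ * _).
  rewrite (grad_norm2E r0 (@torus_metricE R)) expr1n invr1 mul1r torus_lift_comp//.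
  rewrite big_ord_recl big_ord1 !partial_trig_poly.
  rewrite (_ : lift ord0 ord0 = ord_max :> 'I_2); last exact: val_inj.
  rewrite (sumE lphi (fun a b => partial ord0 (M a b) y)).
  rewrite (sumE lphi (fun a b => partial ord_max (M a b) y)) /= !partial_monomial.
  rewrite /trig_poly (sumE l (fun a b => M a b y)) /= /M /cos_monomial -/(X y) -/(Y y).
  have := sqr_SX y; have := sqr_SY y.
  move: (SX y) (SY y) (X y) (Y y) => s t x z t2 s2.
  transitivity (s ^+ 2 * (48 * z + 16 * x) ^+ 2 + t ^+ 2 * (48 * x + 16 * z) ^+ 2).
    by ring.
  by rewrite s2 t2; ring.
by rewrite mul1r ltr_pM2r// ltr_nat.
Qed.

End torus_example.

Theorem mainTheorem2 (R : realType) (M : riemannian R)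
    (hM : (exists2 n : nat, (2 <= n)%N & M = sphere R n) \/ M = torus R) :
  exists f phi : carrier M -> R,
    [/\ smooth f,
        forall p, 0 < f p,
        forall u, laplace_eigenspace (lambda1 M) u -> orthoL2 f u
      & [/\ smooth phi,
            integralM (fun p => f p * phi p) = 0
          & dirichlet phi < lambda1 M * integralM (fun p => phi p ^+ 2)]].
Proof.
case: hM => [[n n2 ->]|->]; first exact: sphere_case.
exact: torus_case.
Qed.
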